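(* Let $\Omega$ be an open subset of $\mathbb{R}^d$, $L\in(0,1)$, $T>0$, $\varepsilon>0$, and let $A:D(A)\to L^2(\Omega)$ be an operator generating a $C_0$ semigroup $(S_t)_{t\ge0}$ on $L^2(\Omega)$. Let $y_0,y_f\in L^2(\Omega)$ satisfy $y_f\ge S_Ty_0$. Assume that $A^\ast$ satisfies property (GUC) and that $\partial_t-A^\ast$ is analytic-hypoelliptic (both defined in the context). Consider, for the cost function $F_T$ defined in the context, the primal problem $$\pi=\inf_{u\in E}\big\{F_T(u)+\delta_{\overline B(y_f-S_Ty_0,\varepsilon)}(L_Tu)\big\}$$ and its dual problem $$d=-\inf_{p_f\in L^2(\Omega)}J_{T,\varepsilon}(p_f),\qquad J_{T,\varepsilon}(p_f)=\frac12\Big(\int_0^T\sigma_{\overline{\mathcal U}_L}\big((L_T^\ast p_f)(t)\big)\,dt\Big)^2-\langle y_f-S_Ty_0,p_f\rangle_{L^2}+\varepsilon\|p_f\|_{L^2}.$$ Then: (1) the strong duality $\pi=d$ holds; (2) the dual problem is attained at a unique minimiser $p_f^\star\in L^2(\Omega)$ of $J_{T,\varepsilon}$; (3) there exists a unique optimal control $u^\star\in E$ for the primal problem. Furthermore, the optimal control is given by $$u^\star(t,\cdot)=\overline M\,\chi_{\{p^\star(t,\cdot)>h(p^\star(t,\cdot))\}},\qquad \overline M=\int_0^T\int_{\{p^\star(t,\cdot)>h(p^\star(t,\cdot))\}}p^\star(t,x)\,dx\,dt,$$ where $p^\star=L_T^\ast p_f^\star$ is the solution of the adjoint equation $p_t+A^\ast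 p=0$ satisfying $p^\star(T)=p_f^\star$.
   Context: $E=L^2((0,T)\times\Omega)$. $L_T:E\to L^2(\Omega)$ is the bounded operator $L_Tu=\int_0^TS_{T-t}u(t)\,dt$, whose adjoint is $(L_T^\ast p_f)(t)=S_{T-t}^\ast p_f$, i.e. $p=L_T^\ast p_f$ solves $p_t+A^\ast p=0$, $p(T)=p_f$. (The solution of $y_t-Ay=u$, $y(0)=y_0$ satisfies $y(T)=S_Ty_0+L_Tu$.) $\overline B(z,\varepsilon)$ is the closed ball in $L^2(\Omega)$ of centre $z$ and radius $\varepsilon$, and $\delta_C$ is the convex indicator function of a set $C$ ($0$ on $C$, $+\infty$ outside). $|\cdot|$ denotes Lebesgue measure and $\chi_\omega$ the characteristic function of $\omega$. $\overline{\mathcal U}_L=\{u\in L^2(\Omega):\ 0\le u\le1 \text{ and }\int_\Omega u\le L|\Omega|\}$, and $\sigma_{\overline{\mathcal U}_L}(v)=\sup_{u\in\overline{\mathcal U}_L}\int_\Omega uv$ for $v\in L^2(\Omega)$. Cost: for $u\in E$, $$F_T(u)=\frac12\sup_{t\in[0,T]}\max\Big(\|u(t,\cdot)\|_{L^\infty(\Omega)},\frac{\|u(t,\cdot)\|_{L^1(\Omega)}}{L|\Omega|}\Big)^2+\delta_{\{u\ge0\}}(u),$$ where the supremum over $t$ is the essential supremum. For $v\in L^2(\Omega)$: $\Phi_v(r)=|\{v>r\}|$, $\Phi_v^{-1}(s)=\inf\{r\in\mathbb{R}:\ \Phi_v(r)\le s\}$, and $h(v)=\max(0,\Phi_v^{-1}(L|\Omega|))$.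 $A^\ast$ satisfies (GUC): for every $y\in L^2(\Omega)$, if there exists $t\in(0,T)$ such that $S_t^\ast y$ is constant over $\Omega$, then $y=0$. $\partial_t-A^\ast$ is analytic-hypoelliptic: any distributional solution $y$ to $\partial_ty-A^\ast y=f$ on $\Omega\times(0,T)$ with $f$ analytic in $\Omega$ is analytic in $\Omega$, where analyticity refers to real-analyticity.
   Formalization: Ω is also assumed connected and |Ω| finite; without these the claim fails (two intervals with Neumann and Dirichlet conditions; the harmonic oscillator on ℝ^d). ''Analytic in Ω'' is read as analytic in x, locally uniformly in t. *)

(* Defs.v *)
From HB Require Import structures.
From mathcomp Require Import all_boot all_order all_algebra.
From mathcomp Require Import all_classical all_reals all_analysis.
From mathcomp Require Import ess_sup_inf measurable_realfun lra.

Set Implicit Arguments.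
Unset Strict Implicit.
Unset Printing Implicit Defensive.

Import Order.TTheory GRing.Theory Num.Theory.
Import numFieldNormedType.Exports.
Local Open Scope classical_set_scope.
Local Open Scope ring_scope.

Definition borel_display : measure_display. Proof. exact. Qed.
Section borel_rV.
Context (R : realType) (d : nat).
Let borel := <<s (@open 'rV[R]_d) >>.
Let borel0 : borel set0. Proof. exact: sigma_algebra0. Qed.
Let borelC A : borel A -> borel (~` A). Proof. exact: sigma_algebraC. Qed.
Let borelU (F : (set 'rV[R]_d)^nat) :
  (forall i, borel (F i)) -> borel (\bigcup_i F i).
Proof. exact: sigma_algebra_bigcup. Qed.
HB.instance Definition _ := @isMeasurable.Build borel_display
  'rV[R]_d borel borel0 borelC borelU.
End borel_rV.

Lemma open_measurable_rV (R : realType) d (O : set 'rV[R]_d) :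
  open O -> measurable O.
Proof. exact: sub_sigma_algebra. Qed.


Section lebesgue_rV.
Context (R : realType).

Definition rV_cons d (z : R * 'rV[R]_d) : 'rV[R]_d.+1 :=
  \row_i (if unlift ord0 i is Some j then z.2 ord0 j else z.1).

Definition rV_uncons d (x : 'rV[R]_d.+1) : R * 'rV[R]_d :=
  (x ord0 ord0, \row_j x ord0 (lift ord0 j)).

Lemma rV_consK d : cancel (@rV_cons d) (@rV_uncons d).
Proof.
move=> [a v]; rewrite /rV_uncons !mxE/= unlift_none; congr pair.
by apply/rowP => j; rewrite !mxE liftK.
Qed.

Lemma rV_unconsK d : cancel (@rV_uncons d) (@rV_cons d).
Proof.
by move=> x; apply/rowP => i; rewrite !mxE/=; case: unliftP => [j|] ->;
  rewrite ?mxE.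
Qed.

Lemma rV_cons_ball d (c : 'rV[R]_d.+1) e : 0 < e ->
  @rV_cons d @^-1` ball c e =
  ball (rV_uncons c).1 e `*` ball (rV_uncons c).2 e.
Proof.
move=> e0; apply/seteqP; split => [[a v]|[a v]].
- move=> [_ cav]; split => /=.
    by have := cav ord0 ord0; rewrite mxE unlift_none.
  by split=> // i j; have := cav ord0 (lift ord0 j); rewrite !mxE liftK (ord1 i).
- move=> [/= ca [_ cv]]; split=> // i j.
  rewrite mxE/= (ord1 i); case: unliftP => [k|] -> //.
  by have := cv ord0 k; rewrite mxE.
Qed.

Lemma open_bigcup_ball_rV n (U : set 'rV[R]_n) : open U ->
  U = \bigcup_(k : 'rV[rat]_n * rat)
    (if `[< 0 < k.2 /\ ball (map_mx ratr k.1 : 'rV[R]_n) (ratr k.2) `<=` U >]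
     then ball (map_mx ratr k.1 : 'rV[R]_n) (ratr k.2) else set0).
Proof.
move=> oU; apply/seteqP; split=> [x Ux|x [k _]]; last first.
  by case: asboolP => // -[_]; exact.
have /nbhs_ballP[e /= e0 xeU] : nbhs x U by exact: open_nbhs_nbhs.
have e20 : 0 < e / 2 by rewrite divr_gt0.
have [q] := rat_in_itvoo e20.
rewrite in_itv/= => /andP[q0 qe].
have H j : exists p : rat, ball (x ord0 j) (ratr q) (ratr p : R).
  have : x ord0 j - ratr q < x ord0 j + ratr q by rewrite ltrD2l gtrN.
  move=> /rat_in_itvoo[p xp]; exists p; rewrite ball_itv. done.
pose c : 'rV[rat]_n := \row_j projT1 (cid (H j)).
have xc : ball x (ratr q) (map_mx ratr c).
  by split => // i j; rewrite !mxE (ord1 i); exact: (projT2 (cid (H j))).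
exists (c, q) => //=; case: asboolP => [_|]; first exact: ball_sym.
case; split=> [|y cy]; first by rewrite -(ltr0q R).
by apply: xeU; apply: le_ball (ball_triangle xc cy); lra.
Qed.

Lemma measurable_rV_cons d : measurable_fun setT (@rV_cons d).
Proof.
apply: (@measurability _ _ _ _ setT (@rV_cons d) (@open 'rV[R]_d.+1)) => //.
move=> _ [U oU <-]; rewrite setTI (open_bigcup_ball_rV oU) preimage_bigcup.
apply: countable_bigcupT_measurable; first exact: countableP.
move=> k; case: asboolP => [[k0 _]|_]; last by rewrite preimage_set0.
rewrite rV_cons_ball ?ltr0q//; apply: measurableX.
  by rewrite ball_itv; exact: measurable_itv.
by apply: open_measurable_rV; apply: ball_open; rewrite ltr0q.
Qed.

Lemma continuous_measurable_rV n m (f : 'rV[R]_n -> 'rV[R]_m) :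
  continuous f -> measurable_fun setT f.
Proof.
move=> /continuousP cf; apply: (@measurability _ _ _ _ setT f open) => //.
move=> _ [U oU <-]; rewrite setTI. apply: open_measurable_rV; exact: cf.
Qed.

Lemma measurable_rV_uncons d : measurable_fun setT (@rV_uncons d).
Proof.
apply: measurable_fun_pair; last first.
  apply: continuous_measurable_rV => x A /nbhs_ballP[e /= e0 xeA].
  apply/nbhs_ballP; exists e => //= y [_ xy]; apply: xeA.
  by split=> // i j; rewrite !mxE; exact: xy.
apply: (measurability _ (RGenOpens.measurableE R)) => _ [_ [a [b ->] <-]].
rewrite setTI; apply: open_measurable_rV.
by apply: open_comp => [x _|]; [exact: coord_continuous|exact: interval_open].
Qed.


Section step.
Context d (mu : {sigma_finite_measure set 'rV[R]_d -> \bar R}).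

Definition lebesgue_rV_step : set 'rV[R]_d.+1 -> \bar R :=
  pushforward (lebesgue_measure \x mu)%E (@rV_cons d).

Let step0 : lebesgue_rV_step set0 = 0%E.
Proof. by rewrite /lebesgue_rV_step /pushforward preimage_set0 measure0. Qed.

Let step_ge0 A : (0 <= lebesgue_rV_step A)%E.
Proof. exact: (measure_ge0 (lebesgue_measure \x mu)%E). Qed.

Let step_sigma_additive : semi_sigma_additive lebesgue_rV_step.
Proof.
have mcons A : measurable A -> measurable (@rV_cons d @^-1` A).
  by move=> mA; rewrite -[X in measurable X]setTI; exact: measurable_rV_cons.
move=> F mF tF mUF; rewrite /lebesgue_rV_step /pushforward preimage_bigcup.
apply: measure_semi_sigma_additive => [n||]; first exact: mcons.
  apply/trivIsetP => i j _ _ ij; rewrite -preimage_setI.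
  by move/trivIsetP : tF => /(_ _ _ _ _ ij) ->//; rewrite preimage_set0.
by rewrite -preimage_bigcup; exact: mcons.
Qed.

HB.instance Definition _ := isMeasure.Build _ _ _ lebesgue_rV_step
  step0 step_ge0 step_sigma_additive.

Let step_sigma_finite : sigma_finite setT lebesgue_rV_step.
Proof.
have /sigma_finiteP[F [TF ndF Foo]] := sigma_finiteT (@lebesgue_measure R).
have /sigma_finiteP[G [TG ndG Goo]] := sigma_finiteT mu.
exists (fun n => @rV_uncons d @^-1` (F n `*` G n)) => [|n].
  apply/esym; rewrite -subTset => x _.
  have [n _ Fn] : (\bigcup_n F n) (rV_uncons x).1 by rewrite -TF.
  have [m _ Gm] : (\bigcup_n G n) (rV_uncons x).2 by rewrite -TG.
  exists (maxn n m) => //; split.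
    by move: Fn; exact/subsetPset/ndF/leq_maxl.
  by move: Gm; exact/subsetPset/ndG/leq_maxr.
have [[mF Fn] [mG Gn]] := (Foo n, Goo n); split.
  by rewrite -[X in measurable X]setTI; apply: measurable_rV_uncons => //;
    exact: measurableX.
rewrite /lebesgue_rV_step /pushforward -comp_preimage.
rewrite (_ : _ \o _ = id); last by apply/funext => z; exact: rV_consK.
by rewrite preimage_id product_measure1E// lte_mul_pinfty// ge0_fin_numE.
Qed.

HB.instance Definition _ :=
  Measure_isSigmaFinite.Build _ _ _ lebesgue_rV_step step_sigma_finite.

End step.

Fixpoint lebesgue_rV d : {sigma_finite_measure set 'rV[R]_d -> \bar R} :=
  match d with
  | 0%N => dirac (0 : 'rV[R]_0)
  | d'.+1 => lebesgue_rV_step (lebesgue_rV d')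
  end.

Lemma lebesgue_rV_box d (a b : 'rV[R]_d) : (forall i, a ord0 i <= b ord0 i) ->
  lebesgue_rV d [set x | forall i, a ord0 i < x ord0 i < b ord0 i] =
  (\prod_i (b ord0 i - a ord0 i))%:E.
Proof.
elim: d a b => [a b _|d IH a b ab].
  rewrite big_ord0 /= diracE mem_set//= => -[].
  by move=> ?.
pose a' := (rV_uncons a).2; pose b' := (rV_uncons b).2.
have ab' i : a' ord0 i <= b' ord0 i by rewrite !mxE.
pose B := [set x : 'rV[R]_d | forall i, a' ord0 i < x ord0 i < b' ord0 i].
have mB : measurable B.
  have -> : B = \bigcap_(i in [set: 'I_d])
      ((fun x : 'rV[R]_d => x ord0 i) @^-1` `]a' ord0 i, b' ord0 i[).
    by apply/seteqP; split=> [x Bx i _|x Bx i]; have := Bx i;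
      rewrite /= in_itv/=; [exact|move=> /(_ I)].
  apply: fin_bigcap_measurable => // i _; apply: open_measurable_rV.
  by apply: open_comp => [x _|]; [exact: coord_continuous|exact: interval_open].
rewrite [LHS]/= /lebesgue_rV_step /pushforward.
set P := (X in (_ \x _)%E X).
have -> : P = (`]a ord0 ord0, b ord0 ord0[%classic `*` B).
  apply/seteqP; split=> [[s x] /= sx|[s x] [/= sab Bx] i].
    split=> [|i]; first by have := sx ord0; rewrite mxE unlift_none in_itv.
    by have := sx (lift ord0 i); rewrite !mxE liftK.
  rewrite mxE; case: unliftP => [j|] -> /=; last by move: sab; rewrite in_itv.
  by have := Bx j; rewrite !mxE.
have mI : measurable `]a ord0 ord0, b ord0 ord0[%classic.
  exact: measurable_itv.
transitivity (lebesgue_measure `]a ord0 ord0, b ord0 ord0[%classic *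
    lebesgue_rV d B)%E; first exact: product_measure1E.
rewrite [X in (_ * X)%E](IH a' b' ab') lebesgue_measure_itv/= lte_fin.
rewrite big_ord_recl.
have E : \prod_i (b' ord0 i - a' ord0 i) =
  \prod_(i < d) (b ord0 (lift ord0 i) - a ord0 (lift ord0 i)).
  by apply: eq_bigr => i _; rewrite !mxE.
rewrite E; case: ltP => [_|ba]; first by rewrite -EFinB -EFinM.
have /eqP -> : b ord0 ord0 == a ord0 ord0 by rewrite eq_le ba ab.
by rewrite subrr mul0r mul0e.
Qed.
End lebesgue_rV.

Definition convex_indicator {R : realType} (V : Type) (C : set V) (v : V) :
  \bar R := if `[< C v >] then 0%E else +oo%E.

Definition is_minimiser (R : realType) (V : Type) (C : set V)
  (J : V -> \bar R) (v : V) := C v /\ forall w, C w -> (J v <= J w)%E.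

(* Elements of L^2(mu) are represented by functions X -> R in `Lfun mu 2%:E`;
   operators act on representatives and all identities in L^2 are stated
   mu-almost everywhere. *)
Section operators.
Context (dX : measure_display) (X : measurableType dX) (R : realType).
Variable mu : {measure set X -> \bar R}.

Definition L2 : set (X -> R) := [set f | f \in Lfun mu 2%:E].

Definition Lp_norm (p : \bar R) (f : X -> R) : \bar R :=
  ('N[mu]_p[EFin \o f])%E.

Definition inner (f g : X -> R) : R := \int[mu]_x (f x * g x).

Record bounded_operator (B : (X -> R) -> (X -> R)) : Prop := BoundedOperator {
  bounded_operator_L2 : forall f, L2 f -> L2 (B f) ;
  bounded_operator_ae : forall f g, L2 f -> L2 g ->
    f = g %[ae mu] -> B f = B g %[ae mu] ;
  bounded_operator_linear : forall (a : R) f g, L2 f -> L2 g ->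
    B (fun x => a * f x + g x) = (fun x => a * B f x + B g x) %[ae mu] ;
  bounded_operator_bound : exists C : R, forall f, L2 f ->
    (Lp_norm 2%:E (B f) <= C%:E * Lp_norm 2%:E f)%E }.

Record C0_semigroup (S : R -> (X -> R) -> (X -> R)) : Prop := C0Semigroup {
  C0_semigroup_bounded : forall t, 0 <= t -> bounded_operator (S t) ;
  C0_semigroup0 : forall f, L2 f -> S 0 f = f %[ae mu] ;
  C0_semigroupD : forall s t f, 0 <= s -> 0 <= t -> L2 f ->
    S (s + t) f = S s (S t f) %[ae mu] ;
  C0_semigroup_cvg : forall f, L2 f ->
    Lp_norm 2%:E (fun x => S t f x - f x) @[t --> 0^'+] --> 0%E }.

Definition right_derivative0 (S : R -> (X -> R) -> (X -> R)) (f g : X -> R) :=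
  L2 g /\
  Lp_norm 2%:E (fun x => t^-1 * (S t f x - f x) - g x) @[t --> 0^'+] --> 0%E.

Definition generates (D : set (X -> R)) (A : (X -> R) -> (X -> R))
    (S : R -> (X -> R) -> (X -> R)) :=
  [/\ C0_semigroup S,
      forall f, D f <-> L2 f /\ exists g, right_derivative0 S f g &
      forall f, D f -> right_derivative0 S f (A f)].

(* the Hilbert space adjoint: a representative of the unique class w in L^2
   with <B f, g> = <f, w> for all f in L^2 *)
Definition adjoint (B : (X -> R) -> (X -> R)) (g : X -> R) : X -> R :=
  xget (fun=> 0) [set w | L2 w /\
    forall f, L2 f -> inner (B f) g = inner f w].

Definition GUC (T : R) (S : R -> (X -> R) -> (X -> R)) :=
  forall y, L2 y ->
    (exists t, 0 < t < T /\ exists c : R,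
      adjoint (S t) y = (fun=> c) %[ae mu]) ->
    y = (fun=> 0) %[ae mu].

End operators.

Section control.
Context (dX : measure_display) (X : measurableType dX) (R : realType).
Variable mu : {sigma_finite_measure set X -> \bar R}.
Variables (L T eps : R) (S : R -> (X -> R) -> (X -> R)).

Local Notation L2 := (L2 mu).
Local Notation Lp_norm := (Lp_norm mu).
Local Notation inner := (inner mu).
Local Notation leb := (@lebesgue_measure R).

Definition volume : R := fine (mu [set: X]).

Definition time_measure : set (measurableTypeR R) -> \bar R :=
  mrestr leb (measurable_itv `]0, T[).
HB.instance Definition _ := Measure.on time_measure.

Definition cylinder_measure : set (measurableTypeR R * X) -> \bar R :=
  (time_measure \x mu)%E.
HB.instance Definition _ := Measure.on cylinder_measure.

Definition control_space : set (R * X -> R) :=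
  [set u | u \in Lfun cylinder_measure 2%:E].

(* the value in L^2(mu) at time t of an element of L^2((0,T) x X) = L^2(0,T; L^2(mu));
   the slice is in L^2(mu) for almost every t only, hence the test *)
Definition at_time (u : R * X -> R) (t : R) : X -> R :=
  if `[< L2 (fun x => u (t, x)) >] then fun x => u (t, x) else fun=> 0.

(* L_T u, the integral over (0,T) of S_(T-t) u(t); this L^2(mu)-valued
   integral is taken in the weak sense *)
Definition control_map (u : R * X -> R) : X -> R :=
  xget (fun=> 0) [set z | L2 z /\ forall q, L2 q ->
    inner z q = \int[leb]_(t in `]0, T[) inner (S (T - t) (at_time u t)) q].

Definition adjoint_state (p : X -> R) (t : R) : X -> R :=
  adjoint mu (S (T - t)) p.

Definition U_L : set (X -> R) := [set u | [/\ L2 u,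
  {ae mu, forall x, 0 <= u x <= 1} & \int[mu]_x u x <= L * volume]].

Definition support_U_L (v : X -> R) : \bar R :=
  ereal_sup [set (inner u v)%:E | u in U_L].

Definition cost (u : R * X -> R) : \bar R :=
  ((2^-1)%:E * ess_sup time_measure (fun t =>
      maxe (Lp_norm +oo (fun x => u (t, x)))
           (Lp_norm 1 (fun x => u (t, x)) * ((L * volume)^-1)%:E) ^+ 2)
   + convex_indicator
       [set w | {ae cylinder_measure, forall z, (0 <= w z)%R}] u)%E.

Definition closed_ball2 (z : X -> R) : set (X -> R) :=
  [set w | L2 w /\ (Lp_norm 2%:E (fun x => w x - z x)%R <= eps%:E)%E].

Definition primal_functional (z : X -> R) (u : R * X -> R) : \bar R :=
  (cost u + convex_indicator (closed_ball2 z) (control_map u))%E.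

Definition primal_value (z : X -> R) : \bar R :=
  ereal_inf [set primal_functional z u | u in control_space].

Definition dual_functional (z p : X -> R) : \bar R :=
  ((2^-1)%:E *
     (\int[leb]_(t in `]0%R, T[) support_U_L (adjoint_state p t)) ^+ 2
   - (inner z p)%:E + eps%:E * Lp_norm 2%:E p)%E.

Definition dual_value (z : X -> R) : \bar R :=
  (- ereal_inf [set dual_functional z p | p in L2])%E.

Definition level_measure (v : X -> R) (r : R) : \bar R :=
  mu [set x | r < v x].

Definition level_inverse (v : X -> R) (s : \bar R) : R :=
  inf [set r | (level_measure v r <= s)%E].

Definition level (v : X -> R) : R :=
  Num.max 0 (level_inverse v (L * volume)%:E).

Definition superlevel (v : X -> R) : set X := [set x | level v < v x].

Definition amplitude (p : X -> R) : R :=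
  \int[leb]_(t in `]0, T[)
    \int[mu]_(x in superlevel (adjoint_state p t)) adjoint_state p t x.

End control.

Section hypoellipticity.
Context (R : realType) (d : nat).
Implicit Types (g phi psi : R * 'rV[R]_d -> R) (O : set 'rV[R]_d).

Definition cylinder (T : R) O : set (R * 'rV[R]_d) := `]0, T[%classic `*` O.

(* the part of degree n at h of the power series with coefficients c *)
Definition homogeneous_part (c : {ffun 'I_d -> nat} -> R) (n : nat)
    (h : 'rV[R]_d) : R :=
  \sum_(a : {ffun 'I_d -> 'I_n.+1} | (\sum_i a i == n)%N)
    c [ffun i => a i : nat] * \prod_i h ord0 i ^+ a i.

(* real-analyticity in the space variable, locally uniformly in time: near
   each point of the cylinder, g(t, .) is the sum of a power series whose
   coefficients satisfy a Cauchy bound with r and M independent of t *)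
Definition space_analytic (T : R) O g :=
  measurable_fun (cylinder T O) g /\
  forall t0 x0, cylinder T O (t0, x0) ->
    exists r M : R, 0 < r /\ exists c : R -> {ffun 'I_d -> nat} -> R,
      forall t, `|t - t0| < r ->
        (forall a, `|c t a| * r ^+ (\sum_i a i)%N <= M) /\
        (forall x, `|x - x0| < r ->
          series (fun n => homogeneous_part (c t) n (x - x0)) @ \oo
            --> g (t, x)).

Definition iter_derive (vs : seq (R * 'rV[R]_d)) phi : R * 'rV[R]_d -> R :=
  foldr (fun v f => 'D_v f) phi vs.

Definition smooth phi := forall vs z, differentiable (iter_derive vs phi) z.

Definition supported_in (K : set (R * 'rV[R]_d)) phi :=
  forall z, ~ K z -> phi z = 0.

Definition test_function (T : R) O phi :=
  smooth phi /\
  exists K, [/\ compact K, K `<=` cylinder T O & supported_in K phi].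

Definition distribution (T : R) O (y : (R * 'rV[R]_d -> R) -> R) :=
  (forall (a : R) phi psi, test_function T O phi -> test_function T O psi ->
    y (fun z => a * phi z + psi z) = a * y phi + y psi) /\
  (forall K, compact K -> K `<=` cylinder T O ->
    exists (C : R) (N : nat), forall phi (M : R),
      smooth phi -> supported_in K phi ->
      (forall vs, (size vs <= N)%N -> all (fun v => `|v| <= 1) vs ->
        forall z, `|iter_derive vs phi z| <= M) ->
      `|y phi| <= C * M).

Definition regular_distribution (T : R) O g (phi : R * 'rV[R]_d -> R) : R :=
  \int[(lebesgue_measure \x lebesgue_rV R d)%E]_(z in cylinder T O)
    (g z * phi z).

Definition time_derivative phi : R * 'rV[R]_d -> R := 'D_((1, 0)) phi.

(* y_t - A^* y = f in the sense of distributions. A^* acts on distributions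
   by transposition, <A^* y, phi> = <y, A phi>; the test functions are those
   which A maps to a test function. *)
Definition distributional_solution (T : R) O
    (mu : {measure set 'rV[R]_d -> \bar R}) (D : set ('rV[R]_d -> R))
    (A : ('rV[R]_d -> R) -> ('rV[R]_d -> R))
    (y : (R * 'rV[R]_d -> R) -> R) (f : R * 'rV[R]_d -> R) :=
  forall phi psi, test_function T O phi -> test_function T O psi ->
    (forall t, 0 < t < T -> D (fun x => phi (t, x)) /\
      (fun x => psi (t, x)) = A (fun x => phi (t, x)) %[ae mu]) ->
    y (fun z => - time_derivative phi z - psi z) =
    regular_distribution T O f phi.

Definition analytic_hypoelliptic (T : R) O
    (mu : {measure set 'rV[R]_d -> \bar R}) (D : set ('rV[R]_d -> R))
    (A : ('rV[R]_d -> R) -> ('rV[R]_d -> R)) :=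
  forall y f, distribution T O y -> space_analytic T O f ->
    distributional_solution T O mu D A y f ->
    exists2 g, space_analytic T O g &
      forall phi, test_function T O phi -> y phi = regular_distribution T O g phi.

End hypoellipticity.

Definition lebesgue_on (R : realType) (d : nat) (O : set 'rV[R]_d)
    (oO : open O) (finO : (lebesgue_rV R d O < +oo)%E) :
    {finite_measure set 'rV[R]_d -> \bar R} :=
  mfrestr (open_measurable_rV oO) finO.

(* Main.v *)
(* For [p] in L^2, [phi |-> \int <S_t phi(t), p> dt] is a distribution which solves
   the adjoint equation (in the time direction t |-> S_t^* p) with zero source, so
   hypoellipticity provides a space-analytic [g]; testing with products of bumps of
   intervals and boxes, which shrink to a pi-system, gives S_t^* p = g(t, .) for
   almost every t. Hence the adjoint states have jointly measurable versions and,
   for [p <> 0], almost all of them have null level sets: otherwise the identity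
   theorem on the connected set O (one-dimensional along lines, then Fubini) makes
   S_t^* p constant, against (GUC).

   Write Sigma(p) for the integral of the support function of U_L along the adjoint
   state. The dual cost is coercive because Sigma(q) = 0 forces q <= 0, whereas
   z >= 0; two minimisers lie on a common ray, by strict convexity of the norm, and
   they coincide on it. Scaling a minimiser p gives Sigma(p)^2 = <z, p> - eps |p|.
   By the bathtub principle, Sigma(p + s q) is at most the integral of
   (p + s q - h)^+ plus capacity times the integral of the level h of p, with equality
   at s = 0; differentiating this bound yields the Euler equation
   L_T u = z - eps p / |p| for u = Sigma(p) 1_{p > h}. Finally, any feasible control
   of cost m^2 / 2 satisfies <z, p> - eps |p| <= <L_T u, p> <= m Sigma(p), so that
   m >= Sigma(p), and equality forces u(t) to attain the support function, that is
   to be Sigma(p) 1_{p > h}. *)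

From HB Require Import structures.
Require Import Defs.
From mathcomp Require Import all_boot all_order all_algebra.
From mathcomp Require Import all_classical all_reals all_analysis.
From mathcomp Require Import ess_sup_inf measurable_realfun lra ring.
Set Implicit Arguments.
Unset Strict Implicit.
Unset Printing Implicit Defensive.
Import Order.TTheory GRing.Theory Num.Theory.
Import numFieldNormedType.Exports.
Local Open Scope classical_set_scope.
Local Open Scope ring_scope.

(** * Square-integrable functions *)

(** Elements of L^2 are functions and operators are linear only almost everywhere, so the Hilbert
    space theory is rebuilt on representatives, without a quotient. One principle replaces weak
    compactness: nested closed midpoint convex sets with points of bounded norm have a common point.
    It yields minimisers, hence Riesz representation (hence adjoints and the weak integral
    [control_map]), then uniform boundedness (hence local bounds on the semigroup), and the
    coercivity of the dual cost. The main obstacle is measurability in time. An adjoint state is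
    chosen separately at each time, so nothing in its definition makes it jointly measurable; joint
    versions are what turns the pairing behind [control_map] into a bounded linear functional and
    gives access to Fubini. The support function is measurable in time for another reason: it is a
    supremum of continuous pairings. Null level sets serve twice in the Euler equation: they make
    the bathtub formula an equality, and they make the positive part differentiable almost
    everywhere. *)

Lemma quad_ge0 (R : realFieldType) (b a : R) :
  (forall s, 0 < s -> 0 <= s * a + s ^+ 2 * b) -> 0 <= a.
Proof.
move=> H; rewrite leNgt; apply/negP => a0.
have b1 : 0 < `|b| + 1 by rewrite ltr_wpDl.
(* Small enough for the quadratic term to cancel at most half of the linear one; the [+ 1] covers
   [b = 0]. *)
pose s := - a / (2 * (`|b| + 1)).
have s0 : 0 < s by rewrite divr_gt0 ?oppr_gt0// mulr_gt0.
have := H s s0; rewrite expr2 -mulrA -mulrDr pmulr_rge0//.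
have : s * b <= s * (`|b| + 1).
  by rewrite ler_pM2l//; have := ler_norm b; lra.
have -> : s * (`|b| + 1) = - a / 2 by rewrite /s; field; rewrite gt_eqF.
lra.
Qed.

Section L2_theory.
Context (dX : measure_display) (X : measurableType dX) (R : realType).
Variable mu : {measure set X -> \bar R}.
Local Notation L2 := (L2 mu).
Local Notation inner := (inner mu).
Implicit Types (f g h : X -> R) (a : R).

Lemma L2P f : L2 f <->
  measurable_fun setT f /\ mu.-integrable setT (EFin \o (fun x => f x ^+ 2)).
Proof.
split=> [f2|[mf if2]].
  split; last exact: Lfun2_integrable_sqr.
  by move: f2; rewrite /L2/= inE => /andP[+ _]; rewrite inE.
rewrite /L2/= inE; apply/andP; split; rewrite inE//= /finite_norm unlock poweR_lty//.
move/integrableP : if2 => [_]; apply: le_lt_trans.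
rewrite le_eqVlt; apply/orP; left; apply/eqP/eq_integral => x _ /=.
by rewrite normrX powR_mulrn.
Qed.

Lemma L2_measurable f : L2 f -> measurable_fun setT f.
Proof. by move=> /L2P[]. Qed.

Lemma L2_integrable_mul f g : L2 f -> L2 g ->
  mu.-integrable setT (EFin \o (fun x => f x * g x)).
Proof. by move=> f2 g2; apply/Lfun1_integrable; exact: Lfun2_mul_Lfun1. Qed.

Lemma L2_scale a f : L2 f -> L2 (fun x => a * f x).
Proof.
move=> /L2P[mf if2]; apply/L2P; split; first exact: measurable_funM.
have := integrableZl measurableT (a ^+ 2) if2; apply: eq_integrable => // x _ /=.
by rewrite exprMn EFinM.
Qed.

Lemma L2_add f g : L2 f -> L2 g -> L2 (fun x => f x + g x).
Proof.
move=> f2 g2; have [mf if2] := (L2P f).1 f2; have [mg ig2] := (L2P g).1 g2.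
apply/L2P; split; first exact: measurable_funD.
have ifg := integrableZl measurableT 2%R (L2_integrable_mul f2 g2).
have := integrableD measurableT (integrableD measurableT if2 ig2) ifg.
apply: eq_integrable => // x _ /=.
by rewrite -EFinM -!EFinD; congr EFin; ring.
Qed.

Lemma L2_cst0 : L2 (fun=> 0).
Proof.
apply/L2P; split => //; apply: (eq_integrable measurableT (cst 0%E)) => [x _ /=|].
  by rewrite expr0n.
exact: integrable0.
Qed.

Lemma L2_lin a f g : L2 f -> L2 g -> L2 (fun x => a * f x + g x).
Proof. by move=> f2 g2; apply: L2_add => //; exact: L2_scale. Qed.

Lemma L2_opp f : L2 f -> L2 (fun x => - f x).
Proof.
by move=> f2; have := L2_scale (-1) f2; congr L2; apply/funext => x; ring.
Qed.

Lemma L2_sub f g : L2 f -> L2 g -> L2 (fun x => f x - g x).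
Proof. by move=> f2 g2; apply: L2_add => //; exact: L2_opp. Qed.

Lemma innerC f g : inner f g = inner g f.
Proof. by apply: eq_Rintegral => x _; rewrite mulrC. Qed.

Lemma inner_linl a f g h : L2 f -> L2 g -> L2 h ->
  inner (fun x => a * f x + g x) h = a * inner f h + inner g h.
Proof.
move=> f2 g2 h2; rewrite /Defs.inner -RintegralZl//; last exact: L2_integrable_mul.
rewrite -RintegralD//.
- by apply: eq_Rintegral => x _; ring.
- have := L2_integrable_mul (L2_scale a f2) h2.
  by congr (_.-integrable _ _); apply/funext => x /=; rewrite mulrA.
- exact: L2_integrable_mul.
Qed.

(** The norm as a real number, total on all functions, so that real arithmetic tactics apply;
    [Lp_norm2E] identifies it with [Lp_norm] on L^2. *)
Definition nrm f : R := Num.sqrt (inner f f).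

Lemma inner_ge0 f : 0 <= inner f f.
Proof. by apply: Rintegral_ge0 => x _; rewrite -expr2 sqr_ge0. Qed.

Lemma nrm_ge0 f : 0 <= nrm f. Proof. exact: sqrtr_ge0. Qed.

Lemma sqr_nrm f : nrm f ^+ 2 = inner f f.
Proof. by rewrite sqr_sqrtr// inner_ge0. Qed.

Lemma inner0l h : inner (fun=> 0) h = 0.
Proof.
rewrite /Defs.inner (@eq_Rintegral _ _ _ mu setT (fun=> 0)) => [|x _].
  by rewrite Rintegral_cst// mul0r.
by rewrite mul0r.
Qed.

Lemma inner0r h : inner h (fun=> 0) = 0.
Proof. by rewrite innerC inner0l. Qed.

Lemma innerDl f g h : L2 f -> L2 g -> L2 h ->
  inner (fun x => f x + g x) h = inner f h + inner g h.
Proof.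
move=> f2 g2 h2; rewrite -[inner f h]mul1r -inner_linl//.
by congr Defs.inner; apply/funext => x; rewrite mul1r.
Qed.

Lemma innerZl a f h : L2 f -> L2 h -> inner (fun x => a * f x) h = a * inner f h.
Proof.
move=> f2 h2; rewrite -[RHS]addr0 -(inner0l h) -inner_linl//; last exact: L2_cst0.
by congr Defs.inner; apply/funext => x; rewrite addr0.
Qed.

Lemma innerNl f h : L2 f -> L2 h -> inner (fun x => - f x) h = - inner f h.
Proof.
move=> f2 h2; rewrite -mulN1r -innerZl//.
by congr Defs.inner; apply/funext => x; rewrite mulN1r.
Qed.

Lemma innerBl f g h : L2 f -> L2 g -> L2 h ->
  inner (fun x => f x - g x) h = inner f h - inner g h.
Proof.
by move=> f2 g2 h2; rewrite innerDl// ?innerNl//; exact: L2_opp.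
Qed.

Lemma innerDr f g h : L2 f -> L2 g -> L2 h ->
  inner h (fun x => f x + g x) = inner h f + inner h g.
Proof. by move=> *; rewrite innerC innerDl// !(innerC h). Qed.

Lemma innerZr a f h : L2 f -> L2 h -> inner h (fun x => a * f x) = a * inner h f.
Proof. by move=> *; rewrite innerC innerZl// !(innerC h). Qed.

Lemma innerNr f h : L2 f -> L2 h -> inner h (fun x => - f x) = - inner h f.
Proof. by move=> *; rewrite innerC innerNl// !(innerC h). Qed.

Lemma innerBr f g h : L2 f -> L2 g -> L2 h ->
  inner h (fun x => f x - g x) = inner h f - inner h g.
Proof. by move=> *; rewrite innerC innerBl// !(innerC h). Qed.

Lemma inner_linr a f g h : L2 f -> L2 g -> L2 h ->
  inner h (fun x => a * f x + g x) = a * inner h f + inner h g.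
Proof. by move=> *; rewrite innerC inner_linl// !(innerC h). Qed.

Lemma sqr_nrmD f g : L2 f -> L2 g ->
  nrm (fun x => f x + g x) ^+ 2 = nrm f ^+ 2 + 2 * inner f g + nrm g ^+ 2.
Proof.
move=> f2 g2; have fg2 := L2_add f2 g2.
by rewrite !sqr_nrm innerDl// !innerDr// (innerC g f); ring.
Qed.

Lemma nrmZ a f : L2 f -> nrm (fun x => a * f x) = `|a| * nrm f.
Proof.
move=> f2; rewrite /nrm innerZl// ?innerZr//; last exact: L2_scale.
by rewrite mulrA -expr2 sqrtrM ?sqr_ge0// sqrtr_sqr.
Qed.

Lemma nrmN f : L2 f -> nrm (fun x => - f x) = nrm f.
Proof.
move=> f2; rewrite -[RHS]mul1r -normr1 -normrN -nrmZ//.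
by congr nrm; apply/funext => x; ring.
Qed.

Lemma sqr_nrmB f g : L2 f -> L2 g ->
  nrm (fun x => f x - g x) ^+ 2 = nrm f ^+ 2 - 2 * inner f g + nrm g ^+ 2.
Proof.
by move=> f2 g2; rewrite sqr_nrmD//; [rewrite innerNr// nrmN//; ring|exact: L2_opp].
Qed.

Lemma inner_le_nrm f g : L2 f -> L2 g -> inner f g <= nrm f * nrm g.
Proof.
move=> f2 g2; have [f0|f0] := eqVneq (nrm f) 0.
  rewrite f0 mul0r leNgt; apply/negP => fg0.
  (* When [nrm f = 0] the squared norm of [t f + g] is affine in [t], and this [t] gives it the
     value [-1]. *)
  pose t := - (nrm g ^+ 2 + 1) / (2 * inner f g).
  have := sqr_ge0 (nrm (fun x => t * f x + g x)).
  rewrite sqr_nrmD//; last exact: L2_scale.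
  rewrite nrmZ// f0 mulr0 innerZl//.
  have -> : 2 * (t * inner f g) = - (nrm g ^+ 2 + 1).
    by rewrite /t; field; rewrite gt_eqF.
  lra.
have [g0|g0] := eqVneq (nrm g) 0.
  rewrite g0 mulr0 leNgt; apply/negP => fg0.
  pose t := - (nrm f ^+ 2 + 1) / (2 * inner f g).
  have := sqr_ge0 (nrm (fun x => f x + t * g x)).
  rewrite sqr_nrmD//; last exact: L2_scale.
  rewrite nrmZ// g0 mulr0 innerZr//.
  have -> : 2 * (t * inner f g) = - (nrm f ^+ 2 + 1).
    by rewrite /t; field; rewrite gt_eqF.
  lra.
have fp : 0 < nrm f by rewrite lt_neqAle eq_sym f0 nrm_ge0.
have gp : 0 < nrm g by rewrite lt_neqAle eq_sym g0 nrm_ge0.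
(* Expanding the square gives [2 |f| |g| (|f| |g| - <f, g>)]. *)
have := sqr_ge0 (nrm (fun x => nrm g * f x - nrm f * g x)).
rewrite sqr_nrmB; [|exact: L2_scale..].
rewrite innerZl// ?innerZr//; last exact: L2_scale.
rewrite !nrmZ// !ger0_norm ?nrm_ge0// => H.
have : 0 <= 2 * (nrm f * nrm g) * (nrm f * nrm g - inner f g) by lra.
by rewrite pmulr_rge0 ?mulr_gt0// subr_ge0.
Qed.

Lemma normr_inner_le f g : L2 f -> L2 g -> `|inner f g| <= nrm f * nrm g.
Proof.
move=> f2 g2; rewrite ler_norml inner_le_nrm// andbT lerNl -innerNl//.
by rewrite (le_trans (inner_le_nrm _ _))// ?nrmN//; exact: L2_opp.
Qed.

Lemma nrmD_le f g : L2 f -> L2 g -> nrm (fun x => f x + g x) <= nrm f + nrm g.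
Proof.
move=> f2 g2; rewrite -(@ler_pXn2r _ 2)// ?nnegrE ?nrm_ge0 ?addr_ge0 ?nrm_ge0//.
rewrite sqr_nrmD// sqrrD; have := inner_le_nrm f2 g2; lra.
Qed.

Lemma nrmB_le f g : L2 f -> L2 g -> nrm (fun x => f x - g x) <= nrm f + nrm g.
Proof.
by move=> f2 g2; rewrite -(nrmN g2); apply: nrmD_le => //; exact: L2_opp.
Qed.

Lemma nrm_subC f g : L2 f -> L2 g -> nrm (fun x => f x - g x) = nrm (fun x => g x - f x).
Proof.
move=> f2 g2; rewrite -nrmN; last exact: L2_sub.
by congr nrm; apply/funext => x; rewrite opprB.
Qed.

Lemma nrm_sub_trans g f h : L2 f -> L2 g -> L2 h ->
  nrm (fun x => f x - h x) <= nrm (fun x => f x - g x) + nrm (fun x => g x - h x).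
Proof.
move=> f2 g2 h2; have := nrmD_le (L2_sub f2 g2) (L2_sub g2 h2).
by congr (_ <= _); congr nrm; apply/funext => x; ring.
Qed.

Lemma nrm_le_sub f g : L2 f -> L2 g -> nrm f <= nrm (fun x => f x - g x) + nrm g.
Proof.
move=> f2 g2; have := nrmD_le (L2_sub f2 g2) g2.
by congr (_ <= _); congr nrm; apply/funext => x; ring.
Qed.

Lemma parallelogram f g : L2 f -> L2 g ->
  nrm (fun x => f x - g x) ^+ 2 =
  2 * nrm f ^+ 2 + 2 * nrm g ^+ 2 - 4 * nrm (fun x => 2^-1 * f x + 2^-1 * g x) ^+ 2.
Proof.
move=> f2 g2; rewrite sqr_nrmB// sqr_nrmD; [|exact: L2_scale..].
rewrite innerZl// ?innerZr// ?nrmZ//; last exact: L2_scale.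
by rewrite ger0_norm//; lra.
Qed.

Lemma Lp_norm2E f : L2 f -> Lp_norm mu 2%:E f = (nrm f)%:E.
Proof.
move=> f2; rewrite /Lp_norm unlock.
rewrite (_ : (\int[mu]_x _)%E = (inner f f)%:E).
  by rewrite poweR_EFin powR12_sqrt ?inner_ge0.
rewrite /Defs.inner /Rintegral fineK; last first.
  exact: integrable_fin_num (L2_integrable_mul f2 f2).
by apply: eq_integral => x _ /=; rewrite powR_mulrn// -normrX ger0_norm ?sqr_ge0.
Qed.

Lemma nrm_eq0 f : L2 f -> nrm f = 0 <-> f = (fun=> 0) %[ae mu].
Proof.
move=> f2; have [mf if2] := (L2P f).1 f2; split=> [f0|f0].
  apply: (@filterS _ _ _ (fun x => setT x -> (EFin \o f) x = cst 0%E x)).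
    by move=> x /= + _ => /(_ I) -[].
  apply: (@Lnorm_eq0_eq0 _ _ _ mu _ 2%:E) => //; first exact/measurable_EFinP.
  by have := Lp_norm2E f2; rewrite f0.
suff : inner f f = 0 by rewrite /nrm => ->; rewrite sqrtr0.
rewrite /Defs.inner /Rintegral (ae_eq_integral (cst 0%E))//.
- by rewrite integral0.
- by apply/measurable_EFinP; exact: measurable_funM.
- by apply: filterS f0 => x /= + _ => /(_ I) ->; rewrite mul0r.
Qed.

Lemma nrm_sub_eq0 f g : L2 f -> L2 g ->
  nrm (fun x => f x - g x) = 0 <-> f = g %[ae mu].
Proof.
move=> f2 g2; rewrite nrm_eq0; last exact: L2_sub.
split; apply: filterS => x /= /(_ I) H _; last by rewrite H subrr.
by apply/eqP; rewrite -subr_eq0 H.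
Qed.

Lemma inner_ae f g h : L2 f -> L2 g -> L2 h -> f = g %[ae mu] ->
  inner f h = inner g h.
Proof.
move=> f2 g2 h2 /(nrm_sub_eq0 f2 g2) fg.
have := normr_inner_le (L2_sub f2 g2) h2.
by rewrite fg mul0r normr_le0 innerBl// subr_eq0 => /eqP.
Qed.

Lemma nrm_ae f g : L2 f -> L2 g -> f = g %[ae mu] -> nrm f = nrm g.
Proof.
move=> f2 g2 fg; rewrite /nrm (inner_ae f2 g2 f2 fg) innerC.
by rewrite (inner_ae f2 g2 g2 fg).
Qed.

Lemma inner_ext f g : L2 f -> L2 g -> (forall h, L2 h -> inner f h = inner g h) ->
  f = g %[ae mu].
Proof.
move=> f2 g2 H; apply/(nrm_sub_eq0 f2 g2)/eqP; rewrite -sqrf_eq0 sqr_nrm.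
by rewrite innerBl//; [rewrite H ?subrr//|]; exact: L2_sub.
Qed.

Lemma Rdominated_cvg (D : set X) (u : nat -> X -> R) f g : measurable D ->
  (forall n, measurable_fun D (u n)) -> measurable_fun D f ->
  {ae mu, forall x, D x -> u n x @[n --> \oo] --> f x} ->
  mu.-integrable D (EFin \o g) ->
  {ae mu, forall x n, D x -> `|u n x| <= g x} ->
  mu.-integrable D (EFin \o f) /\
  \int[mu]_(x in D) u n x @[n --> \oo] --> \int[mu]_(x in D) f x.
Proof.
move=> mD mu_ mf uf ig ug.
have [|||||iF _ cF] := @dominated_convergence _ _ _ mu D mD
  (fun n => EFin \o u n) (EFin \o f) (EFin \o g).
- by move=> n; exact/measurable_EFinP.
- exact/measurable_EFinP.
- by apply: filterS uf => x H Dx; apply/fine_cvgP; split; [exact: nearW|exact: H].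
- exact: ig.
- by apply: filterS ug => x H n Dx; rewrite /= lee_fin H.
- split => //; apply: fine_cvg; rewrite fineK//; exact: integrable_fin_num.
Qed.

Lemma L2_abs f : L2 f -> L2 (fun x => `|f x|).
Proof.
move=> /L2P[mf if2]; apply/L2P; split; first exact: measurableT_comp.
by apply: eq_integrable if2 => // x _ /=; rewrite real_normK// num_real.
Qed.

Lemma nrm_abs f : L2 f -> nrm (fun x => `|f x|) = nrm f.
Proof.
move=> f2; rewrite /nrm; congr Num.sqrt; apply: eq_Rintegral => x _.
by rewrite -!expr2 real_normK// num_real.
Qed.

(** Riesz-Fischer for a fast sequence. The sums [s n] of absolute increments have norm at most 2, so
    by monotone convergence their squared limit [S] is integrable. Where [S] is finite the sequence
    converges, and telescoping bounds [(v n - f)^2] by [S], whence dominated convergence. *)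
Lemma L2_cvg_fast (v : nat -> X -> R) : (forall k, L2 (v k)) ->
  (forall k, nrm (fun x => v k.+1 x - v k x) <= 2^-1 ^+ k) ->
  exists f, L2 f /\ nrm (fun x => v k x - f x) @[k --> \oo] --> 0.
Proof.
move=> v2 vk.
pose s (n : nat) (x : X) : R := \sum_(0 <= k < n) `|v k.+1 x - v k x|.
have s2 n : L2 (s n) /\ nrm (s n) <= 2 - 2 * 2^-1 ^+ n.
  elim: n => [|n [IH1 IH2]].
    have -> : s 0%N = (fun=> 0) by apply/funext => x; rewrite /s big_geq.
    split; first exact: L2_cst0.
    by rewrite /nrm inner0l sqrtr0 expr0; lra.
  have -> : s n.+1 = (fun x => s n x + `|v n.+1 x - v n x|).
    by apply/funext => x; rewrite /s big_nat_recr.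
  have w2 : L2 (fun x => `|v n.+1 x - v n x|) by apply: L2_abs; exact: L2_sub.
  split; first exact: L2_add.
  apply: (le_trans (nrmD_le IH1 w2)); rewrite nrm_abs; last exact: L2_sub.
  rewrite exprS; have := vk n; lra.
have s0 n x : 0 <= s n x by apply: sumr_ge0.
have snd x : nondecreasing_seq (s^~ x).
  by apply/nondecreasing_seqP => n; rewrite /s big_nat_recr//= lerDl.
pose G n x := ((s n x) ^+ 2)%:E.
have mG n : measurable_fun setT (G n).
  by apply/measurable_EFinP/measurable_funX/L2_measurable; have [] := s2 n.
have Gnd x : nondecreasing_seq (G^~ x).
  by move=> m n mn; rewrite /G lee_fin ler_pXn2r ?nnegrE ?s0//; exact: snd.
have Gcvg x : cvgn (G^~ x) by exact: ereal_nondecreasing_is_cvgn.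
pose S x := limn (G^~ x).
have GS n x : (G n x <= S x)%E.
  rewrite /S (cvg_lim _ (ereal_nondecreasing_cvgn (Gnd x)))//.
  by apply: ereal_sup_ubound; exists n.
have S0 x : (0 <= S x)%E.
  by apply: (le_trans _ (GS 0%N x)); rewrite /G lee_fin sqr_ge0.
have mS : measurable_fun setT S.
  by apply: (emeasurable_fun_cvg G) => // x _; exact: Gcvg.
have iS : mu.-integrable setT S.
  apply/integrableP; split => //.
  under eq_integral => x _ do rewrite gee0_abs//.
  have cS : (\int[mu]_x G n x)%E @[n --> \oo] --> (\int[mu]_x S x)%E.
    apply: cvg_monotone_convergence => //.
    by move=> n x _; rewrite lee_fin sqr_ge0.
  have : (\int[mu]_x S x <= 4%:E)%E.
    apply: (@cvge_le _ _ _ _ _ _ _ _ cS); apply: nearW => n.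
    have [sn2 sn] := s2 n; have [_ isn2] := (L2P (s n)).1 sn2.
    rewrite -(fineK (integrable_fin_num measurableT isn2)) lee_fin.
    rewrite (_ : fine _ = nrm (s n) ^+ 2); last first.
      by rewrite sqr_nrm; congr fine; apply: eq_integral => x _; rewrite expr2.
    have : nrm (s n) <= 2.
      by apply: le_trans sn _; rewrite lerBlDr lerDl mulr_ge0// exprn_ge0.
    have := nrm_ge0 (s n); nra.
  by move=> /le_lt_trans; apply; rewrite ltry.
(* Convergence holds only almost everywhere; the upper limit makes [f] measurable on the whole
   space. *)
pose f x := fine (limn_esup (fun n => (v n x)%:E)).
have mf : measurable_fun setT f.
  apply: (@measurableT_comp _ _ _ _ _ _ (@fine R)) => //.
  by apply: measurable_fun_limn_esup => n; apply/measurable_EFinP/L2_measurable.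
have aeS := integrable_ae measurableT iS.
have vle n m x : (n <= m)%N -> `|v m x - v n x| <= s m x.
  move=> nm; rewrite -(telescope_sumr (v^~ x) nm).
  apply: (le_trans (ler_norm_sum _ _ _)).
  by rewrite /s [leRHS](big_cat_nat (leq0n n) nm)//= lerDr sumr_ge0.
have sle x m : S x \is a fin_num -> s m x <= Num.sqrt (fine (S x)).
  move=> fS; rewrite -(ger0_norm (s0 m x)) -sqrtr_sqr ler_wsqrtr//.
  by rewrite -lee_fin fineK//; exact: GS.
have vf : {ae mu, forall x, setT x -> v n x @[n --> \oo] --> f x}.
  apply: filterS aeS => x /(_ I) fS _.
  have cv : cvgn (v^~ x).
    have /normed_cvg : cvgn [normed series (telescope (v^~ x))].
      apply: nondecreasing_is_cvgn; first exact: snd.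
      by exists (Num.sqrt (fine (S x))) => _ [m _ <-]; exact: sle.
    rewrite telescopeK => cv.
    have -> : v^~ x = (fun n => (v n x - v 0%N x) + v 0%N x).
      by apply/funext => n; rewrite subrK.
    by apply: is_cvgD => //; exact: is_cvg_cst.
  have cvE : (v n x)%:E @[n --> \oo] --> (limn (v^~ x))%:E.
    by apply: cvg_EFin => //; exact: nearW.
  rewrite /f is_cvg_limn_esupE; last by apply: cvgP cvE.
  by rewrite (cvg_lim _ cvE).
have dom n : {ae mu, forall x, (v n x - f x) ^+ 2 <= fine (S x)}.
  apply: filterS2 aeS vf => x /(_ I) fS /(_ I) cv.
  have : `|v n x - f x| <= Num.sqrt (fine (S x)).
    have : `|v m x - v n x| @[m --> \oo] --> `|f x - v n x|.
      by apply: cvg_norm; apply: cvgB => //; exact: cvg_cst.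
    rewrite distrC => c; apply: (cvgr_to_le c).
    exists n => // m nm /=.
    by apply: (le_trans (vle _ _ _ nm)); exact: sle.
  rewrite -(@ler_pXn2r _ 2)// ?nnegrE ?sqrtr_ge0// real_normK ?num_real//.
  by rewrite sqr_sqrtr// fine_ge0.
have iS' : mu.-integrable setT (EFin \o (fine \o S)).
  apply: (le_integrable measurableT _ _ iS) => [|x _].
    by apply/measurable_EFinP; exact: measurableT_comp.
  by rewrite /=; case: (S x) => [r||]//=; rewrite ?normr0 ?leey.
have f2 : L2 f.
  have H : L2 (fun x => v 0%N x - f x).
    have m0 : measurable_fun setT (fun x => v 0%N x - f x).
      by apply: measurable_funB => //; exact: L2_measurable.
    apply/L2P; split => //.
    have [] := @Rdominated_cvg setT (fun=> fun x => (v 0%N x - f x) ^+ 2)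
      (fun x => (v 0%N x - f x) ^+ 2) (fine \o S) measurableT _ _ _ iS' _ => //.
    - by move=> _; exact: measurable_funX.
    - exact: measurable_funX.
    - by apply: nearW => x _; exact: cvg_cst.
    - by apply: filterS (dom 0%N) => x H n _; rewrite ger0_norm// sqr_ge0.
  have := L2_sub (v2 0%N) H; congr L2; apply/funext => x; ring.
exists f; split => //.
have [||||_ c] := @Rdominated_cvg setT (fun n x => (v n x - f x) ^+ 2)
      (fun x => 0) (fine \o S) measurableT _ _ _ iS' _.
- by move=> n; apply: measurable_funX; apply: measurable_funB => //; exact: L2_measurable.
- exact: measurable_cst.
- apply: filterS vf => x /(_ I) c _.
  have -> : 0 = (f x - f x) ^+ 2 :> R by rewrite subrr expr0n.
  apply: (@cvg_comp _ _ _ _ (fun r : R => r ^+ 2)); last exact: exprn_continuous.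
  by apply: cvgB => //; exact: cvg_cst.
- apply: filterS (ae_foralln dom) => x H n _.
  by rewrite ger0_norm ?sqr_ge0.
move: c; rewrite Rintegral_cst// mul0r => c.
have -> : (fun k => nrm (fun x => v k x - f x)) =
  (fun k => Num.sqrt (\int[mu]_x (v k x - f x) ^+ 2)).
  by apply/funext => k; rewrite /nrm; congr Num.sqrt.
rewrite -(sqrtr0 R); apply: (cvg_comp _ _ c); exact: sqrt_continuous.
Qed.

Definition cauchy_L2 (u : nat -> X -> R) := forall e : R, 0 < e -> exists N, forall m n,
  (N <= m)%N -> (N <= n)%N -> nrm (fun x => u m x - u n x) <= e.

Lemma L2_complete (u : nat -> X -> R) : (forall k, L2 (u k)) -> cauchy_L2 u ->
  exists f, L2 f /\ nrm (fun x => u k x - f x) @[k --> \oo] --> 0.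
Proof.
move=> u2 cu.
have /choice[N NP] k : exists N, forall m n, (N <= m)%N -> (N <= n)%N ->
    nrm (fun x => u m x - u n x) <= 2^-1 ^+ k by apply: cu; rewrite exprn_gt0.
(* Summing the thresholds yields a nondecreasing [phi] that lies beyond both [N k] and [k]. *)
pose phi k := (\sum_(0 <= j < k.+1) (N j).+1)%N.
have phiN k : (N k <= phi k)%N.
  by rewrite /phi big_nat_recr//=; apply: (leq_trans (leqnSn _)); exact: leq_addl.
have phiS k : (phi k <= phi k.+1)%N by rewrite /phi [leqRHS]big_nat_recr//= leq_addr.
have phik k : (k <= phi k)%N.
  elim: k => // k IH; rewrite /phi big_nat_recr//= -/(phi k) addnS ltnS.
  exact: leq_trans IH (leq_addr _ _).
have [k|k|f [f2 vf]] := @L2_cvg_fast (fun k => u (phi k)).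
- exact: u2.
- by apply: NP => //; exact: leq_trans (phiS k).
exists f; split=> //; apply/cvgrPdist_le => e e0.
have e20 : 0 < e / 2 by rewrite divr_gt0.
have [M MP] := cu _ e20.
move/cvgrPdist_le : vf => /(_ _ e20)[K _ KP].
exists M => // n /= Mn; rewrite sub0r normrN ger0_norm ?nrm_ge0//.
have := KP (maxn K M) (leq_maxl _ _); rewrite sub0r normrN ger0_norm ?nrm_ge0// => H.
have := MP n (phi (maxn K M)) Mn (leq_trans (leq_maxr K M) (phik _)).
have := nrm_sub_trans (u2 n) (u2 (phi (maxn K M))) f2; lra.
Qed.

Definition midpoint f g := fun x => 2^-1 * f x + 2^-1 * g x.

Definition midconvex (K : set (X -> R)) := forall f g, K f -> K g -> K (midpoint f g).

Definition closed_L2 (K : set (X -> R)) := forall (u : nat -> X -> R) f,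
  (forall k, K (u k)) -> L2 f -> nrm (fun x => u k x - f x) @[k --> \oo] --> 0 -> K f.

Lemma L2_midpoint f g : L2 f -> L2 g -> L2 (midpoint f g).
Proof. by move=> f2 g2; apply: L2_add; exact: L2_scale. Qed.

(* By the parallelogram identity, almost norm-minimal elements of [K n] form a
   Cauchy sequence. *)
Lemma nested_convex_closed (K : nat -> set (X -> R)) (C : R) :
  (forall n f, K n f -> L2 f) -> (forall n, midconvex (K n)) ->
  (forall n, closed_L2 (K n)) -> (forall n, K n.+1 `<=` K n) ->
  (forall n, exists2 f, K n f & nrm f <= C) -> exists f, forall n, K n f.
Proof.
move=> K2 Kmid Kcl Kdec Kne.
have KD n m : (n <= m)%N -> K m `<=` K n.
  move=> /subnKC <-; elim: (m - n)%N => [|j IH]; first by rewrite addn0.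
  by rewrite addnS; exact: subset_trans IH.
pose E n := [set nrm f ^+ 2 | f in K n].
have Einf n : has_inf (E n).
  split; last by exists 0 => _ [f _ <-]; exact: sqr_ge0.
  by have [f Kf _] := Kne n; exists (nrm f ^+ 2); exists f.
pose q n := inf (E n).
have qle n f : K n f -> q n <= nrm f ^+ 2.
  by move=> Kf; apply: ge_inf; [exact: (Einf n).2|exists f].
have C0 : 0 <= C by have [f _] := Kne 0%N; apply: le_trans; exact: nrm_ge0.
have qC n : q n <= C ^+ 2.
  have [f Kf fC] := Kne n; apply: (le_trans (qle _ _ Kf)).
  by rewrite ler_pXn2r// ?nnegrE ?nrm_ge0.
have qnd : nondecreasing_seq q.
  move=> n m nm; apply: lb_le_inf; first exact: (Einf m).1.
  by move=> _ [f Kf <-]; apply: qle; exact: KD Kf.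
have qcvg : cvgn q by apply: nondecreasing_is_cvgn => //; exists (C ^+ 2) => _ [n _ <-].
have /choice[u uP] n : exists f, K n f /\ nrm f ^+ 2 < q n + n.+1%:R^-1.
  have [|_ [f Kf <-] fq] := @inf_adherent _ (E n) n.+1%:R^-1 _ (Einf n).
    by rewrite invr_gt0.
  by exists f.
have u2 n : L2 (u n) by have [/K2] := uP n.
have [f [f2 uf]] : exists f, L2 f /\ nrm (fun x => u k x - f x) @[k --> \oo] --> 0.
  apply: L2_complete => // e e0.
  have e4 : 0 < e ^+ 2 / 8 by rewrite divr_gt0// exprn_gt0.
  move/cvgrPdist_lt : (qcvg) => /(_ _ e4)[N1 _ N1P].
  have [N2 _ N2P] := near_infty_natSinv_lt (PosNum e4).
  exists (maxn N1 N2).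
  suff H m n : (maxn N1 N2 <= n)%N -> (n <= m)%N -> nrm (fun x => u m x - u n x) <= e.
    move=> m n Nm Nn; have [nm|/ltnW mn] := leqP n m; first exact: H.
    by rewrite nrm_subC//; exact: H.
  move=> Nn nm; have [N1n N2n] : (N1 <= n /\ N2 <= n)%N.
    by apply/andP; rewrite -geq_max.
  have [Km um] := uP m; have [Kn un] := uP n.
  have := qle n _ (Kmid _ _ _ (KD _ _ nm _ Km) Kn).
  move=> H1; suff : nrm (fun x => u m x - u n x) ^+ 2 <= e ^+ 2.
    by rewrite ler_pXn2r// ?nnegrE ?nrm_ge0// ltW.
  rewrite (parallelogram (u2 m) (u2 n)) -/(midpoint (u m) (u n)).
  have := N1P n N1n; have := N2P n N2n; have := N2P m (leq_trans N2n nm) => /=.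
  have qm := nondecreasing_cvgn_le qnd qcvg m.
  have qn := nondecreasing_cvgn_le qnd qcvg n.
  move=> c1 c2 c3; have c4 : q m - q n < e ^+ 2 / 8.
    by apply: le_lt_trans c3; rewrite ger0_norm ?subr_ge0// lerD2r.
  have um' : nrm (u m) ^+ 2 < q m + e ^+ 2 / 8 by apply: lt_trans um _; rewrite ltrD2l.
  have un' : nrm (u n) ^+ 2 < q n + e ^+ 2 / 8 by apply: lt_trans un _; rewrite ltrD2l.
  have := sqr_ge0 e; lra.
exists f => n; apply: (Kcl n (fun k => u (n + k)%N)) => //.
  by move=> k; apply: (KD n (n + k)%N (leq_addr _ _)); have [] := uP (n + k)%N.
have := uf; rewrite -(cvg_shiftn n); apply: cvg_trans.
by apply: near_eq_cvg; apply: nearW => k; rewrite addnC.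
Qed.

(** The direct method without weak compactness: sublevel sets at heights tending to the infimum
    satisfy [nested_convex_closed]. Truncating the heights at [J f0] keeps every set inside the
    region where coercivity is assumed. *)
Lemma exists_minimiser (J : (X -> R) -> R) f0 (C : R) : L2 f0 ->
  (forall f g, L2 f -> L2 g -> J (midpoint f g) <= 2^-1 * (J f + J g)) ->
  (forall c, closed_L2 [set f | L2 f /\ J f <= c]) ->
  (forall f, L2 f -> J f <= J f0 -> nrm f <= C) ->
  (exists b, forall f, L2 f -> b <= J f) ->
  exists2 f, L2 f & forall g, L2 g -> J f <= J g.
Proof.
move=> f02 Jmid Jcl Jco [b Jb].
pose E := [set J f | f in [set f | L2 f]].
have Einf : has_inf E.
  by split; [exists (J f0); exists f0|exists b => _ [f f2 <-]; exact: Jb].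
pose K n := [set f | L2 f /\ J f <= Num.min (J f0) (inf E + n.+1%:R^-1)].
have [||n|n f [f2 fn]|n|f fK] := @nested_convex_closed K C.
- by move=> n f [].
- move=> n f g [f2 Jf] [g2 Jg]; split; first exact: L2_midpoint.
  by apply: (le_trans (Jmid _ _ f2 g2)); lra.
- exact: Jcl.
- split => //; apply: (le_trans fn).
  have : (n.+2%:R : R)^-1 <= n.+1%:R^-1 by rewrite lef_pV2 ?posrE// ler_nat.
  by rewrite le_min ge_min lexx/= ge_min lerD2l => ->; rewrite orbT.
- have [_ [f f2 <-] fq] : exists2 x, E x & x < inf E + n.+1%:R^-1.
    by apply: inf_adherent => //; rewrite invr_gt0.
  have [Jff0|Jf0f] := leP (J f) (J f0).
    by exists f; [split => //; rewrite le_min Jff0 ltW|exact: Jco].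
  exists f0; last exact: Jco.
  by split => //; rewrite le_min lexx ltW//; exact: lt_trans fq.
have [f2 _] := fK 0%N; exists f => // g g2.
apply: (@le_trans _ _ (inf E)); last by apply: ge_inf; [exact: Einf.2|exists g].
apply/ler_addgt0Pl => e e0; have [N _ NP] := near_infty_natSinv_lt (PosNum e0).
have [_] := fK N; rewrite le_min => /andP[_ H].
by apply: (le_trans H); rewrite addrC lerD2r ltW//; exact: (NP N (leqnn N)).
Qed.

Lemma nrm_cvg (u : nat -> X -> R) f : (forall k, L2 (u k)) -> L2 f ->
  nrm (fun x => u k x - f x) @[k --> \oo] --> 0 -> nrm (u k) @[k --> \oo] --> nrm f.
Proof.
move=> u2 f2 uf; apply/cvgrPdist_le => e e0.
move/cvgrPdist_le : uf => /(_ _ e0); apply: filterS => k.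
rewrite sub0r normrN ger0_norm ?nrm_ge0// => H.
rewrite ler_norml.
have := nrm_le_sub (u2 k) f2; have := nrm_le_sub f2 (u2 k).
rewrite (nrm_subC f2 (u2 k)); lra.
Qed.

Lemma bounded_functional_cvg (l : (X -> R) -> R) (C : R) (u : nat -> X -> R) f :
  (forall g h, L2 g -> L2 h -> l (fun x => g x - h x) = l g - l h) ->
  (forall g, L2 g -> `|l g| <= C * nrm g) ->
  (forall k, L2 (u k)) -> L2 f ->
  nrm (fun x => u k x - f x) @[k --> \oo] --> 0 -> l (u k) @[k --> \oo] --> l f.
Proof.
move=> ladd lC u2 f2 uf; apply: cvg_sub0 (cvg_cst (l f)).
apply: norm_cvg0.
have : C * nrm (fun x => u k x - f x) @[k --> \oo] --> C * 0.
  by apply: cvgM => //; exact: cvg_cst.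
rewrite mulr0; apply: squeeze_cvgr (cvg_cst 0); apply: nearW => k /=.
by rewrite normr_ge0/= -[X in `|X|]/(l (u k) - l f) -ladd//; apply: lC; exact: L2_sub.
Qed.

(** The representative is the minimiser of [|f|^2 / 2 - l f]; its first-order condition along [q]
    and [- q] is the representation. *)
Lemma riesz (l : (X -> R) -> R) (C : R) :
  (forall a f g, L2 f -> L2 g -> l (fun x => a * f x + g x) = a * l f + l g) ->
  (forall f, L2 f -> `|l f| <= C * nrm f) ->
  exists2 w, L2 w & forall f, L2 f -> l f = inner f w.
Proof.
move=> llin lC.
have lB f g : L2 f -> L2 g -> l (fun x => f x - g x) = l f - l g.
  move=> f2 g2; have := llin (- 1) g f g2 f2.
  rewrite mulN1r [RHS]addrC => <-; congr l; apply/funext => x; ring.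
have l0 : l (fun=> 0) = 0.
  rewrite -[RHS](addNr (l (fun=> 0))) -mulN1r -llin; [|exact: L2_cst0..].
  by congr l; apply/funext => x; rewrite mulr0 addr0.
have lZ a f : L2 f -> l (fun x => a * f x) = a * l f.
  move=> f2; have := llin a f _ f2 L2_cst0; rewrite l0 addr0 => <-.
  by congr l; apply/funext => x; rewrite addr0.
pose J f := 2^-1 * nrm f ^+ 2 - l f.
have [||||w w2 wmin] := @exists_minimiser J (fun=> 0) (2 * `|C|) L2_cst0.
- move=> f g f2 g2; rewrite /J.
  have -> : l (midpoint f g) = 2^-1 * l f + 2^-1 * l g.
    by rewrite /midpoint llin ?lZ//; exact: L2_scale.
  have := parallelogram f2 g2; rewrite -/(midpoint f g).
  have := sqr_ge0 (nrm (fun x => f x - g x)); lra.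
- move=> c u f uK f2 uf; split => //.
  have u2 k : L2 (u k) by have [] := uK k.
  have cJ : J (u k) @[k --> \oo] --> J f.
    apply: cvgB; last exact: (bounded_functional_cvg lB lC).
    apply: cvgM; first exact: cvg_cst.
    apply: (@cvg_comp _ _ _ _ (fun r : R => r ^+ 2)); last exact: exprn_continuous.
    exact: nrm_cvg.
  by apply: (cvgr_to_le cJ); apply: nearW => k; have [] := uK k.
- move=> f f2; rewrite /J l0 /nrm inner0l sqrtr0 -/(nrm f) => H.
  rewrite leNgt; apply/negP => fC.
  have f0 := nrm_ge0 f; have := le_trans (ler_norm _) (lC f f2).
  have := ler_norm C; have := normr_ge0 C; nra.
- exists (- (2^-1 * C ^+ 2)) => f f2; rewrite /J.
  have := le_trans (ler_norm _) (lC f f2).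
  have := sqr_ge0 (nrm f - C); lra.
exists w => // q q2; apply/eqP; rewrite -subr_eq0 eq_le; apply/andP.
suff H q' : L2 q' -> 0 <= inner w q' - l q'.
  split; first by have := H q q2; rewrite innerC; lra.
  have := H _ (L2_opp q2); rewrite innerNr// innerC.
  have -> : l (fun x => - q x) = - l q.
    by rewrite -mulN1r -lZ//; congr l; apply/funext => x; rewrite mulN1r.
  lra.
move=> q'2; apply: (@quad_ge0 _ (2^-1 * nrm q' ^+ 2)) => s s0.
have := wmin _ (L2_lin s q'2 w2); rewrite /J llin// sqr_nrmD//; last exact: L2_scale.
rewrite nrmZ// innerZl// (innerC q') exprMn real_normK ?num_real//; lra.
Qed.

(* If no closed ball of radius [r k] around [x k] had a point [f] with
   [nrm (B n f) > k], the family would be uniformly bounded; so one builds nested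
   closed balls on which the family is unbounded. *)
Lemma uniform_boundedness (B : nat -> (X -> R) -> (X -> R)) :
  (forall n f, L2 f -> L2 (B n f)) ->
  (forall n f g, L2 f -> L2 g -> nrm (B n (fun x => f x - g x)) =
                                 nrm (fun x => B n f x - B n g x)) ->
  (forall n a f, L2 f -> nrm (B n (fun x => a * f x)) = `|a| * nrm (B n f)) ->
  (forall n, exists C, forall f, L2 f -> nrm (B n f) <= C * nrm f) ->
  (forall f, L2 f -> exists C, forall n, nrm (B n f) <= C) ->
  exists2 C, 0 <= C & forall n f, L2 f -> nrm (B n f) <= C * nrm f.
Proof.
move=> B2 BB BZ Bbnd Bpt.
apply: contrapT => nC.
have step k (p : {p : (X -> R) * R | L2 p.1 /\ 0 < p.2}) :
    exists p' : {p : (X -> R) * R | L2 p.1 /\ 0 < p.2},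
    forall g, L2 g -> nrm (fun x => g x - (sval p').1 x) <= (sval p').2 ->
      nrm (fun x => g x - (sval p).1 x) <= (sval p).2 /\
      exists n, k%:R <= nrm (B n g).
  case: p => -[c r] [/= c2 r0].
  have [n [f [f2 fr fk]]] : exists n f, [/\ L2 f,
      nrm (fun x => f x - c x) <= r / 2 & k%:R + 1 < nrm (B n f)].
    apply: contrapT => nE; apply: nC.
    (* Were [B n] bounded by [k + 1] on the ball of radius [r / 2] for all [n], differences of two
       of its points would bound [B n] by [2 (k + 1)] on vectors of length [r / 2], whence this
       constant. *)
    exists (4 / r * (k%:R + 1)); first by rewrite mulr_ge0 ?addr_ge0 ?divr_ge0// ltW.
    move=> n f f2; have BE g : L2 g -> nrm (fun x => g x - c x) <= r / 2 ->
        nrm (B n g) <= k%:R + 1.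
      by move=> g2 gr; rewrite leNgt; apply/negP => H; apply: nE; exists n, g.
    have [f0|f0] := eqVneq (nrm f) 0.
      have [C CP] := Bbnd n.
      by rewrite f0 mulr0; have := CP f f2; rewrite f0 mulr0.
    have fp : 0 < nrm f by rewrite lt_neqAle eq_sym f0 nrm_ge0.
    pose a := r / 2 / nrm f.
    have a0 : 0 < a by rewrite !divr_gt0.
    have g2 := L2_lin a f2 c2.
    have H1 : nrm (B n (fun x => a * f x + c x)) <= k%:R + 1.
      apply: BE => //; rewrite (_ : (fun x => _) = (fun x => a * f x)).
        by rewrite nrmZ// gtr0_norm// divfK.
      by apply/funext => x; rewrite addrK.
    have H2 : nrm (B n c) <= k%:R + 1.
      apply: BE => //; rewrite (_ : (fun x => _) = (fun=> 0)).
        by rewrite /nrm inner0l sqrtr0 divr_ge0// ltW.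
      by apply/funext => x; rewrite subrr.
    have : a * nrm (B n f) <= 2 * (k%:R + 1).
      rewrite -{1}(gtr0_norm a0) -BZ//.
      have -> : (fun x => a * f x) = (fun x => (a * f x + c x) - c x).
        by apply/funext => x; rewrite addrK.
      rewrite BB//; apply: (le_trans (nrmB_le _ _)); [exact: B2|exact: B2|lra].
    have E : nrm (B n f) = (2 / r * nrm f) * (a * nrm (B n f)).
      by rewrite /a; field; rewrite f0 gt_eqF.
    move=> Ha; rewrite E; apply: (le_trans (ler_wpM2l _ Ha)).
      by rewrite mulr_ge0 ?divr_ge0// ltW.
    by rewrite le_eqVlt; apply/orP; left; apply/eqP; field; rewrite gt_eqF.
  have [C CP] := Bbnd n.
  (* The new ball stays inside the old one, and [B n] varies by at most 1 over it, so that [k + 1]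
     at the centre leaves [k] everywhere. *)
  pose r' := Num.min (r / 2) (1 / (`|C| + 1)).
  have r'0 : 0 < r' by rewrite lt_min !divr_gt0// ltr_wpDl.
  exists (exist _ (f, r') (conj f2 r'0)) => /= g g2 gf.
  move: (gf); rewrite le_min => /andP[gf1 gf2].
  split; first by have := nrm_sub_trans g2 f2 c2; lra.
  exists n; have := nrm_le_sub (B2 n f f2) (B2 n g g2).
  rewrite (nrm_subC (B2 n f f2) (B2 n g g2)) -BB//.
  have := CP _ (L2_sub g2 f2).
  have : C * nrm (fun x => g x - f x) <= 1.
    apply: (@le_trans _ _ ((`|C| + 1) * nrm (fun x => g x - f x))).
      apply: ler_wpM2r; first exact: nrm_ge0.
      by apply: (le_trans (ler_norm C)); rewrite lerDl.
    by rewrite mulrC -ler_pdivlMr// ltr_wpDl.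
  lra.
have /choice[F FP] : forall kp : nat * {p : (X -> R) * R | L2 p.1 /\ 0 < p.2},
   exists p' : {p : (X -> R) * R | L2 p.1 /\ 0 < p.2},
    forall g, L2 g -> nrm (fun x => g x - (sval p').1 x) <= (sval p').2 ->
      nrm (fun x => g x - (sval kp.2).1 x) <= (sval kp.2).2 /\
      exists n, kp.1%:R <= nrm (B n g).
  by move=> [k p]; exact: step.
pose p0 : {p : (X -> R) * R | L2 p.1 /\ 0 < p.2} :=
  exist _ (fun=> 0, 1) (conj L2_cst0 ltr01).
pose p := fix p k := if k is k'.+1 then F (k', p k') else p0.
pose K k := [set g | L2 g /\ nrm (fun x => g x - (sval (p k)).1 x) <= (sval (p k)).2].
have ball0 k : K k (sval (p k)).1.
  have [c2 r0] := svalP (p k); split=> //.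
  rewrite (_ : (fun x => _) = (fun=> 0)); first by rewrite /nrm inner0l sqrtr0 ltW.
  by apply/funext => x; rewrite subrr.
have KS k : K k.+1 `<=` K k.
  by move=> g [g2 gp]; have [] := FP (k, p k) g g2 gp.
have K01 k : K k `<=` K 0%N.
  by elim: k => // k IH; apply: subset_trans IH; exact: KS.
have [||||f fK] := @nested_convex_closed K 1 _ _ _ KS.
- by move=> k f [].
- move=> k f g [f2 fr] [g2 gr]; split; first exact: L2_midpoint.
  have [c2 r0] := svalP (p k); set c := (sval _).1 in c2 fr gr *.
  have -> : (fun x => midpoint f g x - c x) =
    (fun x => 2^-1 * (f x - c x) + 2^-1 * (g x - c x)).
    by apply/funext => x; rewrite /midpoint; field.
  apply: le_trans (nrmD_le _ _) _; [exact/L2_scale/L2_sub|exact/L2_scale/L2_sub|].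
  rewrite !nrmZ; [|exact: L2_sub..].
  by rewrite ger0_norm//; lra.
- move=> k u f uK f2 uf; split => //.
  have [c2 r0] := svalP (p k).
  have cv : nrm (fun x => u j x - f x) + (sval (p k)).2 @[j --> \oo] --> 0 + (sval (p k)).2.
    by apply: cvgD => //; exact: cvg_cst.
  rewrite -[leRHS]add0r; apply: (cvgr_to_ge cv); apply: nearW => j.
  have [uj2 ujr] := uK j; have := nrm_sub_trans f2 uj2 c2.
  by rewrite (nrm_subC f2 uj2); lra.
- move=> k; exists (sval (p k)).1; first exact: ball0.
  have [g2] := K01 _ _ (ball0 k); congr (nrm _ <= _).
  by apply/funext => x /=; rewrite subr0.
have [f2 _] := fK 0%N; have [C CP] := Bpt f f2.
pose N := Num.truncn C.
(* Points of the ball of index [k + 1] see an operator of size at least [k]; hence a shift by two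
   above the integer part of [C]. *)
have [g2 gp] := fK N.+2; have [_ [n /= nN]] := FP (N.+1, p N.+1) f g2 gp.
by have := le_lt_trans (le_trans nN (CP n)) (truncnS_gt C); rewrite ltxx.
Qed.

End L2_theory.

(** * Bounded operators and semigroups *)

Section bounded_operators.
Context (dX : measure_display) (X : measurableType dX) (R : realType).
Variable mu : {measure set X -> \bar R}.
Local Notation L2 := (L2 mu).
Local Notation inner := (inner mu).
Local Notation nrm := (nrm mu).
Variable B : (X -> R) -> (X -> R).
Hypothesis bB : bounded_operator mu B.
Implicit Types (f g h : X -> R) (a : R).

Lemma bounded_operator_nrm :
  exists2 C : R, 0 <= C & forall f, L2 f -> nrm (B f) <= C * nrm f.
Proof.
have [B2 _ _ [C BC]] := bB; exists `|C| => // f f2.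
apply: (@le_trans _ _ (C * nrm f)).
  by have := BC f f2; rewrite !Lp_norm2E//; exact: B2.
by rewrite ler_wpM2r ?nrm_ge0// ler_norm.
Qed.

Lemma bounded_operator_lin_ae a f g : L2 f -> L2 g ->
  B (fun x => a * f x + g x) = (fun x => a * B f x + B g x) %[ae mu].
Proof. by move=> f2 g2; have [_ _ H _] := bB; exact: H. Qed.

(** Linearity of [B] holds only almost everywhere; after pairing with [h] it becomes an equality of
    real numbers. *)
Lemma inner_bounded_operator_lin a f g h : L2 f -> L2 g -> L2 h ->
  inner (B (fun x => a * f x + g x)) h = a * inner (B f) h + inner (B g) h.
Proof.
move=> f2 g2 h2; have [B2 _ _ _] := bB.
rewrite (inner_ae _ _ h2 (bounded_operator_lin_ae a f2 g2)).
- by rewrite inner_linl//; exact: B2.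
- by apply: B2; exact: L2_lin.
- by apply: L2_lin; exact: B2.
Qed.

Lemma nrm_bounded_operator_sub f g : L2 f -> L2 g ->
  nrm (B (fun x => f x - g x)) = nrm (fun x => B f x - B g x).
Proof.
move=> f2 g2; have [B2 _ _ _] := bB.
rewrite (_ : (fun x => f x - g x) = (fun x => -1 * g x + f x)); last first.
  by apply/funext => x; ring.
rewrite (_ : (fun x => B f x - B g x) = (fun x => -1 * B g x + B f x)); last first.
  by apply/funext => x; ring.
apply: nrm_ae; [exact/B2/L2_lin|by apply: L2_lin; exact: B2|].
exact: bounded_operator_lin_ae.
Qed.

Lemma nrm_bounded_operator0 : nrm (B (fun=> 0)) = 0.
Proof.
have [C _ BC] := bounded_operator_nrm; apply/eqP; rewrite eq_le nrm_ge0 andbT.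
have := BC _ (L2_cst0 mu).
by rewrite (_ : nrm (fun=> 0) = 0) ?mulr0// /nrm inner0l sqrtr0.
Qed.

Lemma inner_bounded_operatorZ a f h : L2 f -> L2 h ->
  inner (B (fun x => a * f x)) h = a * inner (B f) h.
Proof.
move=> f2 h2; have [B2 _ _ _] := bB.
have B0 : inner (B (fun=> 0)) h = 0.
  have := normr_inner_le (B2 _ (L2_cst0 mu)) h2.
  by rewrite nrm_bounded_operator0 mul0r normr_le0 => /eqP.
rewrite -[RHS]addr0 -B0 -inner_bounded_operator_lin//; last exact: L2_cst0.
by congr (inner (B _) h); apply/funext => x; rewrite addr0.
Qed.

Lemma nrm_bounded_operatorZ a f : L2 f -> nrm (B (fun x => a * f x)) = `|a| * nrm (B f).
Proof.
move=> f2; have [B2 _ _ _] := bB.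
have E : B (fun x => a * f x) = (fun x => a * B f x) %[ae mu].
  have := bounded_operator_lin_ae a f2 (L2_cst0 mu).
  have := (nrm_eq0 (B2 _ (L2_cst0 mu))).1 nrm_bounded_operator0.
  rewrite (_ : (fun x => _ + 0) = (fun x => a * f x)); last by apply/funext => x; rewrite addr0.
  by apply: filterS2 => x /(_ I) -> H /H ->; rewrite addr0.
by rewrite (nrm_ae _ _ E) ?nrmZ//; [exact: B2|apply: B2; exact: L2_scale|apply: L2_scale; exact: B2].
Qed.

(** [adjoint] selects by [xget]; Riesz representation of [f |-> <B f, g>] shows that there is
    something to select. *)
Lemma adjointP g : L2 g -> L2 (adjoint mu B g) /\
  forall f, L2 f -> inner (B f) g = inner f (adjoint mu B g).
Proof.
move=> g2; have [B2 _ _ _] := bB; have [C C0 BC] := bounded_operator_nrm.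
have [||w w2 wP] := @riesz _ _ _ mu (fun f => inner (B f) g) (C * nrm g).
- by move=> a f h f2 h2; exact: inner_bounded_operator_lin.
- move=> f f2; apply: (le_trans (normr_inner_le (B2 _ f2) g2)).
  by rewrite mulrAC ler_wpM2r ?nrm_ge0// BC.
by have := @xgetPex _ (fun=> 0) [set w | L2 w /\
    forall f, L2 f -> inner (B f) g = inner f w] (ex_intro _ w (conj w2 wP)).
Qed.

Lemma nrm_adjoint_le (C : R) g : (forall f, L2 f -> nrm (B f) <= C * nrm f) -> L2 g ->
  nrm (adjoint mu B g) <= C * nrm g.
Proof.
move=> BC g2; have [B2 _ _ _] := bB; have [w2 wP] := adjointP g2.
have := wP _ w2; rewrite -sqr_nrm => H.
have [w0|w0] := eqVneq (nrm (adjoint mu B g)) 0.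
  (* [C] carries no sign hypothesis, so [0 <= C * nrm g] is read off from the bound on [B g]. *)
  by rewrite w0; exact: le_trans (nrm_ge0 mu (B g)) (BC g g2).
have wp : 0 < nrm (adjoint mu B g) by rewrite lt_neqAle eq_sym w0 nrm_ge0.
rewrite -(ler_pM2l wp) -expr2 -H.
apply: (le_trans (inner_le_nrm (B2 _ w2) g2)).
by rewrite mulrCA mulrA; apply: ler_wpM2r; [exact: nrm_ge0|rewrite mulrC mulrC BC].
Qed.

Lemma inner_adjointP g w : L2 g -> L2 w ->
  (forall f, L2 f -> inner (B f) g = inner f w) -> adjoint mu B g = w %[ae mu].
Proof.
move=> g2 w2 wP; have [a2 aP] := adjointP g2.
by apply: inner_ext => // h h2; rewrite innerC -aP// wP// innerC.
Qed.

Lemma adjoint_lin a f g : L2 f -> L2 g ->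
  adjoint mu B (fun x => a * f x + g x) =
  (fun x => a * adjoint mu B f x + adjoint mu B g x) %[ae mu].
Proof.
move=> f2 g2; have [B2 _ _ _] := bB.
have [af2 afP] := adjointP f2; have [ag2 agP] := adjointP g2.
apply: inner_adjointP; [exact: L2_lin|exact: L2_lin|move=> h h2].
by rewrite !inner_linr ?afP ?agP//; exact: B2.
Qed.

End bounded_operators.

(** * Local boundedness and strong continuity of semigroups *)

Section semigroups.
Context (dX : measure_display) (X : measurableType dX) (R : realType).
Variable mu : {measure set X -> \bar R}.
Local Notation L2 := (L2 mu).
Local Notation inner := (inner mu).
Local Notation nrm := (nrm mu).
Variable S : R -> (X -> R) -> (X -> R).
Hypothesis hS : C0_semigroup mu S.
Implicit Types (f g h : X -> R) (s t : R).

Lemma semigroup_L2 t f : 0 <= t -> L2 f -> L2 (S t f).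
Proof. by move=> t0 f2; have [+ _ _ _] := C0_semigroup_bounded hS t0; exact. Qed.

Lemma semigroup_right_cvg0 f e : L2 f -> 0 < e ->
  exists2 d, 0 < d & forall t, 0 <= t < d -> nrm (fun x => S t f x - f x) <= e.
Proof.
move=> f2 e0; have /fine_cvgP[_ /cvgrPdist_le /(_ _ e0)[d /= d0 H]] := C0_semigroup_cvg hS f2.
exists d => // t /andP[]; rewrite le_eqVlt => /predU1P[<- _|t0 td].
  rewrite (_ : nrm _ = 0) ?ltW//; apply/nrm_sub_eq0 => //; first exact: semigroup_L2.
  exact: C0_semigroup0.
have /(_ _ t0) := H t; rewrite /= !sub0r !normrN gtr0_norm// => /(_ td).
have St2 := L2_sub (semigroup_L2 (ltW t0) f2) f2.
by rewrite Lp_norm2E//= ger0_norm ?nrm_ge0.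
Qed.

(** Otherwise some [t n <= 1 / (n + 1)] has [S (t n)] of norm above [n]. Strong continuity at 0
    bounds [S (t n) f] for large [n], the finitely many others are bounded by their sum, and uniform
    boundedness is contradicted. *)
Lemma semigroup_bounded_near0 : exists d M : R, [/\ 0 < d, 1 <= M &
  forall t f, 0 <= t <= d -> L2 f -> nrm (S t f) <= M * nrm f].
Proof.
apply: contrapT => nE.
have /choice[t tP] (n : nat) : exists t, 0 <= t <= n.+1%:R^-1 /\
    exists f, L2 f /\ n%:R * nrm f < nrm (S t f).
  apply: contrapT => nt; apply: nE; exists n.+1%:R^-1, n.+1%:R.
  split=> [||t f t0 f2]; [by rewrite invr_gt0|by rewrite ler1n|].
  rewrite leNgt; apply/negP => H; apply: nt; exists t; split => //; exists f; split => //.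
  by apply: le_lt_trans H; rewrite ler_wpM2r ?nrm_ge0// ler_nat.
have t0 n : 0 <= t n by have [/andP[]] := tP n.
have bS n := C0_semigroup_bounded hS (t0 n).
have [|||||C C0 CP] := @uniform_boundedness _ _ _ mu (fun n => S (t n)).
- by move=> n f; exact: semigroup_L2.
- by move=> n f g; exact: nrm_bounded_operator_sub.
- by move=> n a f; exact: nrm_bounded_operatorZ.
- by move=> n; have [C _ CP] := bounded_operator_nrm (bS n); exists C.
- move=> f f2; have [d d0 dP] := semigroup_right_cvg0 f2 ltr01.
  have [N _ NP] := near_infty_natSinv_lt (PosNum d0).
  exists (nrm f + 1 + \sum_(i < N) nrm (S (t i) f)) => n.
  have [Nn|nN] := leqP N n.
    have : nrm (fun x => S (t n) f x - f x) <= 1.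
      apply: dP; rewrite t0/=; have [/andP[_ H] _] := tP n.
      by apply: le_lt_trans H _; exact: NP.
    have := nrm_le_sub (semigroup_L2 (t0 n) f2) f2.
    have : 0 <= \sum_(i < N) nrm (S (t i) f) by apply: sumr_ge0 => i _; exact: nrm_ge0.
    lra.
  rewrite (bigD1 (Ordinal nN))//=.
  have : 0 <= \sum_(i < N | i != Ordinal nN) nrm (S (t i) f).
    by apply: sumr_ge0 => i _; exact: nrm_ge0.
  have := nrm_ge0 mu f; lra.
have [_ [f [f2 fP]]] := tP (Num.truncn C).+1.
have := CP (Num.truncn C).+1 f f2; move: fP => /lt_le_trans /[apply].
apply/negP; rewrite -leNgt ler_wpM2r ?nrm_ge0//.
exact: ltW (truncnS_gt C).
Qed.

Lemma semigroup_bounded (T : R) : exists2 M, 0 <= M &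
  forall t f, 0 <= t <= T -> L2 f -> nrm (S t f) <= M * nrm f.
Proof.
have [d [M [d0 M1 MP]]] := semigroup_bounded_near0.
have M0 : 0 <= M by exact: le_trans M1.
have H k : forall t f, 0 <= t <= k%:R * d -> L2 f -> nrm (S t f) <= M ^+ k.+1 * nrm f.
  elim: k => [t f + f2|k IH t f /andP[t0 tk] f2].
    rewrite mul0r expr1 => /andP[t0 t0']; apply: MP => //.
    by rewrite t0 (le_trans t0')// ltW.
  have [td|dt] := leP t d.
    rewrite exprS; apply: (le_trans (MP _ _ _ f2)); first by rewrite t0.
    by rewrite ler_wpM2r ?nrm_ge0// ler_peMr// exprn_ege1.
  have td0 : 0 <= t - d by rewrite subr_ge0 ltW.
  have E : S t f = S d (S (t - d) f) %[ae mu].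
    by have := C0_semigroupD hS (ltW d0) td0 f2; rewrite addrC subrK.
  have s2 := semigroup_L2 td0 f2.
  rewrite (nrm_ae (semigroup_L2 t0 f2) (semigroup_L2 (ltW d0) s2) E).
  apply: (le_trans (MP _ _ _ s2)); first by rewrite lexx ltW.
  rewrite exprS -mulrA ler_wpM2l// IH// td0/=.
  by rewrite lerBlDr; move: tk; rewrite -natr1 mulrDl mul1r.
exists (M ^+ (Num.truncn (T / d)).+2); first by rewrite exprn_ge0.
move=> t f /andP[t0 tT] f2; apply: H => //; rewrite t0/=; apply: (le_trans tT).
by rewrite -ler_pdivrMr// ltW// truncnS_gt.
Qed.

(** Right continuity at 0, transported: for [s <= t] the difference is [S s] applied to
    [S (t - s) f - f], and the bound on [[0, T]] makes the modulus independent of [s]. This covers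
    left limits too. *)
Lemma semigroup_unif_cont (T e : R) f : L2 f -> 0 < e -> exists2 d, 0 < d &
  forall s t, 0 <= s <= T -> 0 <= t <= T -> `|t - s| < d ->
  nrm (fun x => S t f x - S s f x) <= e.
Proof.
move=> f2 e0; have [M M0 MP] := semigroup_bounded T.
have M1 : 0 < M + 1 by rewrite ltr_wpDl.
have [|d d0 dP] := @semigroup_right_cvg0 f (e / (M + 1)) f2; first by rewrite divr_gt0.
exists d => //.
suff H s t : 0 <= s <= T -> 0 <= t <= T -> s <= t -> `|t - s| < d ->
    nrm (fun x => S t f x - S s f x) <= e.
  move=> s t s0 t0 st; have [lst|/ltW lts] := leP s t; first exact: H.
  rewrite nrm_subC; first by apply: H => //; rewrite distrC.
  - by apply: semigroup_L2 => //; case/andP : t0.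
  - by apply: semigroup_L2 => //; case/andP : s0.
move=> /[dup] sT /andP[s0 _] /andP[t0 _] st; rewrite ger0_norm ?subr_ge0// => tsd.
have ts0 : 0 <= t - s by rewrite subr_ge0.
have ts2 := semigroup_L2 ts0 f2.
have E : S t f = S s (S (t - s) f) %[ae mu].
  by have := C0_semigroupD hS s0 ts0 f2; rewrite addrC subrK.
have -> : nrm (fun x => S t f x - S s f x) = nrm (fun x => S s (S (t - s) f) x - S s f x).
  apply: nrm_ae.
  - by apply: L2_sub; exact: semigroup_L2.
  - by apply: L2_sub; apply: semigroup_L2.
  - by apply: filterS E => x + _ => /(_ I) ->.
rewrite -(nrm_bounded_operator_sub (C0_semigroup_bounded hS s0))//.
apply: (le_trans (MP _ _ sT (L2_sub ts2 f2))).
have : nrm (fun x => S (t - s) f x - f x) <= e / (M + 1) by apply: dP; rewrite ts0.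
move=> /(ler_wpM2l M0) /le_trans; apply.
by rewrite mulrCA ger_pMr// ler_pdivrMr// mul1r lerDl.
Qed.

End semigroups.

(** * Smooth bump functions *)

Section flat_exponential.
Context {R : realType}.
Implicit Types (x h : R) (k : nat).

(** [x^(-k) exp(-1/x)] extended by 0. The powers are there because the derivative at index [k] is a
    combination of the functions of index [k + 2] and [k + 1]: the family is stable under
    differentiation. *)
Definition flat_exp k x : R := if 0 < x then x^-1 ^+ k * expR (- x^-1) else 0.

Lemma flat_exp_ge0 k x : 0 <= flat_exp k x.
Proof.
by rewrite /flat_exp; case: ifPn => // x0; rewrite mulr_ge0 ?expR_ge0// exprn_ge0// invr_ge0 ltW.
Qed.

Lemma expr_le_expR k x : 0 <= x -> x ^+ k <= k`!%:R * expR x.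
Proof.
move=> x0; case: k => [|k].
  by rewrite expr0 fact0 mul1r; apply: le_trans (expR_ge1Dx x); rewrite lerDl.
rewrite -ler_pdivrMl ?ltr0n ?fact_gt0// mulrC.
by apply: le_trans (expR_ge1Dxn k x0); rewrite lerDr.
Qed.

(** The factor [x^2] makes the difference quotient at 0 tend to 0. It comes from bounding the power
    [k + 2] of [x^-1] by a factorial times its exponential. *)
Lemma flat_exp_le k : exists2 C : R, 0 < C & forall x, flat_exp k x <= C * x ^+ 2.
Proof.
exists (k.+2`!%:R); first by rewrite ltr0n fact_gt0.
move=> x; rewrite /flat_exp; case: ifPn => x0; last by rewrite mulr_ge0 ?sqr_ge0.
have xi : 0 <= x^-1 by rewrite invr_ge0 ltW.
have := expr_le_expR k.+2 xi.
rewrite expRN -ler_pdivrMr ?expR_gt0// => H.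
have x2 : 0 <= x ^+ 2 by exact: sqr_ge0.
have := ler_wpM2r x2 H; apply: le_trans.
rewrite le_eqVlt; apply/orP; left; apply/eqP.
by rewrite -addn2 exprD; field; rewrite !gt_eqF ?expR_gt0.
Qed.

Lemma flat_expS k x : flat_exp k.+1 x = x^-1 * flat_exp k x.
Proof. by rewrite /flat_exp exprS; case: ifPn; rewrite ?mulr0// mulrA. Qed.

Lemma flat_exp_le0 k x : x <= 0 -> flat_exp k x = 0.
Proof. by rewrite /flat_exp ltNge => ->. Qed.

Lemma is_derive_flat_exp k x :
  is_derive x 1 (flat_exp k) (flat_exp k.+2 x - k%:R * flat_exp k.+1 x).
Proof.
case: (ltgtP x 0) => x0.
- rewrite !flat_exp_le0 ?ltW// mulr0 subrr.
  have := @is_derive_cst R R R 0 x 1; apply: near_eq_is_derive.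
  by near=> y; rewrite flat_exp_le0// ltW//; near: y; exact: lt_nbhsl.
- have x0' : x != 0 by rewrite gt_eqF.
  elim: k => [|k IH].
    have -> : flat_exp 2 x - 0%:R * flat_exp 1 x = - (- x ^- 2) * expR (- x^-1).
      by rewrite mul0r subr0 opprK /flat_exp x0 exprVn.
    have H : is_derive x 1 (fun y : R => expR (- y^-1)) (- (- x ^- 2) * expR (- x^-1)).
      have dV : is_derive x 1 (fun y : R => - y^-1) (- (- x ^- 2)).
        apply: is_deriveN; apply: DeriveDef; first exact: derivableV.
        by rewrite deriveV// derive_id /GRing.scale/= mulr1.
      by rewrite mulrC; apply: (@is_derive1_comp _ expR).
    move: H; apply: near_eq_is_derive.
    by near=> y; rewrite /flat_exp ifT ?expr0 ?mul1r//; near: y; exact: lt_nbhsr.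
  have -> : flat_exp k.+3 x - k.+1%:R * flat_exp k.+2 x =
      x^-1 * (flat_exp k.+2 x - k%:R * flat_exp k.+1 x) + flat_exp k x * (- x ^- 2).
    by rewrite !flat_expS -natr1 -exprVn; ring.
  have dV : is_derive x 1 (fun y : R => y^-1) (- x ^- 2).
    apply: DeriveDef; first exact: derivableV.
    by rewrite deriveV// derive_id /GRing.scale/= mulr1.
  have := is_deriveM dV IH; apply: near_eq_is_derive.
  by near=> y; rewrite flat_expS.
- rewrite x0 !flat_exp_le0// mulr0 subrr.
  have c0 : h^-1 *: ((flat_exp k \o shift 0) (h *: 1) - flat_exp k 0) @[h --> 0^'] --> 0.
    have [C C0 CP] := flat_exp_le k.
    apply: norm_cvg0.
    apply: (@squeeze_cvgr _ _ _ _ (cst 0) (fun h => C * `|h|)); [|exact: cvg_cst|].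
      near=> h; rewrite normr_ge0/= [flat_exp k 0]flat_exp_le0// subr0 addr0 normrZ.
      have h0 : h != 0 by near: h; exact: nbhs_dnbhs_neq.
      rewrite normfV ler_pdivrMl ?normr_gt0// ger0_norm ?flat_exp_ge0//.
      rewrite /GRing.scale/= mulr1.
      by apply: (le_trans (CP h)); rewrite -(real_normK (num_real h)) expr2 mulrCA.
    have : C * `|h| @[h --> (0:R)^'] --> C * `|0:R|.
      apply: cvgM; first exact: cvg_cst.
      by apply: cvg_norm; apply: cvg_within_filter => //.
    by rewrite normr0 mulr0.
  by apply: DeriveDef; [exact: cvgP c0|exact: cvg_lim c0].
Unshelve. all: by end_near. Qed.

Lemma differentiable_flat_exp k x : differentiable (flat_exp k) x.
Proof. by apply/derivable1_diffP; have [] := is_derive_flat_exp k x. Qed.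

Lemma flat_exp0_le1 x : flat_exp 0 x <= 1.
Proof.
rewrite /flat_exp; case: ifPn => // x0.
by rewrite expr0 mul1r expR_le1 oppr_le0 invr_ge0 ltW.
Qed.

(** Dilated profiles tend to the indicator of [0 < x] and stay at most 1, so that products of them
    replace indicators of boxes under dominated convergence. *)
Lemma flat_exp0_cvg x :
  flat_exp 0 (n.+1%:R * x) @[n --> \oo] --> (if (0 < x)%R then 1 : R else 0).
Proof.
case: (ltP 0 x) => x0; last first.
  by apply: cvg_near_cst; apply: nearW => n; rewrite flat_exp_le0// mulr_ge0_le0.
have c : expR (- (n.+1%:R^-1 * x^-1)) @[n --> \oo] --> expR (- (0 * x^-1)).
  apply: continuous_cvg; first exact: continuous_expR.
  by apply: cvgN; apply: cvgM; [exact: (@cvg_harmonic R)|exact: cvg_cst].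
rewrite mul0r oppr0 expR0 in c.
apply: cvg_trans c; apply: near_eq_cvg; apply: nearW => n.
by rewrite /flat_exp mulr_gt0// expr0 mul1r invfM.
Qed.

End flat_exponential.

Section flat_algebra.
Context {R : realType} (V : normedModType R).

(* Closed under directional derivatives, hence made of smooth functions. *)
Inductive flat_algebra : (V -> R) -> Prop :=
| flat_algebra_cst (c : R) : flat_algebra (fun=> c)
| flat_algebra_exp k a (l : {linear V -> R}) : continuous l ->
    flat_algebra (fun z => flat_exp k (a + l z))
| flat_algebraD f g : flat_algebra f -> flat_algebra g ->
    flat_algebra (fun z => f z + g z)
| flat_algebraM f g : flat_algebra f -> flat_algebra g ->
    flat_algebra (fun z => f z * g z).

Let differentiable_affine a (l : {linear V -> R}) z : continuous l ->
  differentiable (fun z => a + l z) z.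
Proof.
move=> cl; apply: differentiableD; first exact: differentiable_cst.
exact: linear_differentiable.
Qed.

Lemma flat_algebra_differentiable f z : flat_algebra f -> differentiable f z.
Proof.
elim=> [c|k a l cl|f1 f2 _ d1 _ d2|f1 f2 _ d1 _ d2].
- exact: differentiable_cst.
- apply: (@differentiable_comp _ _ _ _ (fun z => a + l z)).
    exact: differentiable_affine.
  exact: differentiable_flat_exp.
- exact: differentiableD.
- exact: differentiableM.
Qed.

Lemma flat_algebra_derive f v : flat_algebra f -> flat_algebra ('D_v f).
Proof.
elim=> [c|k a l cl|f1 f2 fa1 d1 fa2 d2|f1 f2 fa1 d1 fa2 d2].
- rewrite (_ : 'D_v _ = fun=> 0); first exact: flat_algebra_cst.
  by apply/funext => z; rewrite derive_cst.
- rewrite (_ : 'D_v _ = fun z => l v * (flat_exp k.+2 (a + l z) +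
      (- k%:R) * flat_exp k.+1 (a + l z))).
    apply: flat_algebraM; first exact: flat_algebra_cst.
    apply: flat_algebraD; first exact: flat_algebra_exp.
    by apply: flat_algebraM; [exact: flat_algebra_cst|exact: flat_algebra_exp].
  apply/funext => z.
  have da := differentiable_affine a z cl.
  have df := differentiable_flat_exp k (a + l z).
  rewrite deriveE; last exact: (@differentiable_comp _ _ _ _ (fun z => a + l z)).
  rewrite (@diff_comp _ _ _ _ (fun z => a + l z) (flat_exp k))//=.
  rewrite diff1E// derive1E.
  have -> : 'd (fun z => a + l z) z v = l v.
    rewrite (_ : (fun z => a + l z) = cst a + l)// diffD; last 2 first.
      exact: differentiable_cst.
      exact: linear_differentiable.
    by rewrite diff_cst diff_lin//= add0r.
  have [_ ->] := is_derive_flat_exp k (a + l z).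
  by rewrite mulNr.
- rewrite (_ : 'D_v _ = fun z => 'D_v f1 z + 'D_v f2 z); first exact: flat_algebraD.
  apply/funext => z; rewrite -deriveD//; apply: diff_derivable; exact: flat_algebra_differentiable.
- rewrite (_ : 'D_v _ = fun z => f1 z * 'D_v f2 z + f2 z * 'D_v f1 z).
    by apply: flat_algebraD; exact: flat_algebraM.
  apply/funext => z; rewrite [LHS](@deriveM _ _ f1 f2)//; apply: diff_derivable; exact: flat_algebra_differentiable.
Qed.

End flat_algebra.

Lemma flat_algebra_smooth (R : realType) d (f : R * 'rV[R]_d -> R) :
  flat_algebra f -> smooth f.
Proof.
move=> ff vs z; apply: flat_algebra_differentiable.
by elim: vs => [|v vs IH] //=; exact: flat_algebra_derive.
Qed.

(** The generator is a right derivative, so the mean value theorem is not at hand. For each [e], the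
    set of times at which the increment is at most [e (t - c)] contains its supremum by continuity
    and, by the right derivative, extends beyond it; then [e] tends to 0. *)
Lemma right_derivative0_eq (R : realType) (F : R -> R) (a b : R) : a < b ->
  (forall x, a <= x <= b -> {for x, continuous F}) ->
  (forall (x e : R), a < x < b -> 0 < e ->
    exists2 d : R, 0 < d & forall h : R, 0 < h < d -> `|F (x + h) - F x| <= e * h) ->
  F a = F b.
Proof.
move=> ab cF dF.
have cE (x e : R) : a <= x <= b -> 0 < e ->
    exists2 d : R, 0 < d & forall y : R, `|x - y| < d -> `|F x - F y| <= e.
  move=> xab e0; have /cvgrPdist_le/(_ _ e0)[d /= d0 H] := cF x xab.
  by exists d.
have H1 (c d e : R) : a < c -> c <= d -> d < b -> 0 < e -> `|F d - F c| <= e * (d - c).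
  move=> ac cd db e0.
  pose E := [set t | c <= t <= d /\ `|F t - F c| <= e * (t - c)].
  have Ec : E c by split; rewrite ?lexx ?cd// !subrr normr0 mulr0.
  have sE : has_sup E by split; [exists c|exists d => t [/andP[]]].
  have cs : c <= sup E by apply: ub_le_sup => //; exact: sE.2.
  have sd : sup E <= d by apply: ge_sup; [exact: sE.1|move=> t [/andP[]]].
  have sab : a < sup E < b by rewrite (lt_le_trans ac cs) (le_lt_trans sd db).
  have Es : E (sup E).
    split; first by rewrite cs.
    apply/ler_addgt0Pl => n n0.
    have sab' : a <= sup E <= b by case/andP: sab => ? ?; rewrite !ltW.
    have [r r0 rP] := cE _ _ sab' n0.
    have [t Et st] := sup_adherent r0 sE.
    have ts : t <= sup E by apply: ub_le_sup => //; exact: sE.2.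
    have : `|F (sup E) - F t| <= n by apply: rP; rewrite ger0_norm ?subr_ge0//; lra.
    have [_] := Et; have := ler_normD (F (sup E) - F t) (F t - F c).
    rewrite addrA subrK; have := ler_wpM2l (ltW e0) ts; lra.
  have [ds|sltd] := leP d (sup E).
    by have <- : sup E = d; [apply/le_anti; rewrite sd ds|have [_] := Es].
  have [r r0 rP] := dF _ _ sab e0.
  pose h := Num.min (r / 2) (d - sup E).
  have h0 : 0 < h by rewrite lt_min divr_gt0//= subr_gt0.
  have hr : h < r by rewrite gt_min; apply/orP; left; lra.
  have hd : h <= d - sup E by rewrite ge_min lexx orbT.
  have : E (sup E + h).
    split; first by apply/andP; split; lra.
    have [_ H] := Es.
    have := rP h; rewrite h0 hr => /(_ isT).
    have := ler_normD (F (sup E + h) - F (sup E)) (F (sup E) - F c).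
    rewrite addrA subrK; lra.
  by move/(ub_le_sup sE.2); rewrite gerDl leNgt h0.
have H2 c d : a < c -> c <= d -> d < b -> F d = F c.
  move=> ac cd db; apply/eqP; rewrite -subr_eq0 -normr_le0.
  apply/ler_addgt0Pl => e e0; rewrite addr0.
  have dc0 : 0 < d - c + 1 by lra.
  apply: (le_trans (H1 c d (e / (d - c + 1)) ac cd db _)); first exact: divr_gt0.
  by rewrite mulrAC ler_pdivrMr// ler_pM2l//; lra.
apply/eqP; rewrite -subr_eq0 -normr_le0; apply/ler_addgt0Pl => e e0; rewrite addr0.
have e20 : 0 < e / 2 by rewrite divr_gt0.
have [|d1 d10 D1] := cE a (e / 2) _ e20; first by rewrite lexx ltW.
have [|d2 d20 D2] := cE b (e / 2) _ e20; first by rewrite lexx ltW.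
pose m := (a + b) / 2.
(* The right derivative is controlled in the open interval only: [c] and [d] are close to the ends,
   where continuity takes over, and the midpoint keeps them in order. *)
pose c := Num.min (a + d1 / 2) m; pose d := Num.max (b - d2 / 2) m.
have am : a < m by rewrite /m; lra.
have mb : m < b by rewrite /m; lra.
have ac : a < c by rewrite lt_min am andbT; lra.
have db : d < b by rewrite gt_max mb andbT; lra.
have cm : c <= m by rewrite ge_min lexx orbT.
have md : m <= d by rewrite le_max lexx orbT.
have c1 : c <= a + d1 / 2 by rewrite ge_min lexx.
have d3 : b - d2 / 2 <= d by rewrite le_max lexx.
have := H2 c d ac (le_trans cm md) db.
have : `|F a - F c| <= e / 2 by apply: D1; rewrite ltr0_norm ?subr_lt0//; lra.
have : `|F b - F d| <= e / 2 by apply: D2; rewrite gtr0_norm ?subr_gt0//; lra.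
rewrite !ler_norml => /andP[? ?] /andP[? ?] ?; apply/andP; split; lra.
Qed.

(** [S] is only meaningful at nonnegative times. Composing with the projection onto [[0, T]], which
    is 1-Lipschitz, produces a globally continuous function, the form that the integration results
    take. *)
Lemma continuous_clamp (R : realType) (G : R -> R) (T : R) : 0 < T ->
  (forall s e : R, 0 <= s <= T -> 0 < e -> exists2 d : R, 0 < d &
    forall t : R, 0 <= t <= T -> `|t - s| < d -> `|G t - G s| <= e) ->
  exists2 Gb : R -> R, continuous Gb & forall t : R, 0 <= t <= T -> Gb t = G t.
Proof.
move=> T0 cG; pose cl (t : R) := Num.min (Num.max t 0) T.
have cl0T t : 0 <= cl t <= T.
  by rewrite /cl le_min le_max lexx orbT (ltW T0)/= ge_min lexx orbT.
have clE t : 0 <= t <= T -> cl t = t.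
  by move=> /andP[t0 tT]; rewrite /cl max_l// min_l.
exists (G \o cl); last by move=> t tT /=; rewrite clE.
move=> s; apply/cvgrPdist_le => e e0.
have [d d0 dP] := cG (cl s) e (cl0T s) e0.
exists d => //= t /= st; rewrite distrC; apply: dP => //.
have H u v : u <= v -> 0 <= cl v - cl u <= v - u.
  move=> uv; rewrite /cl.
  case: (leP u 0) => ?; case: (leP v 0) => ?; case: (leP _ T) => ?;
    try (case: (leP _ T) => ?); apply/andP; split; lra.
apply: le_lt_trans st; have [ts|/ltW st] := leP t s.
  by have /andP[h1 h2] := H _ _ ts; rewrite distrC !ger0_norm// subr_ge0.
by have /andP[h1 h2] := H _ _ st; rewrite [leRHS]distrC !ger0_norm// subr_ge0.
Qed.

Lemma L2_bounded dX (X : measurableType dX) (R : realType)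
    (mu : {finite_measure set X -> \bar R}) (f : X -> R) (C : R) : 0 <= C ->
  measurable_fun setT f -> (forall x, `|f x| <= C) ->
  L2 mu f /\ nrm mu f <= C * Num.sqrt (volume mu).
Proof.
move=> C0 mf fC.
have iC : mu.-integrable setT (EFin \o (fun=> C ^+ 2)).
  exact: finite_measure_integrable_cst.
have fC2 x : f x ^+ 2 <= C ^+ 2.
  by rewrite -(real_normK (num_real (f x))) ler_pXn2r ?nnegrE.
have if2 : mu.-integrable setT (EFin \o (fun x => f x ^+ 2)).
  apply: (le_integrable measurableT _ _ iC).
    by apply/measurable_EFinP; exact: measurable_funX.
  by move=> x _ /=; rewrite lee_fin !ger0_norm ?sqr_ge0.
have f2 : L2 mu f by apply/L2P.
split => //; rewrite -[X in X * _](ger0_norm C0) -sqrtr_sqr -sqrtrM ?sqr_ge0//.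
apply: ler_wsqrtr; rewrite /volume -Rintegral_cst//.
by apply: le_Rintegral => // x _; rewrite -expr2.
Qed.

Lemma continuous_measurable_rV_R (R : realType) d (f : 'rV[R]_d -> R) :
  continuous f -> measurable_fun setT f.
Proof.
move=> /continuousP cf; apply: (measurability _ (RGenOpens.measurableE R)) => _ [_ [a [b ->] <-]].
by rewrite setTI; apply: open_measurable_rV; apply: cf; exact: interval_open.
Qed.

(** * Test functions on the cylinder *)

Section test_functions.
Context (R : realType) (d : nat) (T : R) (O : set 'rV[R]_d).
Implicit Types (phi : R * 'rV[R]_d -> R) (K : set (R * 'rV[R]_d)).

Lemma smooth_continuous phi : smooth phi -> continuous phi.
Proof. by move=> sphi z; apply: differentiable_continuous; exact: (sphi [::]). Qed.

Lemma smooth_derive phi v : smooth phi -> smooth ('D_v phi).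
Proof.
move=> sphi vs z; have := sphi (rcons vs v) z.
by rewrite /iter_derive foldr_rcons.
Qed.

Lemma supported_derive K phi v : compact K -> supported_in K phi -> supported_in K ('D_v phi).
Proof.
move=> cK sphi z Kz; have oK : open (~` K).
  by apply: closed_openC; apply: compact_closed => //; exact: norm_hausdorff.
rewrite (@near_eq_derive _ _ _ _ (cst (0 : R))) ?derive_cst//.
have : nbhs z (~` K) by exact: open_nbhs_nbhs.
by apply: filterS => w Kw; rewrite sphi.
Qed.

Lemma supported_bounded K phi : compact K -> continuous phi -> supported_in K phi ->
  exists2 C : R, 0 <= C & forall z, `|phi z| <= C.
Proof.
move=> cK cphi sphi.
have cc : compact (phi @` K).
  by apply: continuous_compact => //; exact: continuous_subspaceT.
have [M [Mr MP]] := compact_bounded cc.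
exists (`|M| + 1) => // z.
have [Kz|Kz] := pselect (K z); last by rewrite sphi// normr0.
apply: (MP (`|M| + 1)); last by exists z.
by rewrite (le_lt_trans (ler_norm M))// ltrDl.
Qed.

Lemma is_derive_time phi (t : R) x : smooth phi ->
  is_derive t 1 (fun s => phi (s, x)) (time_derivative phi (t, x)).
Proof.
move=> sphi.
have dphi : derivable phi (t, x) (1, 0) by apply: diff_derivable; exact: (sphi [::]).
have E (h : R) : (h *: (1, 0) + (t, x) : R * 'rV[R]_d) = (h *: 1 + t, x).
  by apply: (congr2 pair) => //=; rewrite scaler0 add0r.
split.
  move: dphi; rewrite /derivable /=.
  by under eq_fun do rewrite E.
by rewrite /time_derivative /derive /=; under [in RHS]eq_fun do rewrite E.
Qed.

(** The mean value theorem in time, used once for the increment and twice for the Taylor remainder.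
    Compact support bounds both time derivatives, so the constant does not depend on [x]. *)
Lemma test_function_time_bounds K phi : compact K -> smooth phi -> supported_in K phi ->
  exists2 C : R, 0 <= C & forall s t x,
    `|phi (t, x) - phi (s, x)| <= C * `|t - s| /\
    `|phi (t, x) - phi (s, x) - (t - s) * time_derivative phi (s, x)|
      <= C * `|t - s| ^+ 2.
Proof.
move=> cK sphi Kphi.
have s1 : smooth (time_derivative phi) by exact: smooth_derive.
have K1 : supported_in K (time_derivative phi) by exact: supported_derive.
have s2 : smooth (time_derivative (time_derivative phi)) by exact: smooth_derive.
have K2 : supported_in K (time_derivative (time_derivative phi)) by exact: supported_derive.
have [C1 C10 C1P] := supported_bounded cK (smooth_continuous s1) K1.
have [C2 C20 C2P] := supported_bounded cK (smooth_continuous s2) K2.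
have mvt (f : R * 'rV[R]_d -> R) s t x : smooth f -> exists u : R, `|u - s| <= `|t - s| /\
    f (t, x) - f (s, x) = time_derivative f (u, x) * (t - s).
  move=> sf; have cf (a b : R) : {within `[a, b], continuous (fun u => f (u, x))}.
    apply: continuous_subspaceT => u; apply: differentiable_continuous.
    by apply/derivable1_diffP; have [] := is_derive_time u x sf.
  have [st|ts] := leP s t.
    have [|u ust ->] := @MVT_segment _ _ (fun u => time_derivative f (u, x)) _ _ st _ (cf _ _).
      by move=> u _; exact: is_derive_time.
    exists u; split => //; move: ust; rewrite in_itv/= => /andP[? ?].
    by rewrite !ger0_norm ?subr_ge0// lerD2r.
  have [|u ust H] := @MVT_segment _ _ (fun u => time_derivative f (u, x)) _ _ (ltW ts) _ (cf _ _).
    by move=> u _; exact: is_derive_time.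
  exists u; split; last by rewrite -opprB H; ring.
  move: ust; rewrite in_itv/= => /andP[? ?].
  by rewrite ler0_norm ?subr_le0// ltr0_norm ?subr_lt0// lerN2 lerD2r.
exists (C1 + C2) => [|s t x]; first exact: addr_ge0.
split.
  have [u [_ ->]] := mvt phi s t x sphi; rewrite normrM ler_wpM2r//.
  by apply: (le_trans (C1P _)); rewrite lerDl.
have [u [us ->]] := mvt phi s t x sphi.
have [w [_ H]] := mvt _ s u x s1.
have -> : time_derivative phi (u, x) * (t - s) - (t - s) * time_derivative phi (s, x) =
  (time_derivative phi (u, x) - time_derivative phi (s, x)) * (t - s) by ring.
rewrite H !normrM -mulrA expr2; apply: ler_pM => //.
- by apply: (le_trans (C2P _)); rewrite lerDr.
- by rewrite -expr2 expr2 ler_wpM2r.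
Qed.

End test_functions.

(** * The weak solution attached to a final datum *)

Section semigroup_pairing.
Context (dX : measure_display) (X : measurableType dX) (R : realType).
Variable mu : {measure set X -> \bar R}.
Variables (S : R -> (X -> R) -> (X -> R)) (T : R).
Hypothesis hS : C0_semigroup mu S.
Hypothesis T0 : 0 < T.
Local Notation L2 := (L2 mu).
Local Notation inner := (inner mu).
Local Notation nrm := (nrm mu).

Lemma semigroup_pairing_continuous_at (f : R -> X -> R) (C : R) p :
  0 <= C -> (forall t, L2 (f t)) ->
  (forall s t, nrm (fun x => f t x - f s x) <= C * `|t - s|) -> L2 p ->
  forall s e : R, 0 <= s <= T -> 0 < e -> exists2 d : R, 0 < d &
    forall t : R, 0 <= t <= T -> `|t - s| < d ->
    `|inner (S t (f t)) p - inner (S s (f s)) p| <= e.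
Proof.
move=> C0 f2 fC p2 s e sT e0.
have [M M0 MP] := semigroup_bounded hS T.
have P0 : 0 < nrm p + 1 by rewrite ltr_wpDl ?nrm_ge0.
have e1 : 0 < e / (2 * (nrm p + 1)) by rewrite divr_gt0// mulr_gt0.
have [d1 d10 D1] := semigroup_unif_cont hS T (f2 s) e1.
have K0 : 0 < M * C * nrm p + 1 by rewrite ltr_wpDl// !mulr_ge0// nrm_ge0.
exists (Num.min d1 (e / (2 * (M * C * nrm p + 1)))).
  by rewrite lt_min d10 divr_gt0// mulr_gt0.
move=> t tT; rewrite lt_min => /andP[td1 td2].
have t0 : 0 <= t by case/andP: tT.
have s0 : 0 <= s by case/andP: sT.
have bt := C0_semigroup_bounded hS t0.
have St u : L2 u -> L2 (S t u) by exact: semigroup_L2.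
have Ss u : L2 u -> L2 (S s u) by exact: semigroup_L2.
have H1 : `|inner (S t (f t)) p - inner (S t (f s)) p| <= e / 2.
  rewrite -innerBl//; [|exact: St|exact: St].
  apply: (le_trans (normr_inner_le _ p2)); first by apply: L2_sub; exact: St.
  rewrite -(nrm_bounded_operator_sub bt)//.
  apply: (@le_trans _ _ (M * (C * `|t - s|) * nrm p)).
    apply: ler_wpM2r; first exact: nrm_ge0.
    apply: (le_trans (MP t _ tT _)); first exact: L2_sub.
    exact: ler_wpM2l.
  have : (M * C * nrm p + 1) * `|t - s| <= e / 2.
    rewrite mulrC -ler_pdivlMr//; apply: (le_trans (ltW td2)).
    by rewrite invfM mulrA.
  have := normr_ge0 (t - s); lra.
have H2 : `|inner (S t (f s)) p - inner (S s (f s)) p| <= e / 2.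
  rewrite -innerBl//; [|exact: St|exact: Ss].
  apply: (le_trans (normr_inner_le _ p2)); first by apply: L2_sub; [exact: St|exact: Ss].
  have := ler_wpM2r (nrm_ge0 mu p) (D1 s t sT tT td1) => /le_trans; apply.
  rewrite (_ : _ * nrm p = e / 2 * (nrm p / (nrm p + 1))); last by field; rewrite gt_eqF.
  by rewrite ger_pMr ?divr_gt0// ler_pdivrMr// mul1r lerDl.
have := ler_normD (inner (S t (f t)) p - inner (S t (f s)) p)
  (inner (S t (f s)) p - inner (S s (f s)) p).
rewrite addrA subrK; lra.
Qed.

Lemma semigroup_pairing_continuous (f : R -> X -> R) (C : R) p :
  0 <= C -> (forall t, L2 (f t)) ->
  (forall s t, nrm (fun x => f t x - f s x) <= C * `|t - s|) -> L2 p ->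
  exists2 Gb : R -> R, continuous Gb &
    forall t : R, 0 <= t <= T -> Gb t = inner (S t (f t)) p.
Proof.
move=> C0 f2 fC p2; apply: continuous_clamp => // s e sT e0.
exact: (semigroup_pairing_continuous_at C0).
Qed.

Lemma semigroup_pairing_bounded : exists2 M : R, 0 <= M &
  forall t f p, 0 <= t <= T -> L2 f -> L2 p ->
  `|inner (S t f) p| <= M * nrm f * nrm p.
Proof.
have [M M0 MP] := semigroup_bounded hS T; exists M => // t f p tT f2 p2.
have t0 : 0 <= t by case/andP: tT.
apply: (le_trans (normr_inner_le (semigroup_L2 hS t0 f2) p2)).
by apply: ler_wpM2r; [exact: nrm_ge0|exact: MP].
Qed.

(* The difference quotient splits into the Taylor remainder of [f] moved by
   [S (t + h)], the strong continuity of [S], and the generator at [f t]. *)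
Lemma semigroup_pairing_right_derivative (f f' : R -> X -> R) (A : X -> R) (C t : R) p :
  0 <= C -> (forall t, L2 (f t)) -> (forall t, L2 (f' t)) ->
  (forall h, nrm (fun x => f (t + h) x - f t x - h * f' t x) <= C * h ^+ 2) ->
  0 < t < T -> right_derivative0 mu S (f t) A -> L2 p ->
  forall e : R, 0 < e -> exists2 d : R, 0 < d & forall h : R, 0 < h < d ->
    `|inner (S (t + h) (f (t + h))) p - inner (S t (f t)) p
      - h * inner (S t (fun x => f' t x + A x)) p| <= e * h.
Proof.
move=> C0 f2 f'2 fC /andP[t0 tT] [A2 cA] p2 e e0.
have [M M0 MP] := semigroup_pairing_bounded.
pose P := M * nrm p + nrm p + 1.
have P0 : 0 < P by rewrite ltr_wpDl// addr_ge0 ?mulr_ge0 ?nrm_ge0.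
have e3 : 0 < e / (3 * P) by rewrite divr_gt0// mulr_gt0.
have [d1 d10 D1] := semigroup_unif_cont hS T (f'2 t) e3.
have [d2 /= d20 D2] : exists2 d : R, 0 < d & forall h, 0 < h < d ->
    nrm (fun x => h^-1 * (S h (f t) x - f t x) - A x) <= e / (3 * P).
  have /fine_cvgP[_ /cvgrPdist_le /(_ _ e3)[d /= d0 H]] := cA.
  exists d => // h /andP[h0 hd]; have /(_ _ h0) := H h.
  rewrite /= !sub0r !normrN gtr0_norm// => /(_ hd).
  have S2 := semigroup_L2 hS (ltW h0) (f2 t).
  rewrite Lp_norm2E//= ?ger0_norm ?nrm_ge0//.
  by apply: L2_sub => //; apply: L2_scale; exact: L2_sub.
exists (Num.min (Num.min d1 d2) (Num.min (T - t) (e / (3 * (C * P + 1))))).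
  by rewrite !lt_min d10 d20 subr_gt0 tT divr_gt0// mulr_gt0// ltr_wpDl// mulr_ge0// ltW.
move=> h; rewrite !lt_min => /andP[h0 /andP[/andP[hd1 hd2] /andP[hT hC]]].
have th0 : 0 <= t + h by rewrite addr_ge0 ?ltW.
have thT : 0 <= t + h <= T by rewrite th0/=; lra.
have tT' : 0 <= t <= T by rewrite !ltW.
have bth := C0_semigroup_bounded hS th0.
have bt := C0_semigroup_bounded hS (ltW t0).
have Sth u : L2 u -> L2 (S (t + h) u) by exact: semigroup_L2.
have St u : L2 u -> L2 (S t u) by exact: (semigroup_L2 hS (ltW t0)).
pose r x := f (t + h) x - f t x - h * f' t x.
have r2 : L2 r by apply: L2_sub; [exact: L2_sub|exact: L2_scale].
pose q x := h^-1 * (S h (f t) x - f t x) - A x.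
have Sh2 := semigroup_L2 hS (ltW h0) (f2 t).
have q2 : L2 q by apply: L2_sub => //; apply: L2_scale; exact: L2_sub.
have E1 : inner (S (t + h) (f (t + h))) p =
    inner (S (t + h) r) p + (h * inner (S (t + h) (f' t)) p + inner (S (t + h) (f t)) p).
  have -> : f (t + h) = fun x => 1 * r x + (h * f' t x + f t x).
    by apply/funext => x; rewrite /r; ring.
  rewrite (inner_bounded_operator_lin bth)//; last exact: L2_lin.
  by rewrite (inner_bounded_operator_lin bth)// mul1r.
have E2 : inner (S (t + h) (f t)) p =
    h * inner (S t q) p + (h * inner (S t A) p + inner (S t (f t)) p).
  have D := C0_semigroupD hS (ltW t0) (ltW h0) (f2 t).
  rewrite (inner_ae (Sth _ (f2 t)) (St _ Sh2) p2 D).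
  rewrite -!(inner_bounded_operator_lin bt)//; last exact: L2_lin.
  congr (inner (S t _) p); apply/funext => x; rewrite /q; field.
  by rewrite gt_eqF.
have E3 : inner (S t (fun x => f' t x + A x)) p = inner (S t (f' t)) p + inner (S t A) p.
  rewrite -[X in X + _]mul1r -(inner_bounded_operator_lin bt)//.
  by congr (inner (S t _) p); apply/funext => x; rewrite mul1r.
have -> : inner (S (t + h) (f (t + h))) p - inner (S t (f t)) p
      - h * inner (S t (fun x => f' t x + A x)) p =
  inner (S (t + h) r) p + (h * (inner (S (t + h) (f' t)) p - inner (S t (f' t)) p)
  + h * inner (S t q) p) by rewrite E1 E2 E3; ring.
have MnP : M * nrm p <= P by rewrite /P -addrA lerDl addr_ge0 ?nrm_ge0.
have nP : nrm p <= P.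
  by rewrite /P addrAC lerDr addr_ge0 ?mulr_ge0 ?nrm_ge0.
have H1 : `|inner (S (t + h) r) p| <= e / 3 * h.
  apply: (le_trans (MP _ _ _ thT r2 p2)).
  have : M * nrm r * nrm p <= P * (C * h ^+ 2).
    by rewrite mulrAC; apply: ler_pM; rewrite ?mulr_ge0 ?nrm_ge0//; exact: fC.
  move=> /le_trans; apply.
  have : (C * P + 1) * h <= e / 3.
    rewrite mulrC -ler_pdivlMr ?ltr_wpDl// ?mulr_ge0// ?(ltW P0)//.
    by apply: (le_trans (ltW hC)); rewrite invfM mulrA.
  move=> /(ler_wpM2r (ltW h0)); rewrite expr2; have := sqr_ge0 h; rewrite expr2; lra.
have H2 : `|h * (inner (S (t + h) (f' t)) p - inner (S t (f' t)) p)| <= e / 3 * h.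
  rewrite normrM gtr0_norm// mulrC ler_pM2r// -innerBl//; [|exact: Sth|exact: St].
  apply: (le_trans (normr_inner_le _ p2)); first by apply: L2_sub; [exact: Sth|exact: St].
  apply: (@le_trans _ _ (e / (3 * P) * P)).
    apply: ler_pM => //; try exact: nrm_ge0.
    by apply: D1 => //; rewrite addrAC subrr add0r gtr0_norm.
  by rewrite le_eqVlt; apply/orP; left; apply/eqP; field; rewrite gt_eqF.
have H3 : `|h * inner (S t q) p| <= e / 3 * h.
  rewrite normrM gtr0_norm// mulrC ler_pM2r//.
  apply: (le_trans (MP _ _ _ tT' q2 p2)).
  apply: (@le_trans _ _ (P * (e / (3 * P)))).
    rewrite mulrAC; apply: ler_pM => //; try exact: nrm_ge0.
      by rewrite mulr_ge0 ?nrm_ge0.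
    by apply: D2; rewrite h0.
  by rewrite le_eqVlt; apply/orP; left; apply/eqP; field; rewrite gt_eqF.
have := ler_normD (inner (S (t + h) r) p) (h * (inner (S (t + h) (f' t)) p - inner (S t (f' t)) p)
  + h * inner (S t q) p).
have := ler_normD (h * (inner (S (t + h) (f' t)) p - inner (S t (f' t)) p)) (h * inner (S t q) p).
lra.
Qed.

End semigroup_pairing.

Lemma continuous_integrable_itvoo (R : realType) (G Gb : R -> R) (T : R) : 0 < T ->
  continuous Gb -> (forall t, 0 <= t <= T -> Gb t = G t) ->
  (@lebesgue_measure R).-integrable `]0, T[ (EFin \o G).
Proof.
move=> T0 cG GE.
have H : (@lebesgue_measure R).-integrable `[0, T] (EFin \o Gb).
  apply: continuous_compact_integrable; first exact: segment_compact.
  exact: continuous_subspaceT.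
have : (@lebesgue_measure R).-integrable `]0, T[ (EFin \o Gb).
  by apply: integrableS H => //; exact: subset_itv_oo_cc.
apply: eq_integrable => // t /[!inE]/=; rewrite in_itv/= => /andP[t0 tT].
by rewrite GE// !ltW.
Qed.

(** Subtracting a primitive of [g] leaves a function of zero right derivative, hence of equal end
    values by [right_derivative0_eq]; as [G] also has equal end values, the integral vanishes. *)
Lemma integral_right_derivative_eq0 (R : realType) (G g : R -> R) (T : R) : 0 < T ->
  continuous G -> continuous g -> G 0 = G T ->
  (forall t e : R, 0 < t < T -> 0 < e -> exists2 d : R, 0 < d &
    forall h : R, 0 < h < d -> `|G (t + h) - G t - h * g t| <= e * h) ->
  \int[@lebesgue_measure R]_(t in `]0, T[) g t = 0.
Proof.
move=> T0 cG cg GT dG.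
have ig (a b : R) : (@lebesgue_measure R).-integrable `[a, b] (EFin \o g).
  apply: continuous_compact_integrable; first exact: segment_compact.
  exact: continuous_subspaceT.
(* The primitive starts at [-1], so that [0] is an interior point at which it is continuous. *)
pose I (t : R) : R := \int[@lebesgue_measure R]_(s in `[-1, t]) g s.
have dI (t : R) : -1 < t -> derivable I t 1 /\ derive1 I t = g t.
  move=> t1; apply: (@continuous_FTC1_closed _ g (-1) t (t + 1)) => //.
  - by rewrite ltrDl.
  - exact: cg.
have FE : (fun t => G t - I t) 0 = (fun t => G t - I t) T.
  apply: (@right_derivative0_eq _ (fun t => G t - I t) 0 T T0).
  - move=> x /andP[x0 _]; apply: continuousB; first exact: cG.
    apply: differentiable_continuous; apply/derivable1_diffP.
    by have [] := dI x; first by lra.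
  - move=> t e tT e0; have t1 : -1 < t by lra.
    have e20 : 0 < e / 2 by rewrite divr_gt0.
    have [d1 d10 D1] := dG t _ tT e20.
    have [dIt It] := dI t t1.
    have : h^-1 *: (I (t + h) - I t) @[h --> 0^'] --> g t.
      rewrite -It derive1E; move: dIt; rewrite /derivable /derive /= => dIt.
      have E : (fun h : R => h^-1 *: (I (h *: 1 + t) - I t)) = (fun h : R => h^-1 *: (I (t + h) - I t)).
        by apply/funext => h; congr (_ *: (I _ - _)); rewrite [h%:A]mulr1 addrC.
      by rewrite -E.
    move=> /cvgrPdist_le /(_ _ e20)[d2 /= d20 D2].
    exists (Num.min d1 d2); first by rewrite lt_min d10.
    move=> h; rewrite lt_min => /andP[h0 /andP[hd1 hd2]].
    have := D1 h; rewrite h0 hd1 => /(_ isT) H1.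
    have := D2 h; rewrite /= sub0r normrN gtr0_norm// => /(_ hd2).
    rewrite gt_eqF// => /(_ isT) H2.
    have H3 : `|h * g t - (I (t + h) - I t)| <= e / 2 * h.
      rewrite (_ : h * g t - _ = h * (g t - h^-1 *: (I (t + h) - I t))).
        by rewrite normrM gtr0_norm// mulrC ler_pM2r.
      by rewrite /GRing.scale/=; field; rewrite gt_eqF.
    have := ler_normD (G (t + h) - G t - h * g t) (h * g t - (I (t + h) - I t)).
    have -> : G (t + h) - G t - h * g t + (h * g t - (I (t + h) - I t)) =
      G (t + h) - I (t + h) - (G t - I t) by ring.
    lra.
have : I T - I 0 = 0 by move: FE => /=; lra.
rewrite /I Rintegral_itvB ?bnd_simp//; last exact: ltW.
by rewrite -Rintegral_itv_bndo_bndc//; apply: integrableS (ig 0 T) => //; exact: subset_itv_oo_cc.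
Qed.

(** * The adjoint equation in the sense of distributions *)

Section weak_solution.
Context (R : realType) (d : nat) (T : R) (O : set 'rV[R]_d).
Variable mu : {finite_measure set 'rV[R]_d -> \bar R}.
Variables (S : R -> ('rV[R]_d -> R) -> ('rV[R]_d -> R)).
Hypothesis hS : C0_semigroup mu S.
Hypothesis T0 : 0 < T.
Local Notation L2 := (L2 mu).
Local Notation inner := (inner mu).
Local Notation nrm := (nrm mu).
Implicit Types (phi psi : R * 'rV[R]_d -> R) (p : 'rV[R]_d -> R).

Lemma slice_measurable phi (t : R) : continuous phi -> measurable_fun setT (fun x => phi (t, x)).
Proof.
move=> cphi; apply: continuous_measurable_rV_R => x.
apply: (@continuous_comp _ _ _ (fun x => (t, x)) phi); last exact: cphi.
move=> A [[B C] /= [Bt Cx] BCA]; apply: filterS Cx => y Cy.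
by apply: BCA; split => //=; exact: nbhs_singleton.
Qed.

Lemma slice_L2 K phi t : compact K -> smooth phi -> supported_in K phi ->
  L2 (fun x => phi (t, x)).
Proof.
move=> cK sphi Kphi.
have [C C0 CP] := supported_bounded cK (smooth_continuous sphi) Kphi.
by have [] := L2_bounded mu C0 (slice_measurable t (smooth_continuous sphi)) (fun x => CP (t, x)).
Qed.

Lemma slice_time_bounds K phi : compact K -> smooth phi -> supported_in K phi ->
  exists2 C : R, 0 <= C & forall s t,
    nrm (fun x => phi (t, x) - phi (s, x)) <= C * `|t - s| /\
    nrm (fun x => phi (t, x) - phi (s, x) - (t - s) * time_derivative phi (s, x))
      <= C * `|t - s| ^+ 2.
Proof.
move=> cK sphi Kphi.
have [C C0 CP] := test_function_time_bounds cK sphi Kphi.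
have m1 (t : R) : measurable_fun setT (fun x => phi (t, x)).
  by apply: slice_measurable; exact: smooth_continuous.
have m2 (t : R) : measurable_fun setT (fun x => time_derivative phi (t, x)).
  by apply: slice_measurable; apply: smooth_continuous; exact: smooth_derive.
exists (C * Num.sqrt (volume mu)) => [|s t]; first by rewrite mulr_ge0.
split; rewrite mulrAC.
  have [|||//] := @L2_bounded _ _ _ mu (fun x => phi (t, x) - phi (s, x)) (C * `|t - s|).
  - by rewrite mulr_ge0.
  - exact: measurable_funB.
  - by move=> x; have [] := CP s t x.
have [|||//] := @L2_bounded _ _ _ mu (fun x => phi (t, x) - phi (s, x)
    - (t - s) * time_derivative phi (s, x)) (C * `|t - s| ^+ 2).
- by rewrite mulr_ge0.
- by apply: measurable_funB; [exact: measurable_funB|exact: measurable_funM].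
- by move=> x; have [] := CP s t x.
Qed.

Lemma slice_pairing_continuous K phi p : compact K -> smooth phi -> supported_in K phi ->
  L2 p -> exists2 Gb : R -> R, continuous Gb &
    forall t : R, 0 <= t <= T -> Gb t = inner (S t (fun x => phi (t, x))) p.
Proof.
move=> cK sphi Kphi p2.
have [C C0 CP] := slice_time_bounds cK sphi Kphi.
apply: (@semigroup_pairing_continuous _ _ _ _ _ _ hS T0 (fun t x => phi (t, x)) C) => //.
- by move=> t; exact: (slice_L2 _ cK).
- by move=> s t; have [] := CP s t.
Qed.

(** [S] acts on the test function instead of its adjoint on [p]: the integrand is then continuous in
    time, whereas no joint measurability of [S_t^* p] is known at this stage. *)
Definition semigroup_distribution p phi : R :=
  \int[@lebesgue_measure R]_(t in `]0, T[) inner (S t (fun x => phi (t, x))) p.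

Lemma slice_pairing_integrable K phi p : compact K -> smooth phi -> supported_in K phi ->
  L2 p -> (@lebesgue_measure R).-integrable `]0, T[
    (EFin \o (fun t => inner (S t (fun x => phi (t, x))) p)).
Proof.
move=> cK sphi Kphi p2; have [Gb cG GE] := slice_pairing_continuous cK sphi Kphi p2.
exact: (continuous_integrable_itvoo T0 cG).
Qed.

Lemma distribution_semigroup p : L2 p -> Defs.distribution T O (semigroup_distribution p).
Proof.
move=> p2; split.
  move=> a phi psi [sphi [K [cK _ Kphi]]] [spsi [K' [cK' _ Kpsi]]].
  have i1 := slice_pairing_integrable cK sphi Kphi p2.
  have i2 := slice_pairing_integrable cK' spsi Kpsi p2.
  rewrite /semigroup_distribution -RintegralZl// -RintegralD//; last first.
    by apply: eq_integrable (integrableZl _ a i1).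
  apply: eq_Rintegral => t; rewrite inE/= in_itv/= => /andP[t0 _].
  by rewrite (inner_bounded_operator_lin (C0_semigroup_bounded hS (ltW t0)))//;
    [exact: (slice_L2 _ cK)|exact: (slice_L2 _ cK')].
move=> K cK _; have [M M0 MP] := semigroup_pairing_bounded T hS.
pose C := M * Num.sqrt (volume mu) * nrm p.
have C0 : 0 <= C by rewrite !mulr_ge0 ?nrm_ge0.
(* The pairing is controlled by the sup norm of the test function, so the distribution has order 0;
   [T] is the length of the time interval. *)
exists (C * T), 0%N => phi m sphi Kphi phim.
have phim' z : `|phi z| <= m by exact: (phim [::]).
have m0 : 0 <= m by apply: le_trans (phim' 0).
have i1 := slice_pairing_integrable cK sphi Kphi p2.
apply: (le_trans (le_normr_Rintegral _ i1)) => //.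
have -> : C * T * m = \int[@lebesgue_measure R]_(t in `]0, T[) (C * m).
  by rewrite Rintegral_cst//= lebesgue_measure_itv/= lte_fin T0 -EFinB/= subr0; ring.
apply: le_Rintegral => //.
- by have := integrable_norm i1; apply: eq_integrable.
- apply: (@continuous_integrable_itvoo _ _ (fun=> C * m) _ T0) => // t.
  exact: cvg_cst.
- move=> t /=; rewrite in_itv/= => /andP[t0 tT].
  have [f2 fn] := L2_bounded mu m0 (slice_measurable t (smooth_continuous sphi)) (fun x => phim' (t, x)).
  apply: (le_trans (MP _ _ _ _ f2 p2)); first by rewrite !ltW.
  rewrite (_ : C * m = M * (m * Num.sqrt (volume mu)) * nrm p); last by rewrite /C; ring.
  by rewrite ler_wpM2r ?nrm_ge0// ler_wpM2l.
Qed.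

(** The pairing [<S_t phi(t), p>] vanishes at both ends because [phi] is supported in the open
    cylinder, and its right derivative is [<S_t (phi' + A phi), p>]. The integral of the latter is
    therefore 0. *)
Lemma semigroup_distributional_solution D A p : generates mu D A S -> L2 p ->
  distributional_solution T O mu D A (semigroup_distribution p) (fun=> 0).
Proof.
move=> [_ _ genA] p2 phi psi [sphi [K [cK KO Kphi]]] [spsi [K' [cK' KO' Kpsi]]] phipsi.
rewrite /regular_distribution.
under eq_Rintegral do rewrite mul0r.
rewrite (_ : Rintegral _ _ _ = 0); last by rewrite /Rintegral integral0_eq.
have s1 : smooth (time_derivative phi) by exact: smooth_derive.
have K1 : supported_in K (time_derivative phi) by exact: supported_derive.
have phi2 t := slice_L2 t cK sphi Kphi.
have phi'2 t := slice_L2 t cK s1 K1.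
have psi2 t := slice_L2 t cK' spsi Kpsi.
have [G cG GE] := slice_pairing_continuous cK sphi Kphi p2.
have [g1 cg1 g1E] := slice_pairing_continuous cK s1 K1 p2.
have [g2 cg2 g2E] := slice_pairing_continuous cK' spsi Kpsi p2.
have [C C0 CP] := slice_time_bounds cK sphi Kphi.
have z0 t : ~~ (0 < t < T) -> (fun x => phi (t, x)) = fun=> 0.
  move=> tT; apply/funext => x; apply: Kphi => /KO[/=].
  by rewrite in_itv/= (negbTE tT).
have nS0 t : 0 <= t -> inner (S t (fun=> 0)) p = 0.
  move=> t0; have bt := C0_semigroup_bounded hS t0.
  have S0 := semigroup_L2 hS t0 (L2_cst0 mu).
  have := normr_inner_le S0 p2.
  by rewrite nrm_bounded_operator0// mul0r normr_le0 => /eqP.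
have := @integral_right_derivative_eq0 _ G (fun t => g1 t + g2 t) T T0 cG.
have -> : G 0 = 0 by rewrite GE ?lexx ?ltW// z0 ?ltxx// nS0.
have -> : G T = 0 by rewrite GE ?lexx ?ltW// z0 ?ltxx ?andbF// nS0// ltW.
move=> H; rewrite /semigroup_distribution -[RHS]oppr0 -[in RHS](H _ _ _) //.
- rewrite -mulN1r -RintegralZl//; last first.
    apply: (@continuous_integrable_itvoo _ _ (fun t => g1 t + g2 t) _ T0) => //.
    by move=> t; apply: continuousD; [exact: cg1|exact: cg2].
  apply: eq_Rintegral => t; rewrite inE/= in_itv/= => /andP[t0 tT].
  have bt := C0_semigroup_bounded hS (ltW t0).
  rewrite g1E ?g2E ?ltW//.
  rewrite (_ : (fun x => _) = fun x => -1 * time_derivative phi (t, x) +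
     (-1 * psi (t, x) + 0)); last by apply/funext => x; ring.
  rewrite !(inner_bounded_operator_lin bt)//.
  + by rewrite nS0 ?ltW//; ring.
  + exact: L2_cst0.
  + by apply: L2_lin => //; exact: L2_cst0.
- by move=> t; apply: continuousD; [exact: cg1|exact: cg2].
- move=> t e tT e0; have [Dt At] := phipsi t tT.
  have [|d0 d00 dP] := @semigroup_pairing_right_derivative _ _ _ _ _ _ hS
    (fun t x => phi (t, x)) (fun t x => time_derivative phi (t, x)) _ C t p C0 phi2 phi'2
    _ tT (genA _ Dt) p2 e e0.
    move=> h; have [_] := CP t (t + h).
    by rewrite addrAC subrr add0r real_normK ?num_real.
  have /andP[t0 ltT] := tT.
  exists (Num.min d0 (T - t)); first by rewrite lt_min d00 subr_gt0.
  move=> h; rewrite lt_min => /andP[h0 /andP[hd hT]].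
  have hd' : 0 < h < d0 by rewrite h0 hd.
  have H' := dP h hd'.
  rewrite GE; last by apply/andP; split; lra.
  rewrite GE; last by apply/andP; split; lra.
  have tT' : 0 <= t <= T by rewrite !ltW.
  rewrite (g1E _ tT') (g2E _ tT').
  have bt := C0_semigroup_bounded hS (ltW t0).
  have [A2 _] := genA _ Dt.
  have S2 u : L2 u -> L2 (S t u) by exact: (semigroup_L2 hS (ltW t0)).
  have E : inner (S t (fun x => time_derivative phi (t, x) + A (fun x => phi (t, x)) x)) p =
     inner (S t (fun x => time_derivative phi (t, x))) p + inner (S t (fun x => psi (t, x))) p.
    rewrite -[X in X + _]mul1r -(inner_bounded_operator_lin bt)//.
    apply: inner_ae => //; [exact/S2/L2_add|exact/S2/L2_lin|].
    have [_ Sae _ _] := bt; apply: Sae; [exact: L2_add|exact: L2_lin|].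
    by apply: filterS At => x + _ => /(_ I) ->; rewrite mul1r.
  by rewrite -E; exact: H'.
Qed.

End weak_solution.

(** * Restricted measures, Fubini, and functions determined by a pi-system *)

Section restricted_measure.
Context (dX : measure_display) (X : measurableType dX) (R : realType).
Variables (mu : {measure set X -> \bar R}) (D : set X) (mD : measurable D).
Local Open Scope ereal_scope.
Local Notation restr := (mrestr mu mD).

Let restr_setC : restr (~` D) = 0.
Proof. by rewrite /mrestr setICl measure0. Qed.

Let eq_restr (f : X -> \bar R) : \int[restr]_(x in D) f x = \int[mu]_(x in D) f x.
Proof.
by apply: eq_measure_integral => A mA AD; rewrite /= /mrestr setIidl.
Qed.

Lemma integral_mrestr (f : X -> \bar R) : measurable_fun setT f ->
  \int[restr]_x f x = \int[mu]_(x in D) f x.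
Proof.
move=> mf; have mC := measurableC mD.
have H (g : X -> \bar R) : measurable_fun setT g -> (forall x, 0 <= g x) ->
    \int[restr]_x g x = \int[mu]_(x in D) g x.
  move=> mg g0; rewrite (ge0_negligible_integral mC measurableT mg (fun x _ => g0 x) restr_setC).
  by rewrite setTD setCK eq_restr.
rewrite [LHS]integralE [RHS]integralE; congr (_ - _); apply: H => //.
  exact: measurable_funepos.
exact: measurable_funeneg.
Qed.

Lemma integrable_mrestr (f : X -> \bar R) : measurable_fun setT f ->
  restr.-integrable setT f <-> mu.-integrable D f.
Proof.
move=> mf; split=> /integrableP[_ ioo]; apply/integrableP; split => //.
- exact: measurable_funTS.
- by move: ioo; rewrite integral_mrestr//; exact: measurableT_comp.
- by rewrite integral_mrestr//; exact: measurableT_comp.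
Qed.

Lemma ae_mrestr (P : X -> Prop) :
  {ae restr, forall x, P x} <-> {ae mu, forall x, D x -> P x}.
Proof.
split=> [[N [mN N0 PN]]|[N [mN N0 PN]]].
  exists (N `&` D); split => //; first exact: measurableI.
  by move=> x /= /not_implyP[Dx Px]; split => //; exact: PN.
exists (N `|` ~` D); split; first by apply: measurableU => //; exact: measurableC.
  rewrite /mrestr setIUl setICl setU0.
  by apply: (subset_measure0 _ mN _ N0); [exact: measurableI|exact: subIsetl].
move=> x /= Px; have [Dx|] := pselect (D x); last by right.
by left; apply: PN => /= /(_ Dx).
Qed.

End restricted_measure.

Lemma Rfubini (d1 d2 : measure_display) (T1 : measurableType d1) (T2 : measurableType d2)
    (R : realType) (m1 : {sigma_finite_measure set T1 -> \bar R})
    (m2 : {sigma_finite_measure set T2 -> \bar R}) (D1 : set T1) (D2 : set T2)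
    (f : T1 * T2 -> R) : measurable D1 -> measurable D2 ->
  (m1 \x m2)%E.-integrable (D1 `*` D2) (EFin \o f) ->
  [/\ m1.-integrable D1 (EFin \o (fun x => \int[m2]_(y in D2) f (x, y))),
    \int[(m1 \x m2)%E]_(z in D1 `*` D2) f z =
      \int[m1]_(x in D1) \int[m2]_(y in D2) f (x, y) &
    {ae m1, forall x, D1 x -> m2.-integrable D2 (EFin \o (fun y => f (x, y)))}].
Proof.
move=> mD1 mD2 if12; have mD : measurable (D1 `*` D2) by exact: measurableX.
pose F := (EFin \o f) \_ (D1 `*` D2).
have iF : (m1 \x m2)%E.-integrable setT F by apply/(integrable_mkcond _ mD).
have FE x y : D1 x -> F (x, y) = ((fun y => (f (x, y))%:E) \_ D2) y.
  move=> D1x; rewrite /F !patchE; congr (if _ then _ else _).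
  by apply/idP/idP; rewrite !inE/=; [case|split].
have FE0 x y : ~ D1 x -> F (x, y) = 0%E.
  by move=> D1x; rewrite /F patchE memNset// => -[].
have sec x : D1 x -> (\int[m2]_y F (x, y) = \int[m2]_(y in D2) (f (x, y))%:E)%E.
  by move=> D1x; rewrite [RHS]integral_mkcond; apply: eq_integral => y _; rewrite FE.
have sec0 x : ~ D1 x -> (\int[m2]_y F (x, y) = 0)%E.
  by move=> D1x; apply: integral0_eq => y _; rewrite FE0.
have ae1 : {ae m1, forall x, D1 x -> m2.-integrable D2 (EFin \o (fun y => f (x, y)))}.
  have := ae_integrable1 iF; apply: filterS => x /= H D1x.
  apply/(integrable_mkcond _ mD2); apply: eq_integrable H => // y _.
  by rewrite FE.
have iG := integrable_fubini_F iF.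
have EG x : D1 x -> fubini_F m2 F x \is a fin_num ->
    (\int[m2]_(y in D2) f (x, y))%:E = fubini_F m2 F x.
  by move=> D1x Ffin; rewrite /Rintegral /fubini_F -sec// fineK.
have aeG := integrable_ae measurableT iG.
(* The inner real integral is [fine] of the extended one by definition, so [G] equals it at every
   point of [D1], also where the section is not integrable. *)
pose G x := fine (fubini_F m2 F x).
have mG : measurable_fun setT G.
  by apply: (@measurableT_comp _ _ _ _ _ _ (@fine R)) => //; exact: (measurable_int _ iG).
have GE x : D1 x -> \int[m2]_(y in D2) f (x, y) = G x.
  by move=> D1x; rewrite /G /fubini_F sec.
have iG' : m1.-integrable setT (EFin \o G).
  apply: (le_integrable measurableT _ _ iG) => [|x _]; first exact/measurable_EFinP.
  by rewrite /= /G; case: (fubini_F _ _ _) => [r||]//=; rewrite ?normr0 ?leey.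
split => //.
- apply: (@eq_integrable _ _ _ _ D1 mD1 (EFin \o G)); last exact: integrableS iG'.
  by move=> x; rewrite inE => D1x; rewrite /= GE.
- rewrite (@eq_Rintegral _ _ _ m1 D1 G); last by move=> x; rewrite inE => /GE.
  rewrite /Rintegral [in LHS]integral_mkcond -/F -integral12_prod_meas1//.
  congr fine; rewrite [RHS]integral_mkcond; apply: ae_eq_integral => //.
  + exact: (measurable_int _ iG).
  + by apply/measurable_restrict => //; apply/measurable_EFinP; exact: measurable_funTS.
  + apply: filterS aeG => x /(_ I) Ffin _; rewrite patchE; case: ifPn.
      by move=> _; rewrite /G fineK.
    by rewrite notin_setE => D1x; rewrite /fubini_F sec0.
Qed.

(** Dynkin's argument: the measurable sets over which [f] has zero integral form a lambda system,
    increasing unions being handled by dominated convergence. Once all measurable subsets of [D] are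
    reached, [f] vanishes almost everywhere. *)
Lemma ae_eq0_setI_closed (dX : measure_display) (X : measurableType dX) (R : realType)
    (mu : {measure set X -> \bar R}) (G : set (set X)) (D : set X) (f : X -> R) :
  measurable D -> setI_closed G -> @measurable _ X = <<s G >> ->
  mu.-integrable D (EFin \o f) -> \int[mu]_(x in D) f x = 0 ->
  (forall A, G A -> \int[mu]_(x in D `&` A) f x = 0) ->
  {ae mu, forall x, D x -> f x = 0}.
Proof.
move=> mD GI mG if_ f0 fG.
pose H := [set A | measurable A /\ \int[mu]_(x in D `&` A) f x = 0].
have iS A : measurable A -> mu.-integrable (D `&` A) (EFin \o f).
  by move=> mA; apply: integrableS if_ => //; exact: measurableI.
have lH : lambda_system setT H.
  split => //; first by split => //; rewrite setIT.
    move=> A B BA [mA A0] [mB B0]; split; first exact: measurableD.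
    have E : D `&` A = (D `&` (A `\` B)) `|` (D `&` B).
      by rewrite -setIUr setUC setDUK.
    have := A0; rewrite E Rintegral_setU//; first by rewrite B0 addr0.
    - by apply: measurableI => //; exact: measurableD.
    - exact: measurableI.
    - by rewrite -E; exact: iS.
    - by apply/disj_setPS => x [[_ [_ nB]] [_ Bx]]; exact: nB.
  move=> F ndF HF; have mF i : measurable (F i) by have [] := HF i.
  have mUF : measurable (\bigcup_i F i) by exact: bigcup_measurable.
  split => //.
  have mf : measurable_fun D f by apply/measurable_EFinP; exact: (measurable_int _ if_).
  have E B : \int[mu]_(x in D `&` B) f x = \int[mu]_(x in D) (f x * \1_B x).
    rewrite Rintegral_mkcondr; apply: eq_Rintegral => x _.
    by rewrite patchE indicE; case: ifPn; rewrite ?mulr1 ?mulr0.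
  have [||||_ c] := @Rdominated_cvg _ _ _ mu D (fun n x => f x * \1_(F n) x)
     (fun x => f x * \1_(\bigcup_i F i) x) (fun x => `|f x|) mD _ _ _ (integrable_norm if_).
  - by move=> n; apply: measurable_funM => //; exact: measurable_funTS.
  - by apply: measurable_funM => //; exact: measurable_funTS.
  - apply: nearW => x Dx; apply: cvgM; first exact: cvg_cst.
    have [[i _ Fix]|nFx] := pselect ((\bigcup_i F i) x).
      apply: cvg_near_cst; exists i => // n /= ni.
      rewrite !indicE !mem_set//; first by exists i.
      by move/ndF : ni => /subsetPset; exact.
    apply: cvg_near_cst; apply: nearW => n; rewrite !indicE !memNset//.
    by move=> Fnx; apply: nFx; exists n.
  - apply: nearW => x n Dx; rewrite normrM ler_piMr// indicE.
    by case: (_ \in _); rewrite ?normr1 ?normr0.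
  rewrite E; apply: (cvg_unique _ c); first exact: norm_hausdorff.
  by apply: cvg_near_cst; apply: nearW => n; rewrite -E; have [] := HF n.
have HT A : measurable A -> H A.
  rewrite mG; apply: (lambda_system_subset GI lH) => // A' GA'.
  by split; [rewrite mG; exact: sub_sigma_algebra|exact: fG].
have : ae_eq mu D (EFin \o f) (cst 0%E).
  apply: integral_ae_eq => // A AD mA; rewrite integral0.
  have iA : mu.-integrable A (EFin \o f) by exact: integrableS if_.
  rewrite -(fineK (integrable_fin_num mA iA)); congr EFin.
  by have [_] := HT A mA; rewrite /Rintegral setIidr.
by apply: filterS => x /= H0 /H0 [].
Qed.

(** * Local bounds for space-analytic functions *)

Section space_analytic_bounded.
Context (R : realType) (d : nat).
Implicit Types (c : {ffun 'I_d -> nat} -> R) (h x : 'rV[R]_d).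

Lemma rV_coord_le x i : `|x ord0 i| <= `|x|.
Proof. by rewrite [leRHS]mx_normrE; exact: (le_bigmax _ _ (ord0, i)). Qed.

Lemma homogeneous_part_le c n h (r M : R) : 0 < r ->
  (forall a, `|c a| * r ^+ (\sum_i a i)%N <= M) -> `|h| <= r / 2 ^+ d.+1 ->
  `|homogeneous_part c n h| <= M * 2^-1 ^+ n.
Proof.
move=> r0 cM hr.
have M0 : 0 <= M.
  by apply: le_trans (cM [ffun=> 0%N]); rewrite mulr_ge0// exprn_ge0// ltW.
have rho0 : 0 <= r / 2 ^+ d.+1 by rewrite divr_ge0 ?exprn_ge0// ltW.
have H (a : {ffun 'I_d -> 'I_n.+1}) : (\sum_i a i == n)%N ->
    `|c [ffun i => a i : nat] * \prod_i h ord0 i ^+ a i| <= M * (2^-1 ^+ d.+1) ^+ n.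
  move=> /eqP an; rewrite normrM normr_prod.
  have : \prod_i `|h ord0 i ^+ a i| <= (r / 2 ^+ d.+1) ^+ n.
    rewrite -[in leRHS]an expr_sum; apply: ler_prod => i _.
    rewrite normr_ge0 normrX/=; apply: lerXn2r; rewrite ?nnegrE//.
    by apply: le_trans hr; exact: rV_coord_le.
  move=> /(ler_wpM2l (normr_ge0 (c [ffun i => a i : nat]))) /le_trans; apply.
  have := cM [ffun i => a i : nat].
  rewrite (_ : (\sum_i _)%N = n); last first.
    by rewrite -[RHS]an; apply: eq_bigr => i _; rewrite ffunE.
  move=> /(ler_wpM2r (_ : 0 <= (2^-1 ^+ d.+1) ^+ n)) => /(_ (exprn_ge0 _ (exprn_ge0 _ _))) H.
  apply: le_trans (H _) => //.
  by rewrite -mulrA -exprMn exprVn.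
rewrite /homogeneous_part; apply: (le_trans (ler_norm_sum _ _ _)).
apply: (le_trans (ler_sum _ H)).
have M2 : 0 <= M * (2^-1 ^+ d.+1) ^+ n by rewrite mulr_ge0// !exprn_ge0.
apply: (@le_trans _ _ (\sum_(a : {ffun 'I_d -> 'I_n.+1}) M * (2^-1 ^+ d.+1) ^+ n)).
  by rewrite [leRHS](bigID (fun a : {ffun 'I_d -> 'I_n.+1} => (\sum_i a i == n)%N))/=
    lerDl sumr_ge0.
rewrite sumr_const -[X in X <= _]mulr_natl cardT -cardE card_ffun !card_ord.
have : ((n.+1 ^ d)%:R : R) <= (2 ^+ n) ^+ d.
  rewrite -natrX -natrX ler_nat.
  have [->|d0] := posnP d; first by rewrite !expn0.
  by rewrite leq_exp2r// ltn_expl.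
move=> /(ler_wpM2r M2) /le_trans; apply.
have E : (2 ^+ n) ^+ d * (2^-1 ^+ d.+1) ^+ n = 2^-1 ^+ n :> R.
  by rewrite exprS exprMn mulrCA -!exprM (mulnC d n) -exprMn divff// expr1n mulr1.
by rewrite mulrCA E.
Qed.

(** Since [r] and [M] do not depend on time, the bound holds in a neighbourhood in both variables;
    the factor 2 is the sum of the geometric series. *)
Lemma space_analytic_locally_bounded (T : R) (O : set 'rV[R]_d) g t0 x0 :
  space_analytic T O g -> cylinder T O (t0, x0) ->
  exists e B : R, 0 < e /\ forall t x, `|t - t0| < e -> `|x - x0| < e -> `|g (t, x)| <= B.
Proof.
move=> [_ ag] /ag[r [M [r0 [c cP]]]].
have p1 : (1 : R) <= 2 ^+ d.+1 by rewrite exprn_ege1// ler1n.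
have e0 : 0 < r / 2 ^+ d.+1 by rewrite divr_gt0// exprn_gt0.
have er : r / 2 ^+ d.+1 <= r by rewrite ler_pdivrMr ?exprn_gt0// ler_peMr// ltW.
exists (r / 2 ^+ d.+1), (2 * M); split => // t x tt0 xx0.
have [cM cvg] := cP t (lt_le_trans tt0 er).
have {}cvg := cvg x (lt_le_trans xx0 er).
have M0 : 0 <= M.
  by apply: le_trans (cM [ffun=> 0%N]); rewrite mulr_ge0// exprn_ge0// ltW.
apply: (cvgr_to_le (cvg_norm cvg)); apply: nearW => N /=.
apply: (le_trans (ler_norm_sum _ _ _)).
have : \sum_(0 <= n < N) `|homogeneous_part (c t) n (x - x0)| <= \sum_(0 <= n < N) M * 2^-1 ^+ n.
  by apply: ler_sum => n _; apply: (homogeneous_part_le _ r0 cM); exact: ltW.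
move=> /le_trans; apply.
rewrite -mulr_sumr mulrC ler_wpM2r//.
have : \sum_(0 <= n < N) 2^-1 ^+ n = 2 - 2 * 2^-1 ^+ N :> R.
  elim: N => [|N IH]; first by rewrite big_geq// expr0; ring.
  by rewrite big_nat_recr//= IH exprS; field.
by move=> ->; rewrite gerBl mulr_ge0// exprn_ge0.
Qed.

(** Gives [g] the integrability on compact boxes that Fubini and dominated convergence require when
    it is tested with bumps. *)
Lemma space_analytic_compact_bounded (T : R) (O : set 'rV[R]_d) g K :
  space_analytic T O g -> compact K -> K `<=` cylinder T O ->
  exists2 B : R, 0 <= B & forall z, K z -> `|g z| <= B.
Proof.
move=> ag cK KO.
have /compact_near_coveringP /(_ _ +oo (fun B z => `|g z| <= B)) := cK.
case.
  move=> [t0 x0] Kz; have [e [B [e0 eB]]] := space_analytic_locally_bounded ag (KO _ Kz).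
  exists (ball (t0, x0) e, [set y | B <= y]) => /=.
    by split; [exact: nbhsx_ballx|apply: nbhs_pinfty_ge; rewrite num_real].
  move=> [[t x] y] /= [[/= bt bx] By]; apply: le_trans By.
  apply: eB; first by rewrite distrC.
  by rewrite distrC; move: bx; rewrite mx_norm_ball.
move=> B0 [B0r HB]; exists (`|B0| + 1) => // z; apply: HB.
by rewrite (le_lt_trans (ler_norm _))// ltrDl.
Qed.

End space_analytic_bounded.

(** * Identification with an analytic function *)

Lemma ae_forall_count (dX : measure_display) (X : measurableType dX) (R : realType)
    (mu : {measure set X -> \bar R}) (I : countType) (P : I -> X -> Prop) :
  (forall i, {ae mu, forall x, P i x}) -> {ae mu, forall x, forall i, P i x}.
Proof.
move=> H; pose Q n x := if unpickle n is Some i then P i x else True.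
have : {ae mu, forall x, forall n, Q n x}.
  apply: ae_foralln => n; rewrite /Q; case: unpickle => [i|]; first exact: H.
  exact: nearW.
by apply: filterS => x Qx i; have := Qx (pickle i); rewrite /Q pickleK.
Qed.

Lemma ae_filter1 (dX : measure_display) (X : measurableType dX) (R : realType)
    (mu : {measure set X -> \bar R}) (P W : X -> Prop) :
  {ae mu, forall x, P x} -> (forall x, P x -> W x) -> {ae mu, forall x, W x}.
Proof. by move=> H1 H; apply: filterS H1. Qed.

Lemma ae_filter2 (dX : measure_display) (X : measurableType dX) (R : realType)
    (mu : {measure set X -> \bar R}) (P Q W : X -> Prop) :
  {ae mu, forall x, P x} -> {ae mu, forall x, Q x} -> (forall x, P x -> Q x -> W x) ->
  {ae mu, forall x, W x}.
Proof. by move=> H1 H2 H; apply: filterS2 H1 H2. Qed.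

Lemma product_measure_lty (d1 d2 : measure_display) (T1 : measurableType d1)
    (T2 : measurableType d2) (R : realType) (m1 : {sigma_finite_measure set T1 -> \bar R})
    (m2 : {sigma_finite_measure set T2 -> \bar R}) (A : set T1) (B : set T2) :
  measurable A -> measurable B -> (m1 A < +oo)%E -> (m2 B < +oo)%E ->
  ((m1 \x m2)%E (A `*` B) < +oo)%E.
Proof.
by move=> mA mB ? ?; rewrite product_measure1E// lte_mul_pinfty// ge0_fin_numE.
Qed.

(** * Smooth bumps of intervals and boxes *)

Section box_bumps.
Context (R : realType) (d : nat).
Implicit Types (a b x : 'rV[R]_d) (s t : R) (n : nat).

Definition open_box a b : set 'rV[R]_d :=
  [set x | forall i, a ord0 i < x ord0 i < b ord0 i].
Definition closed_box a b : set 'rV[R]_d :=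
  [set x | forall i, a ord0 i <= x ord0 i <= b ord0 i].

Lemma open_box_closed a b : open_box a b `<=` closed_box a b.
Proof. by move=> x H i; have /andP[? ?] := H i; rewrite !ltW. Qed.

Lemma measurable_open_box a b : measurable (open_box a b).
Proof.
rewrite (_ : open_box a b = \bigcap_(i in [set: 'I_d])
    ((fun x : 'rV[R]_d => x ord0 i) @^-1` `]a ord0 i, b ord0 i[)).
  apply: fin_bigcap_measurable => // i _; apply: open_measurable_rV.
  by apply: open_comp => [x _|]; [exact: coord_continuous|exact: interval_open].
by apply/seteqP; split=> [x Bx i _|x Bx i]; have := Bx i;
  rewrite /= in_itv/=; [exact|move=> /(_ I)].
Qed.

Lemma compact_closed_box a b : compact (closed_box a b).
Proof.
rewrite (_ : closed_box a b = [set x | forall i, `[a ord0 i, b ord0 i]%classic (x ord0 i)]).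
  apply: (@rV_compact R d (fun i => `[a ord0 i, b ord0 i]%classic)) => i.
  exact: segment_compact.
by apply/seteqP; split => x H i; have := H i; rewrite /= in_itv.
Qed.

Definition itv_bump n s t (r : R) : R :=
  flat_exp 0 (n.+1%:R * (r - s)) * flat_exp 0 (n.+1%:R * (t - r)).

Definition box_bump n a b x : R := \prod_i itv_bump n (a ord0 i) (b ord0 i) (x ord0 i).

Lemma itv_bump_ge0 n s t r : 0 <= itv_bump n s t r.
Proof. by rewrite mulr_ge0// flat_exp_ge0. Qed.

Lemma itv_bump_le1 n s t r : itv_bump n s t r <= 1.
Proof. by rewrite mulr_ile1 ?flat_exp_ge0 ?flat_exp0_le1. Qed.

Lemma itv_bump_eq0 n s t r : ~~ (s < r < t) -> itv_bump n s t r = 0.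
Proof.
rewrite negb_and -!leNgt /itv_bump => /orP[rs|tr].
  by rewrite flat_exp_le0 ?mul0r// mulr_ge0_le0// subr_le0.
by rewrite [X in _ * X]flat_exp_le0 ?mulr0// mulr_ge0_le0// subr_le0.
Qed.

Lemma itv_bump_cvg s t r : itv_bump n s t r @[n --> \oo] --> ((s < r < t)%R%:R : R).
Proof.
rewrite (_ : _%:R = (if (0 < r - s)%R then 1 : R else 0) * (if (0 < t - r)%R then 1 : R else 0)).
  by apply: cvgM; exact: flat_exp0_cvg.
by rewrite !subr_gt0; case: ifPn; case: ifPn; rewrite ?mulr1 ?mulr0.
Qed.

Lemma box_bump_ge0 n a b x : 0 <= box_bump n a b x.
Proof. by apply: prodr_ge0 => i _; exact: itv_bump_ge0. Qed.

Lemma box_bump_le1 n a b x : box_bump n a b x <= 1.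
Proof.
by apply: prodr_ile1 => i _; rewrite itv_bump_ge0 itv_bump_le1.
Qed.

Lemma box_bump_eq0 n a b x : ~ open_box a b x -> box_bump n a b x = 0.
Proof.
move=> /existsNP[i /negP xi]; rewrite /box_bump (bigD1 i)//= itv_bump_eq0 ?mul0r//.
Qed.

Lemma box_bump_cvg a b x : box_bump n a b x @[n --> \oo] --> (\1_(open_box a b) x : R).
Proof.
rewrite (_ : \1_(open_box a b) x = \prod_i ((a ord0 i < x ord0 i < b ord0 i)%R%:R : R)).
  by apply: cvg_big => [|i _]; [exact: mul_continuous|exact: itv_bump_cvg].
rewrite indicE; have [xb|nxb] := pselect (open_box a b x).
  by rewrite mem_set// big1// => i _; rewrite xb.
rewrite memNset//; move/existsNP : nxb => [i /negP/negbTE xi].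
by rewrite (bigD1 i)//= xi mul0r.
Qed.

Lemma measurable_itv_bump n s t : measurable_fun setT (itv_bump n s t).
Proof.
have cf (u : R -> R) : continuous u -> measurable_fun setT (fun r => flat_exp 0 (u r)).
  move=> cu; apply: continuous_measurable_fun => r.
  apply: (@continuous_comp _ _ _ u (flat_exp 0)); first exact: cu.
  exact/differentiable_continuous/differentiable_flat_exp.
by apply: measurable_funM; apply: cf => r; apply: cvgM; (try exact: cvg_cst);
  apply: cvgB; (try exact: cvg_cst); exact: cvg_id.
Qed.

Lemma measurable_box_bump n a b : measurable_fun setT (box_bump n a b).
Proof.
apply: measurable_prod => i _.
apply: (@measurableT_comp _ _ _ _ _ _ (itv_bump n (a ord0 i) (b ord0 i))).
  exact: measurable_itv_bump.
by apply: continuous_measurable_rV_R => x; exact: coord_continuous.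
Qed.

Lemma flat_algebra_affine (V : normedModType R) k (c : R) (f : V -> R) :
  linear f -> continuous f -> flat_algebra (fun z => flat_exp k (c + f z)).
Proof.
move=> lf cf; pose l : {linear V -> R} := HB.pack f (GRing.isLinear.Build R V R *%R f lf).
exact: (@flat_algebra_exp _ _ k c l).
Qed.

Lemma flat_algebra_itv_bump (V : normedModType R) n s t (f : V -> R) :
  linear f -> continuous f -> flat_algebra (fun z => itv_bump n s t (f z)).
Proof.
move=> lf cf; apply: flat_algebraM.
  rewrite (_ : (fun z => _) = fun z => flat_exp 0 (- (n.+1%:R * s) + n.+1%:R * f z)).
    apply: (@flat_algebra_affine _ _ _ (fun z => n.+1%:R * f z)).
      by move=> k u v; rewrite lf /GRing.scale/=; ring.
    by move=> x; apply: cvgM; [exact: cvg_cst|exact: cf].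
  by apply/funext => z; congr flat_exp; ring.
rewrite (_ : (fun z => _) = fun z => flat_exp 0 (n.+1%:R * t + (- n.+1%:R) * f z)).
  apply: (@flat_algebra_affine _ _ _ (fun z => - n.+1%:R * f z)).
    by move=> k u v; rewrite lf /GRing.scale/=; ring.
  by move=> x; apply: cvgM; [exact: cvg_cst|exact: cf].
by apply/funext => z; congr flat_exp; ring.
Qed.

Lemma smooth_bump n m s t a b :
  smooth (fun z : R * 'rV[R]_d => itv_bump n s t z.1 * box_bump m a b z.2).
Proof.
apply: flat_algebra_smooth; apply: flat_algebraM.
  by apply: (@flat_algebra_itv_bump _ n s t (fun z : R * 'rV[R]_d => z.1)) => // z; exact: cvg_fst.
rewrite /box_bump; elim: (index_enum 'I_d) => [|i r IH].
  by under eq_fun do rewrite big_nil; exact: flat_algebra_cst.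
under eq_fun do rewrite big_cons.
apply: flat_algebraM => //.
apply: (@flat_algebra_itv_bump _ m (a ord0 i) (b ord0 i) (fun z : R * 'rV[R]_d => z.2 ord0 i)).
  by move=> k u v; rewrite /= !mxE.
move=> z; apply: (@continuous_comp _ _ _ snd (fun x : 'rV[R]_d => x ord0 i)).
  exact: cvg_snd.
exact: coord_continuous.
Qed.

Lemma test_function_bump T O n m s t s0 t0 a b : s0 <= s -> t <= t0 -> 0 < s0 -> t0 < T ->
  closed_box a b `<=` O ->
  test_function T O (fun z : R * 'rV[R]_d => itv_bump n s t z.1 * box_bump m a b z.2) /\
  supported_in (`[s0, t0] `*` closed_box a b)
    (fun z : R * 'rV[R]_d => itv_bump n s t z.1 * box_bump m a b z.2).
Proof.
move=> s0s tt0 s00 t0T abO.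
have H : supported_in (`[s0, t0] `*` closed_box a b)
    (fun z : R * 'rV[R]_d => itv_bump n s t z.1 * box_bump m a b z.2).
  move=> [r x] /= /not_andP[rst|xab].
    rewrite itv_bump_eq0 ?mul0r//; apply/negP => /andP[? ?]; apply: rst.
    by rewrite in_itv/=; apply/andP; split; lra.
  by rewrite box_bump_eq0 ?mulr0// => /open_box_closed.
split => //; split; first exact: smooth_bump.
exists (`[s0, t0] `*` closed_box a b); split => //.
  by apply: compact_setX; [exact: segment_compact|exact: compact_closed_box].
move=> [r x] [/=]; rewrite in_itv/= => /andP[s0r rt0] xab; split => /=; last exact: abO.
by rewrite in_itv/=; apply/andP; split; lra.
Qed.

End box_bumps.

Section identification.
Context (R : realType) (d : nat) (T : R) (O : set 'rV[R]_d).
Hypotheses (oO : open O) (finO : (lebesgue_rV R d O < +oo)%E) (T0 : 0 < T).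
Let mu := lebesgue_on oO finO.
Local Notation leb := (@lebesgue_measure R).
Local Notation L2 := (L2 mu).
Local Notation inner := (Defs.inner mu).

Let lI : (leb `]0%R, T[%classic < +oo)%E.
Proof. by rewrite lebesgue_measure_itv/= lte_fin T0 ltry. Qed.

Lemma integral_lebesgue_on (f : 'rV[R]_d -> R) : measurable_fun setT f ->
  \int[lebesgue_rV R d]_(x in O) f x = \int[mu]_x f x.
Proof.
move=> mf; rewrite /Rintegral; congr fine; apply/esym.
by apply: integral_mrestr; exact/measurable_EFinP.
Qed.

Variables (S : R -> ('rV[R]_d -> R) -> ('rV[R]_d -> R)) (g : R * 'rV[R]_d -> R)
  (p : 'rV[R]_d -> R).
Hypotheses (hS : C0_semigroup mu S) (p2 : L2 p) (ag : space_analytic T O g).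
Hypothesis gp : forall phi, test_function T O phi ->
  semigroup_distribution T mu S p phi = regular_distribution T O g phi.
Hypothesis mg : measurable_fun setT g.

Section one_box.
Variables (s0 t0 : R) (a0 b0 : 'rV[R]_d).
Hypotheses (s00 : 0 < s0) (st0 : s0 < t0) (t0T : t0 < T).
Hypothesis abO : closed_box a0 b0 `<=` O.

Let K : set (R * 'rV[R]_d) := `[s0, t0] `*` closed_box a0 b0.

Let KO : K `<=` cylinder T O.
Proof.
have s0' := s00; have t0' := t0T.
move=> [r x] [/=]; rewrite in_itv/= => /andP[s0r rt0] xab; split => /=; last exact: abO.
by rewrite in_itv/=; apply/andP; split; lra.
Qed.

Let cK : compact K.
Proof. by apply: compact_setX; [exact: segment_compact|exact: compact_closed_box]. Qed.

Let mK : measurable K.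
Proof.
apply: measurableX; first exact: measurable_itv.
rewrite (_ : closed_box a0 b0 = \bigcap_(i in [set: 'I_d])
    ((fun x : 'rV[R]_d => x ord0 i) @^-1` `[a0 ord0 i, b0 ord0 i])).
  apply: fin_bigcap_measurable => // i _; rewrite -[X in measurable X]setTI.
  by apply: continuous_measurable_rV_R => //; exact: coord_continuous.
by apply/seteqP; split=> [x Bx i _|x Bx i]; have := Bx i;
  rewrite /= in_itv/=; [exact|move=> /(_ I)].
Qed.

(** Cutting [g] off outside [K] makes it bounded on the whole space; bumps supported in [K] do not
    see the change. *)
Let gK (z : R * 'rV[R]_d) : R := g z * \1_K z.

Let mgK : measurable_fun setT gK.
Proof. by apply: measurable_funM => //; exact: measurable_indic mK. Qed.

Let gK_bounded : exists2 B : R, 0 <= B & forall z, `|gK z| <= B.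
Proof.
have [B B0 HB] := space_analytic_compact_bounded ag cK KO.
exists B => // z; rewrite /gK indicE; have [Kz|nKz] := pselect (K z).
  by rewrite mem_set// mulr1 HB.
by rewrite memNset// mulr0 normr0.
Qed.

Let integrable_O (f : 'rV[R]_d -> R) (C : R) : measurable_fun setT f ->
  (forall x, `|f x| <= C) -> mu.-integrable setT (EFin \o f).
Proof.
move=> mf fC; apply: measurable_bounded_integrable => //.
  by rewrite ltey_eq fin_num_measure.
by exists C; split; [rewrite num_real|move=> y Cy x _; exact: le_trans (fC x) (ltW Cy)].
Qed.

Let box_bump_L2 m a b : L2 (box_bump m a b).
Proof.
have [x|//] := @L2_bounded _ _ _ mu _ 1 ler01 (measurable_box_bump m a b).
by rewrite ger0_norm ?box_bump_ge0// box_bump_le1.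
Qed.

Section moments.
Variables (m : nat) (a b : 'rV[R]_d).
Hypotheses (aa0 : forall i, a0 ord0 i <= a ord0 i) (bb0 : forall i, b ord0 i <= b0 ord0 i).

Let phi_K x : box_bump m a b x != 0 -> closed_box a0 b0 x.
Proof.
move=> px i; have /andP[xa xb] : a ord0 i < x ord0 i < b ord0 i.
  by apply/negPn/negP => H; move/eqP: px; apply; apply: box_bump_eq0 => /(_ i); exact/negP.
by rewrite (le_trans (aa0 i) (ltW xa)) (le_trans (ltW xb) (bb0 i)).
Qed.

Let kappa (t : R) : R := inner (S t (box_bump m a b)) p.
Let gamma (t : R) : R := \int[mu]_x (gK (t, x) * box_bump m a b x).

Let bump_L2 := box_bump_L2 m a b.

Let kappa_integrable : leb.-integrable `]0, T[ (EFin \o kappa).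
Proof.
have [||||Gb cG HG] := @semigroup_pairing_continuous _ _ _ mu S T hS T0 (fun=> box_bump m a b) 0 p => //.
- by move=> s t; rewrite mul0r (_ : (fun x => _) = fun=> 0) ?/nrm ?inner0l ?sqrtr0//;
    apply/funext => x; rewrite subrr.
exact: (continuous_integrable_itvoo T0 cG).
Qed.

Let F n s t (z : R * 'rV[R]_d) : R := gK z * (itv_bump n s t z.1 * box_bump m a b z.2).

Let F_integrable n s t : (leb \x lebesgue_rV R d)%E.-integrable (`]0, T[ `*` O) (EFin \o F n s t).
Proof.
have [B B0 HB] := gK_bounded.
apply: measurable_bounded_integrable => //.
- apply: measurableX => //; exact: open_measurable_rV.
- by apply: product_measure_lty => //; exact: open_measurable_rV.
- apply: measurable_funM; first exact: measurable_funTS.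
  apply: measurable_funTS; apply: measurable_funM.
    by apply: (measurableT_comp (measurable_itv_bump n s t)); exact: measurable_fst.
  by apply: (measurableT_comp (measurable_box_bump m a b)); exact: measurable_snd.
- exists B; split; [by rewrite num_real|move=> y By z _].
  rewrite /= /F normrM; apply: le_trans (ltW By); apply: le_trans (HB z).
  rewrite ler_piMr// ger0_norm; last by rewrite mulr_ge0 ?box_bump_ge0// itv_bump_ge0.
  by rewrite mulr_ile1 ?itv_bump_ge0 ?box_bump_ge0 ?itv_bump_le1 ?box_bump_le1.
Qed.

Let gamma_integrable : leb.-integrable `]0, T[ (EFin \o gamma).
Proof.
have [B B0 HB] := gK_bounded.
pose G (z : R * 'rV[R]_d) : R := gK z * box_bump m a b z.2.
have mG : measurable_fun setT G.
  apply: measurable_funM => //.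
  by apply: (measurableT_comp (measurable_box_bump m a b)); exact: measurable_snd.
have GB z : `|G z| <= B.
  rewrite /G normrM; apply: le_trans (HB z).
  by rewrite ler_piMr// ger0_norm ?box_bump_ge0// box_bump_le1.
have iG : (leb \x mu)%E.-integrable (`]0, T[ `*` setT) (EFin \o G).
  apply: measurable_bounded_integrable => //.
  - exact: measurableX.
  - by apply: product_measure_lty => //; rewrite -ge0_fin_numE// fin_num_measure.
  - exact: measurable_funTS.
  - by exists B; split; [rewrite num_real|move=> y By z _; exact: le_trans (GB z) (ltW By)].
have mI : measurable (`]0, T[%classic : set (measurableTypeR R)) by exact: measurable_itv.
by have [] := Rfubini mI measurableT iG.
Qed.

Let bump_pairing n s t : s0 <= s -> t <= t0 ->
  \int[leb]_(r in `]0, T[) (itv_bump n s t r * (kappa r - gamma r)) = 0.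
Proof.
move=> ss tt.
have [|] := @test_function_bump R d T O n m s t s0 t0 a b ss tt s00 t0T.
  by apply: subset_trans abO => x xab i; have /andP[? ?] := xab i;
    rewrite (le_trans (aa0 i))//= (le_trans _ (bb0 i)).
move=> /gp E _.
have mI : measurable (`]0, T[%classic : set (measurableTypeR R)) by exact: measurable_itv.
have bI (h : R -> R) : leb.-integrable `]0, T[ (EFin \o h) ->
    leb.-integrable `]0, T[ (EFin \o (fun r => itv_bump n s t r * h r)).
  move=> ih; apply: (le_integrable mI _ _ ih).
    apply/measurable_EFinP; apply: measurable_funM.
      by apply: measurable_funTS; exact: measurable_itv_bump.
    by apply/measurable_EFinP; exact: (measurable_int _ ih).
  move=> r _; rewrite /= lee_fin normrM ler_piMl// ger0_norm ?itv_bump_ge0//.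
  exact: itv_bump_le1.
rewrite (_ : (fun r => _) = fun r => itv_bump n s t r * kappa r - itv_bump n s t r * gamma r); last first.
  by apply/funext => r; rewrite mulrBr.
rewrite RintegralB//; last 2 first.
  by apply: bI; exact: kappa_integrable.
  by apply: bI; exact: gamma_integrable.
apply/eqP; rewrite subr_eq0; apply/eqP.
transitivity (semigroup_distribution T mu S p
    (fun z : R * 'rV_d => itv_bump n s t z.1 * box_bump m a b z.2)).
  apply: eq_Rintegral => r; rewrite inE/= in_itv/= => /andP[r0 _].
  rewrite /kappa -(inner_bounded_operatorZ (C0_semigroup_bounded hS (ltW r0)))//.
rewrite E /regular_distribution.
transitivity (\int[(leb \x lebesgue_rV R d)%E]_(z in `]0, T[ `*` O) F n s t z).
  apply: eq_Rintegral => -[r x] _; rewrite /F /gK indicE.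
  have [Kz|nKz] := pselect (K (r, x)); first by rewrite mem_set// mulr1.
  rewrite memNset// mulr0 mul0r (_ : itv_bump _ _ _ _ * _ = 0) ?mulr0//=.
  apply/eqP; rewrite mulf_eq0; apply/negPn/negP; rewrite negb_or => /andP[r0 x0].
  apply: nKz; split => /=; last by apply: phi_K; exact: x0.
  rewrite in_itv/=; have /andP[sr rt] : s < r < t.
    by apply/negPn/negP => H; move/eqP: r0; apply; exact: itv_bump_eq0.
  by rewrite (le_trans ss (ltW sr)) (le_trans (ltW rt) tt).
have [_ -> _] := Rfubini mI (open_measurable_rV oO) (F_integrable n s t).
apply: eq_Rintegral => r _; rewrite /gamma /F /=.
rewrite integral_lebesgue_on.
  rewrite -RintegralZl//; first by apply: eq_Rintegral => x _; ring.
  have [B B0 HB] := gK_bounded.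
  apply: (integrable_O (C := B)).
    apply: measurable_funM; last exact: measurable_box_bump.
    exact: (measurableT_comp mgK (measurable_pair1 _)).
  move=> x; rewrite normrM; apply: le_trans (HB (r, x)).
  by rewrite ler_piMr// ger0_norm ?box_bump_ge0// box_bump_le1.
apply: measurable_funM; first exact: (measurableT_comp mgK (measurable_pair1 _)).
by apply: measurable_funM => //; exact: measurable_box_bump.
Qed.

(** With the space bump fixed, time bumps tend to indicators of intervals, so [kappa - gamma] has
    zero integral over each interval in []s0, t0[]; open intervals being a pi-system, it vanishes
    almost everywhere. The null set depends on [m], [a] and [b]. *)
Lemma bump_moment_eq : {ae leb, forall t, s0 < t < t0 -> kappa t = gamma t}.
Proof.
have s0' := s00; have t0' := t0T.
have mI : measurable (`]0, T[%classic : set (measurableTypeR R)) by exact: measurable_itv.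
have ikg : leb.-integrable `]0, T[ (EFin \o (fun r => kappa r - gamma r)).
  apply: (@eq_integrable _ _ _ leb _ mI _ (EFin \o (fun r : R => kappa r - gamma r)) _ (integrableB mI kappa_integrable gamma_integrable)).
  by move=> r _; rewrite /= EFinB.
have I0 s t : s0 <= s -> t <= t0 -> \int[leb]_(r in `]s, t[) (kappa r - gamma r) = 0.
  move=> ss tt; have mkg : measurable_fun `]0, T[ (fun r => kappa r - gamma r).
    by apply/measurable_EFinP; exact: (measurable_int _ ikg).
  have [||||_ c] := @Rdominated_cvg _ _ _ leb `]0, T[%classic
    (fun n r => itv_bump n s t r * (kappa r - gamma r))
    (fun r => (s < r < t)%R%:R * (kappa r - gamma r)) (fun r => `|kappa r - gamma r|)
    mI _ _ _ (integrable_norm ikg).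
  - move=> n; apply: measurable_funM => //; apply: measurable_funTS; exact: measurable_itv_bump.
  - apply: measurable_funM => //; apply: measurable_funTS.
    rewrite (_ : (fun r => _) = \1_(`]s, t[%classic)); first exact: measurable_indic.
    by apply/funext => r; rewrite indicE mem_setE in_itv.
  - apply: nearW => r _; apply: cvgM; last exact: cvg_cst.
    exact: itv_bump_cvg.
  - apply: nearW => r n _; rewrite normrM ler_piMl// ger0_norm ?itv_bump_ge0//.
    exact: itv_bump_le1.
  rewrite (_ : `]s, t[%classic = `]0, T[ `&` `]s, t[); last first.
    apply/esym/setIidr => r /=; rewrite !in_itv/= => /andP[? ?]; apply/andP; split; lra.
  rewrite Rintegral_mkcondr.
  transitivity (\int[leb]_(r in `]0, T[) ((s < r < t)%R%:R * (kappa r - gamma r))).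
    apply: eq_Rintegral => r _; rewrite patchE mem_setE in_itv/=.
    by case: ifPn; rewrite ?mul1r ?mul0r.
  apply: (cvg_unique _ c); first exact: norm_hausdorff.
  by apply: cvg_near_cst; apply: nearW => n; exact: (bump_pairing n ss tt).
have st0' := st0.
have H := @ae_eq0_setI_closed _ _ R leb [set A | exists a b, A = `]a, b[%classic] `]s0, t0[%classic
  (fun r => kappa r - gamma r) (measurable_itv _) _ (RGenOpens.measurableE R) _ _ _.
have : {ae leb, forall r, `]s0, t0[%classic r -> kappa r - gamma r = 0}.
  apply: H.
  - move=> _ _ [a1 [b1 ->]] [a2 [b2 ->]]; exists (Num.max a1 a2), (Num.min b1 b2).
    by apply/seteqP; split => r /=; rewrite !in_itv/= gt_max lt_min;
      [move=> [/andP[-> ->] /andP[-> ->]]|move=> /andP[/andP[-> ->] /andP[-> ->]]].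
  - apply: integrableS ikg => // r /=; rewrite !in_itv/= => /andP[? ?]; apply/andP; split; lra.
  - exact: I0.
  - move=> _ [a1 [b1 ->]]; rewrite (_ : _ `&` _ = `]Num.max s0 a1, Num.min t0 b1[%classic).
      by apply: I0; rewrite ?le_max ?ge_min lexx.
    by apply/seteqP; split => r /=; rewrite !in_itv/= gt_max lt_min;
      [move=> [/andP[-> ->] /andP[-> ->]]|move=> /andP[/andP[-> ->] /andP[-> ->]]].
move=> [N [mN N0 sN]]; exists N; split => // r /= nr; apply: sN => /= H1; apply: nr => r01.
by apply/eqP; rewrite -subr_eq0 H1// in_itv.
Qed.

End moments.

Let w t := adjoint mu (S t) p.

Let diff_integrable (t : R) : 0 <= t ->
  mu.-integrable setT (EFin \o (fun x => w t x - gK (t, x))).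
Proof.
move=> tge0; have [w2 wP] := adjointP (C0_semigroup_bounded hS tge0) p2.
have [B B0 HB] := gK_bounded.
apply: (@eq_integrable _ _ _ mu _ measurableT
    ((EFin \o w t) \- (EFin \o (fun x => gK (t, x))))%E).
  by move=> x _; rewrite /= EFinB.
apply: integrableB => //.
  have [c2 _] := @L2_bounded _ _ _ mu (cst (1 : R)) 1 ler01 (measurable_cst _) (fun=> ltac:(by rewrite normr1)).
  apply: (@eq_integrable _ _ _ mu _ measurableT _ _ _ (L2_integrable_mul w2 c2)) => x _.
  by rewrite /= mulr1.
apply: (integrable_O (C := B)) => [|x]; last exact: HB.
exact: (measurableT_comp mgK (measurable_pair1 _)).
Qed.

Let gamma_cvg (a b : 'rV[R]_d) (t : R) : (forall i, a0 ord0 i <= a ord0 i) ->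
  (forall i, b ord0 i <= b0 ord0 i) ->
  s0 < t < t0 -> (forall m, inner (S t (box_bump m a b)) p =
     \int[mu]_x (gK (t, x) * box_bump m a b x)) ->
  \int[mu]_(x in open_box a b) (w t x - gK (t, x)) = 0.
Proof.
move=> aa0 bb0 /andP[s0t tt0] H.
have tge0 : 0 <= t by apply/ltW/(lt_trans s00).
have [w2 wP] := adjointP (C0_semigroup_bounded hS tge0) p2.
have [B B0 HB] := gK_bounded.
have mgt : measurable_fun setT (fun x => gK (t, x)).
  exact: (measurableT_comp mgK (measurable_pair1 _)).
have iwg := diff_integrable tge0.
have mwg : measurable_fun setT (fun x => w t x - gK (t, x)).
  by apply/measurable_EFinP; exact: (measurable_int _ iwg).
have [||||_ c] := @Rdominated_cvg _ _ _ mu setT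
    (fun m x => box_bump m a b x * (w t x - gK (t, x)))
    (fun x => \1_(open_box a b) x * (w t x - gK (t, x))) (fun x => `|w t x - gK (t, x)|)
    measurableT _ _ _ (integrable_norm iwg).
- by move=> m; apply: measurable_funM => //; exact: measurable_box_bump.
- by apply: measurable_funM => //; apply: measurable_indic; exact: measurable_open_box.
- apply: nearW => x _; apply: cvgM; last exact: cvg_cst.
  exact: box_bump_cvg.
- apply: nearW => x m _; rewrite normrM ler_piMl// ger0_norm ?box_bump_ge0//.
  exact: box_bump_le1.
rewrite Rintegral_mkcond.
transitivity (\int[mu]_x (\1_(open_box a b) x * (w t x - gK (t, x)))).
  apply: eq_Rintegral => x _; rewrite patchE indicE.
  by case: ifPn => _; rewrite ?mul1r ?mul0r.
apply: (cvg_unique _ c); first exact: norm_hausdorff.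
apply: cvg_near_cst; apply: nearW => m.
have bL := box_bump_L2 m a b.
have := H m; rewrite wP// /Defs.inner => E.
rewrite (_ : (fun x => _) = fun x => box_bump m a b x * w t x - gK (t, x) * box_bump m a b x).
  rewrite RintegralB//; first by rewrite E subrr.
    exact: L2_integrable_mul.
  apply: (integrable_O (C := B)).
    by apply: measurable_funM => //; exact: measurable_box_bump.
  move=> x; rewrite normrM; apply: le_trans (HB (t, x)).
  by rewrite ler_piMr// ger0_norm ?box_bump_ge0// box_bump_le1.
by apply/funext => x; ring.
Qed.

(** The exceptional times of [bump_moment_eq] depend on the bump, so only countably many bumps are
    used, built on boxes with rational corners. At a good time they tend to the indicators of these
    boxes, a pi-system generating the Borel sets. *)
Lemma semigroup_analytic_box : {ae leb, forall t, s0 < t < t0 ->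
  {ae mu, forall x, open_box a0 b0 x -> adjoint mu (S t) p x = g (t, x)}}.
Proof.
(* Corners are clipped to the fixed box, because the moment identity is known only for bumps
   supported in it; the clipped box is the intersection with the rational one. *)
pose al (i : 'rV[rat]_d * 'rV[rat]_d) : 'rV[R]_d :=
  \row_k Num.max (a0 ord0 k) (ratr (i.1 ord0 k)).
pose be (i : 'rV[rat]_d * 'rV[rat]_d) : 'rV[R]_d :=
  \row_k Num.min (b0 ord0 k) (ratr (i.2 ord0 k)).
have aal i k : a0 ord0 k <= al i ord0 k by rewrite mxE le_max lexx.
have bbe i k : be i ord0 k <= b0 ord0 k by rewrite mxE ge_min lexx.
have H1 : {ae leb, forall t, forall j : nat, s0 < t < t0 ->
    inner (S t (box_bump j a0 b0)) p = \int[mu]_x (gK (t, x) * box_bump j a0 b0 x)}.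
  by apply: ae_foralln => j; exact: bump_moment_eq.
have H2 : {ae leb, forall t, forall ij : (nat * ('rV[rat]_d * 'rV[rat]_d)), s0 < t < t0 ->
    inner (S t (box_bump ij.1 (al ij.2) (be ij.2))) p =
    \int[mu]_x (gK (t, x) * box_bump ij.1 (al ij.2) (be ij.2) x)}.
  by apply: ae_forall_count => -[j i]; apply: bump_moment_eq => k; [exact: aal|exact: bbe].
apply: (ae_filter2 H1 H2) => t {}H1 {}H2 st.
have tge0 : 0 <= t by case/andP: st => /ltW s0t _; exact: le_trans (ltW s00) s0t.
have [w2 wP] := adjointP (C0_semigroup_bounded hS tge0) p2.
have iwg := diff_integrable tge0.
pose G := [set A | exists i : 'rV[rat]_d * 'rV[rat]_d,
  A = open_box (map_mx ratr i.1 : 'rV[R]_d) (map_mx ratr i.2)].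
have : {ae mu, forall x, open_box a0 b0 x -> w t x - gK (t, x) = 0}.
  apply: (@ae_eq0_setI_closed _ _ _ mu G (open_box a0 b0)).
  - exact: measurable_open_box.
  - move=> _ _ [i1 ->] [i2 ->].
    exists (\row_k Num.max (i1.1 ord0 k) (i2.1 ord0 k), \row_k Num.min (i1.2 ord0 k) (i2.2 ord0 k)).
    apply/seteqP; split => [x [/= A1 A2] k|x A].
      have := A1 k; have := A2 k; rewrite !mxE /= => /andP[? ?] /andP[? ?].
      apply/andP; split; [case: (leP (i1.1 ord0 k) (i2.1 ord0 k))|case: (leP (i1.2 ord0 k) (i2.2 ord0 k))] => //.
    split => k; have := A k; rewrite !mxE /= => /andP[A1 A2]; apply/andP; split.
    + by apply: le_lt_trans A1; rewrite ler_rat le_max lexx.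
    + by apply: (lt_le_trans A2); rewrite ler_rat ge_min lexx.
    + by apply: le_lt_trans A1; rewrite ler_rat le_max lexx orbT.
    + by apply: (lt_le_trans A2); rewrite ler_rat ge_min lexx orbT.
  - apply/seteqP; split.
      apply: smallest_sub; first exact: smallest_sigma_algebra.
      (* Balls of the sup norm are boxes, so rational boxes generate the open sets. *)
      move=> U oU; rewrite (open_bigcup_ball_rV oU).
      apply: (@countable_bigcupT_measurable _ (g_sigma_algebraType G)); first exact: countableP.
      move=> [c q]; case: asboolP => [[q0 _]|_]; last exact: measurable0.
      apply: sub_sigma_algebra; exists (c - const_mx q, c + const_mx q) => /=.
      apply/seteqP; split => [x [_ cx] k|x cx].
        have : `|map_mx ratr c ord0 k - x ord0 k| < ratr q := cx ord0 k.
        rewrite !mxE rmorphB rmorphD/= ltr_distlC => /andP[? ?]; apply/andP; split; lra.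
      split; first by rewrite ltr0q.
      move=> i k; rewrite (ord1 i); have := cx k; rewrite !mxE rmorphB rmorphD/= => /andP[? ?].
      suff : `|ratr (c ord0 k) - x ord0 k| < ratr q by [].
      by rewrite ltr_distlC; apply/andP; split; lra.
    apply: smallest_sub; first exact: sigma_algebra_measurable.
    by move=> _ [i ->]; exact: measurable_open_box.
  - exact: (integrableS measurableT (measurable_open_box _ _) (@subsetT _ _) iwg).
  - by apply: gamma_cvg => // j; exact: H1.
  - move=> _ [i ->]; rewrite (_ : _ `&` _ = open_box (al i) (be i)).
      by apply: gamma_cvg => // j; exact: (H2 (j, i)).
    apply/seteqP; split => [x [A1 A2] k|x A].
      by have := A1 k; have := A2 k; rewrite !mxE gt_max lt_min => /andP[-> ->] /andP[-> ->].
    by split => k; have := A k; rewrite !mxE gt_max lt_min => /andP[/andP[? ?] /andP[? ?]];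
      apply/andP.
apply: filterS => x H xab; rewrite -[LHS]/(w t x).
have /eqP := H xab; rewrite subr_eq0 => /eqP ->.
rewrite /gK indicE mem_set ?mulr1//; split; last exact: open_box_closed.
by rewrite /= in_itv/=; case/andP: st => /ltW -> /ltW ->.
Qed.

End one_box.
Lemma semigroup_analytic_ae : {ae leb, forall t, 0 < t < T ->
  adjoint mu (S t) p = (fun x => g (t, x)) %[ae mu]}.
Proof.
(* A countable cover of the cylinder by rational boxes, so that exceptional times and points remain
   negligible in the union. *)
pose good (i : (rat * rat) * ('rV[rat]_d * 'rV[rat]_d)) :=
  [/\ 0 < ratr i.1.1 :> R, ratr i.1.1 < ratr i.1.2 :> R, ratr i.1.2 < T &
   closed_box (map_mx ratr i.2.1 : 'rV[R]_d) (map_mx ratr i.2.2) `<=` O].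
have H : {ae leb, forall t, forall i, good i -> ratr i.1.1 < t < ratr i.1.2 ->
    {ae mu, forall x, open_box (map_mx ratr i.2.1 : 'rV[R]_d) (map_mx ratr i.2.2) x ->
      adjoint mu (S t) p x = g (t, x)}}.
  apply: ae_forall_count => i; have [gi|ngi] := pselect (good i); last first.
    by apply: aeW => t /ngi.
  have [i1 i2 i3 i4] := gi.
  have := semigroup_analytic_box i1 i2 i3 i4.
  by move=> [N [mN N0 sN]]; exists N; split => // t /= nt; apply: sN => /= Q; apply: nt => _.
move: H => [N [mN N0 sN]]; exists N; split => // t /= nt; apply: sN => /= Q; apply: nt => /andP[t0 tT].
have [q1] := rat_in_itvoo t0; rewrite in_itv/= => /andP[q10 q1t].
have [q2] := rat_in_itvoo tT; rewrite in_itv/= => /andP[tq2 q2T].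
have H : {ae mu, forall x, forall i : 'rV[rat]_d * 'rV[rat]_d,
    closed_box (map_mx ratr i.1 : 'rV[R]_d) (map_mx ratr i.2) `<=` O ->
    open_box (map_mx ratr i.1 : 'rV[R]_d) (map_mx ratr i.2) x ->
      adjoint mu (S t) p x = g (t, x)}.
  apply: ae_forall_count => i.
  have [ci|nci] := pselect (closed_box (map_mx ratr i.1 : 'rV[R]_d) (map_mx ratr i.2) `<=` O); last first.
    by apply: aeW => x /nci.
  have gi : good ((q1, q2), i) by split => //=; exact: lt_trans q1t tq2.
  have := Q _ gi; rewrite q1t tq2 => /(_ isT).
  by apply: filterS => x /= + _ => /[apply].
have HO : {ae mu, forall x, O x}.
  by apply/(@ae_mrestr _ _ _ (lebesgue_rV R d) O (open_measurable_rV oO)); exact: aeW.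
apply: (ae_filter2 H HO) => x {}H Ox _.
have /nbhs_ballP[e /= e0 xeO] : nbhs x O by exact: open_nbhs_nbhs.
have rl k : exists r : rat, x ord0 k - e / 2 < ratr r < x ord0 k.
  have /rat_in_itvoo[r] : x ord0 k - e / 2 < x ord0 k by rewrite ltrBlDr ltrDl divr_gt0.
  by rewrite in_itv; exists r.
have rr k : exists r : rat, x ord0 k < ratr r < x ord0 k + e / 2.
  have /rat_in_itvoo[r] : x ord0 k < x ord0 k + e / 2 by rewrite ltrDl divr_gt0.
  by rewrite in_itv; exists r.
pose i : 'rV[rat]_d * 'rV[rat]_d :=
  (\row_k projT1 (cid (rl k)), \row_k projT1 (cid (rr k))).
apply: (H i) => [y yi|k]; last first.
  rewrite !mxE; have /andP[_ ->] := projT2 (cid (rl k)).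
  by have /andP[-> _] := projT2 (cid (rr k)).
apply: xeO; split => // j k; rewrite (ord1 j).
suff : `|x ord0 k - y ord0 k| < e by [].
have := yi k; rewrite !mxE.
have /andP[+ +] := projT2 (cid (rl k)).
have /andP[+ +] := projT2 (cid (rr k)).
by rewrite ltr_distlC => ? ? ? ? /andP[? ?]; apply/andP; split; lra.
Qed.

End identification.

(** The representative given by hypoellipticity is controlled on the cylinder only. Extension by 0
    makes it measurable everywhere, and it stays analytic because the radii can be shrunk so as to
    remain in the open cylinder. *)
Lemma semigroup_analytic (R : realType) (d : nat) (T : R) (O : set 'rV[R]_d)
    (oO : open O) (finO : (lebesgue_rV R d O < +oo)%E) D A S (p : 'rV[R]_d -> R) :
  let mu := lebesgue_on oO finO in 0 < T ->
  generates mu D A S -> analytic_hypoelliptic T O mu D A -> L2 mu p ->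
  exists g : R * 'rV[R]_d -> R, [/\ measurable_fun setT g, space_analytic T O g &
    {ae @lebesgue_measure R, forall t, 0 < t < T ->
      adjoint mu (S t) p = (fun x => g (t, x)) %[ae mu]}].
Proof.
move=> mu T0 gen hyp p2; have [hS _ _] := gen.
have a0 : space_analytic T O (fun=> 0).
  split; first exact: measurable_cst.
  move=> t0 x0 _; exists 1, 0; split => //; exists (fun _ _ => 0) => t _; split => [a|x _].
    by rewrite normr0 mul0r.
  rewrite (_ : series _ = fun=> 0); first exact: cvg_cst.
  apply/funext => n; rewrite /series/= big1// => k _.
  by rewrite /homogeneous_part big1// => a _; rewrite mul0r.
have [g [mg ag] gp] := hyp _ _ (distribution_semigroup O hS T0 p2) a0
  (semigroup_distributional_solution (O := O) hS T0 gen p2).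
have mC : measurable (cylinder T O).
  by apply: measurableX; [exact: measurable_itv|exact: open_measurable_rV].
pose h := g \_ (cylinder T O).
have hE z : cylinder T O z -> h z = g z by move=> Oz; rewrite /h patchE mem_set.
have h0 z : ~ cylinder T O z -> h z = 0 by move=> Oz; rewrite /h patchE memNset.
have mh : measurable_fun setT h by apply/(measurable_restrictT _ _).1.
have ah : space_analytic T O h.
  split; first exact: measurable_funTS.
  move=> t0 x0 [/= t0T Ox0]; have [r [M [r0 [c cP]]]] := ag _ _ (conj t0T Ox0).
  have /nbhs_ballP[e /= e0 xeO] : nbhs x0 O by exact: open_nbhs_nbhs.
  have /nbhs_ballP[e1 /= e10 xeT] : nbhs t0 `]0, T[%classic.
    by apply: open_nbhs_nbhs; split => //; exact: interval_open.
  exists (Num.min r (Num.min e e1)), M; split; first by rewrite !lt_min r0 e0 e10.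
  exists c => t; rewrite !lt_min => /and3P[tr te te1].
  have [cM cx] := cP t tr; split => [a|x].
    apply: le_trans (cM a); rewrite ler_wpM2l// lerXn2r ?nnegrE ?(ltW r0)//.
      by rewrite !le_min !ltW.
    by rewrite ge_min lexx.
  rewrite !lt_min => /and3P[xr xe _]; rewrite hE; first exact: cx.
  split => /=; first by apply: xeT; rewrite /ball/= distrC.
  by apply: xeO; rewrite -ball_normE /= distrC.
exists h; split => //.
apply: (semigroup_analytic_ae T0 hS p2 ah _ mh) => phi tphi.
rewrite (gp _ tphi); apply: eq_Rintegral => z; rewrite inE => Oz.
by rewrite hE.
Qed.

(** * The identity theorem *)

Section power_series_zeros.
Context (R : realType).
Implicit Types (b : nat -> R) (f : R -> R) (s r k : R).

Lemma geometric_tail_le (q : R) N m : 0 <= q <= 2^-1 ->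
  \sum_(N <= n < m) q ^+ n <= 2 * q ^+ N.
Proof.
move=> /andP[q0 q1]; have [mN|Nm] := leqP m N; first by rewrite big_geq// mulr_ge0 ?exprn_ge0.
suff : \sum_(N <= n < m) q ^+ n <= 2 * q ^+ N - 2 * q ^+ m.
  by move=> /le_trans; apply; rewrite gerBl mulr_ge0 ?exprn_ge0.
elim: m Nm => // m IH; rewrite ltnS leq_eqVlt => /orP[/eqP <-|Nm].
  rewrite big_nat1 exprS; have := exprn_ge0 N q0; nra.
rewrite (big_nat_recr m)/=; last exact: ltnW.
apply: (le_trans (lerD (IH Nm) (lexx _))); rewrite exprS; have := exprn_ge0 m q0; nra.
Qed.

(** Near 0 the first nonzero term dominates the tail of the series. *)
Lemma power_series_isolated_zero b f r : 0 < r ->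
  (forall s, `|s| < r -> series (fun n => b n * s ^+ n) @ \oo --> f s) ->
  (exists n, b n != 0) ->
  exists2 e, 0 < e & forall s, 0 < `|s| < e -> f s != 0.
Proof.
move=> r0 fE exb; pose N := ex_minn exb.
have [bN bmin] : b N != 0 /\ forall n, (n < N)%N -> b n = 0.
  rewrite /N; case: ex_minnP => m bm mmin; split => // n nm.
  by apply/eqP/negPn/negP => /mmin; rewrite leqNgt nm.
pose s0 := r / 2; have s00 : 0 < s0 by rewrite divr_gt0.
have s0r : `|s0| < r by rewrite gtr0_norm// /s0; lra.
have [M M0 HM] : exists2 M, 0 < M & forall n, `|b n| * s0 ^+ n <= M.
  have /cvg_series_cvg_0 : cvgn (series (fun n => b n * s0 ^+ n)).
    by apply/cvg_ex; exists (f s0); exact: fE.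
  move=> /cvgP /cvg_seq_bounded [M [Mr HM]].
  exists (`|M| + 1); first by rewrite ltr_wpDl.
  move=> n; have := HM (`|M| + 1) (le_lt_trans (ler_norm _) (ltr_pwDr ltr01 (lexx _))) n I.
  by rewrite /= normrM normrX (gtr0_norm s00).
have bN0 : 0 < `|b N| * s0 ^+ N by rewrite mulr_gt0 ?normr_gt0 ?exprn_gt0.
(* The bound [1/2] makes the tail at most [2 M q^(N+1)]; the other one makes this smaller than the
   leading term [|b N| s0^N q^N]. *)
pose q0 := Num.min 2^-1 (`|b N| * s0 ^+ N / (4 * M)).
have q00 : 0 < q0 by rewrite lt_min invr_gt0 ltr0n/= divr_gt0// mulr_gt0.
exists (q0 * s0); first by rewrite mulr_gt0.
move=> s /andP[sgt0 sq]; pose q := `|s| / s0.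
have q_gt0 : 0 < q by rewrite divr_gt0.
have : q < q0 by rewrite ltr_pdivrMr.
rewrite lt_min => /andP[q12]; rewrite ltr_pdivlMr ?mulr_gt0// => qM.
have sE : `|s| = q * s0 by rewrite /q mulfVK// gt_eqF.
have sr : `|s| < r by rewrite sE (lt_trans _ s0r)// gtr0_norm// gtr_pMl//; lra.
have tail : `|f s - b N * s ^+ N| <= 2 * M * q ^+ N.+1.
  have c : (fun m => series (fun n => b n * s ^+ n) m - b N * s ^+ N) @ \oo -->
      f s - b N * s ^+ N by apply: cvgB; [exact: fE|exact: cvg_cst].
  apply: (cvgr_to_le (cvg_norm c)); near=> m.
  have Nm : (N < m)%N by near: m; exact: nbhs_infty_gt.
  rewrite /series/= (big_cat_nat (n := N.+1))//= big_nat_recr//= big_nat_cond big1 ?add0r; last first.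
    by move=> i /andP[/andP[_ /bmin ->]] _; rewrite mul0r.
  rewrite addrAC subrr add0r (le_trans (ler_norm_sum _ _ _))//.
  apply: (@le_trans _ _ (\sum_(N.+1 <= n < m) M * q ^+ n)).
    apply: ler_sum => n _; rewrite normrM normrX sE exprMn mulrCA mulrC ler_wpM2r//.
    by rewrite exprn_ge0// ltW.
  rewrite -mulr_sumr -mulrA mulrCA ler_wpM2l ?(ltW M0)//.
  by apply: geometric_tail_le; rewrite !ltW.
apply/eqP => fs0; move: tail; rewrite fs0 sub0r normrN normrM normrX sE exprMn exprS.
rewrite leNgt => /negP; apply.
have qN : 0 < q ^+ N by rewrite exprn_gt0.
rewrite (_ : `|b N| * (q ^+ N * s0 ^+ N) = q ^+ N * (`|b N| * s0 ^+ N)); last by ring.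
rewrite (_ : 2 * M * (q * q ^+ N) = q ^+ N * (2 * M * q)); last by ring.
rewrite ltr_pM2l//; nra.
Unshelve. all: by end_near.
Qed.

Definition local_power_series (U : set R) f := forall s, U s ->
  exists (r : R) b, 0 < r /\
    forall h, `|h| < r -> series (fun n => b n * h ^+ n) @ \oo --> f (s + h).

Lemma local_power_series_dichotomy U f k s : local_power_series U f -> U s ->
  (\forall h \near s, f h = k) \/ (\forall h \near s, h != s -> f h != k).
Proof.
move=> fU /fU[r [b [r0 bP]]].
(* Shifting the constant coefficient reduces the value [k] to 0. *)
pose b' n := if n is 0%N then b 0%N - k else b n.
have b'P h : `|h| < r -> series (fun n => b' n * h ^+ n) @ \oo --> f (s + h) - k.
  move=> /bP fh; have c : (fun m => series (fun n => b n * h ^+ n) m - k) @ \oo --> f (s + h) - k.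
    by apply: cvgB => //; exact: cvg_cst.
  apply: cvg_trans c; apply: near_eq_cvg; near=> m.
  have m0 : (0 < m)%N by near: m; exact: nbhs_infty_gt.
  rewrite /series /= (big_ltn (F := fun n => b n * h ^+ n) m0).
  rewrite (big_ltn (F := fun n => b' n * h ^+ n) m0) /= expr0 !mulr1 addrAC; congr (_ + _).
  by apply: eq_big_nat => -[].
have [ex|nex] := pselect (exists n, b' n != 0).
  right; have [e e0 eP] := power_series_isolated_zero r0 b'P ex.
  apply/nbhs_ballP; exists e => //= h; rewrite /ball/= distrC => hse hs.
  have := eP (h - s); rewrite normr_gt0 subr_eq0 hs hse => /(_ isT).
  by rewrite subr_eq0 subrKC.
left; apply/nbhs_ballP; exists r => //= h; rewrite /ball/= distrC => hr.
have := b'P _ hr; rewrite (_ : series _ = fun=> 0); last first.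
  apply/funext => m; rewrite /series/= big1// => i _.
  have -> : b' i = 0 by apply/eqP/negPn/negP => bi; apply: nex; exists i.
  by rewrite mul0r.
rewrite subrKC => c; apply/eqP; rewrite -subr_eq0; apply/eqP.
by apply: (cvg_unique _ c); [exact: norm_hausdorff|exact: cvg_cst].
Unshelve. all: by end_near.
Qed.

(** If the interior of the level set missed the interval, the dichotomy would make its points
    isolated, hence countable and of measure 0. So the interior meets the interval, where the
    dichotomy makes it relatively closed as well, and connectedness concludes. *)
Lemma local_power_series_identity (a b : R) f k (E : set (measurableTypeR R)) :
  local_power_series `]a, b[ f -> measurable E -> E `<=` `]a, b[ ->
  (forall s, E s -> f s = k) -> lebesgue_measure E != 0%E ->
  forall s, a < s < b -> f s = k.
Proof.
move=> fab mE Eab Ek E0.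
pose W : set R := [set h | f h = k]^°.
have dich (s : R) : a < s < b -> W s \/ (\forall h \near s, h != s -> f h != k).
  by move=> sab; apply: (local_power_series_dichotomy _ fab); rewrite /= in_itv.
have oW : open W by exact: open_interior.
have [W0|W0] := pselect ((`]a, b[%classic `&` W) = set0).
  exfalso; move/eqP: E0; apply.
  (* An isolated point of [E] is the only one in some interval with rational ends, so the isolated
     points lie in a countable union of null sets. *)
  pose I (q : rat * rat) := `]ratr q.1, ratr q.2[%classic : set R.
  suff : {ae @lebesgue_measure R, forall s, forall q,
      (exists s0, E `&` I q `<=` [set s0]) -> ~ (E `&` I q) s}.
    move=> [N [mN N0 sN]]; apply: (@subset_measure0 _ _ _ (@lebesgue_measure R) E N mE mN _ N0) => s Es.
    apply: sN => /= H; have sab := Eab _ Es; rewrite /= in_itv/= in sab.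
    have [Ws|/nbhs_ballP[e /= e0 He]] := dich s sab.
      have : (`]a, b[%classic `&` W) s by split => //=; rewrite in_itv.
      by rewrite W0.
    have [q1] : exists q1 : rat, ratr q1 \in `]s - e, s[ by apply: rat_in_itvoo; lra.
    rewrite in_itv/= => /andP[q11 q12].
    have [q2] : exists q2 : rat, ratr q2 \in `]s, s + e[ by apply: rat_in_itvoo; lra.
    rewrite in_itv/= => /andP[q21 q22].
    apply: (H (q1, q2)); last by split; rewrite /I //= in_itv/= q12.
    exists s => h [Eh]; rewrite /I/= in_itv/= => /andP[qh hq].
    apply/eqP/negPn/negP => hs.
    have /He/(_ hs)/eqP : ball s e h.
      by rewrite /ball/= ltr_distlC; apply/andP; split; lra.
    by apply; exact: Ek.
  apply: ae_forall_count => q.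
  have [[s0 Es0]|nex] := pselect (exists s0, E `&` I q `<=` [set s0]); last first.
    by apply: aeW => s /nex.
  exists [set s0]; split; [exact: measurable_set1|exact: lebesgue_measure_set1|].
  by move=> s /= ns; apply: Es0; apply: contrapT => nE; exact: ns.
have cab : connected (`]a, b[%classic : set R).
  by apply/connected_intervalP; exact: interval_is_interval.
have WE : `]a, b[%classic `&` W = `]a, b[%classic.
  apply: cab.
  - by apply/set0P/eqP.
  - by exists W.
  - exists (closure W); first exact: closed_closure.
    apply/seteqP; split => s [sab Ws]; split => //; first exact: subset_closure.
    have := dich s; rewrite /= in_itv/= in sab; move=> /(_ sab)[//|H].
    have [w [Ww Hw]] := Ws _ H.
    have [<-//|ws] := eqVneq w s.
    by have := Hw ws; rewrite (nbhs_singleton Ww) eqxx.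
move=> s sab; have : (`]a, b[%classic `&` W) s by rewrite WE /= in_itv.
by case=> _ /nbhs_singleton.
Qed.

End power_series_zeros.

(** * The identity theorem in several variables *)

Section space_identity.
Context (R : realType).

(** Expansions along lines are all that the one-variable theorem uses, and they restrict to
    coordinate slices at no cost. *)
Definition line_analytic (d : nat) (U : set 'rV[R]_d) (f : 'rV[R]_d -> R) :=
  forall x v, U x -> exists (r : R) b, 0 < r /\
    forall h, `|h| < r -> series (fun n => b n * h ^+ n) @ \oo --> f (x + h *: v).

Lemma space_analytic_line (d : nat) (T t : R) (O : set 'rV[R]_d) g :
  space_analytic T O g -> 0 < t < T -> line_analytic O (fun x => g (t, x)).
Proof.
move=> [_ ag] tT x v Ox.
have [|r [M [r0 [c cP]]]] := ag t x; first by split => //=; rewrite in_itv.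
have [_ cx] := cP t ltac:(by rewrite subrr normr0).
exists (r / (`|v| + 1)), (fun n => homogeneous_part (c t) n v); split.
  by rewrite divr_gt0// ltr_wpDl.
move=> h; rewrite ltr_pdivlMr ?ltr_wpDl// => hr.
have /cx : `|x + h *: v - x| < r.
  by rewrite addrAC subrr add0r normrZ (le_lt_trans _ hr)// ler_wpM2l// lerDl.
rewrite addrAC subrr add0r.
rewrite (_ : (fun n => homogeneous_part (c t) n (h *: v)) = fun n => homogeneous_part (c t) n v * h ^+ n)//.
apply/funext => n.
rewrite /homogeneous_part mulr_suml; apply: eq_bigr => a /eqP an.
rewrite -mulrA; congr (_ * _); rewrite (_ : h ^+ n = \prod_i h ^+ a i).
  by rewrite -big_split/=; apply: eq_bigr => i _; rewrite mxE exprMn mulrC.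
by rewrite -expr_sum an.
Qed.

Lemma rV_cons_line (d : nat) (s h t : R) (x v : 'rV[R]_d) :
  rV_cons (s + h * t, x + h *: v) = rV_cons (s, x) + h *: rV_cons (t, v).
Proof. by apply/rowP => i; rewrite !mxE/=; case: unliftP => [j _|_]; rewrite ?mxE. Qed.

(** Induction on the dimension. The slices of the level set have positive measure for a set [E] of
    first coordinates of positive measure. On those slices the induction hypothesis applies, and for
    fixed [x] the one-variable theorem propagates the value from [E] to the whole interval. *)
Lemma line_analytic_box (d : nat) (a b : 'rV[R]_d) f k :
  measurable_fun setT f -> line_analytic (open_box a b) f ->
  lebesgue_rV R d (open_box a b `&` [set x | f x = k]) != 0%E ->
  forall x, open_box a b x -> f x = k.
Proof.
elim: d a b f => [a b f mf la /eqP A0 x xab|d IH a b f mf la A0].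
  rewrite (_ : x = 0); last by apply/rowP => -[].
  apply: contrapT => f0; apply: A0; rewrite /= diracE memNset//=.
  by case.
set A := _ `&` _ in A0.
pose a' := (rV_uncons a).2; pose b' := (rV_uncons b).2.
pose a1 := a ord0 ord0; pose b1 := b ord0 ord0.
have boxE s x : open_box a b (rV_cons (s, x)) <-> a1 < s < b1 /\ open_box a' b' x.
  split=> [H|[sab xab] i].
    split=> [|i]; first by have := H ord0; rewrite mxE unlift_none.
    by have := H (lift ord0 i); rewrite !mxE liftK.
  rewrite mxE; case: unliftP => [j|] -> //=; have := xab j; by rewrite !mxE.
have mA : measurable A.
  apply: measurableI; first exact: measurable_open_box.
  by rewrite -[X in measurable X]setTI; exact: (mf measurableT _ (measurable_set1 k)).
have mcA : measurable (@rV_cons R d @^-1` A).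
  by rewrite -[X in measurable X]setTI; exact: measurable_rV_cons.
pose m' s := lebesgue_rV R d (xsection (@rV_cons R d @^-1` A) s).
have mm' : measurable_fun setT m' by exact: measurable_fun_xsection.
pose E : set (measurableTypeR R) := m' @^-1` [set~ 0%E].
have mE : measurable E by rewrite -[X in measurable X]setTI; exact: (mm' measurableT _ (measurableC (emeasurable_set1 0))).
have secE s : xsection (@rV_cons R d @^-1` A) s =
    if a1 < s < b1 then open_box a' b' `&` [set x | f (rV_cons (s, x)) = k] else set0.
  apply/seteqP; split=> x; rewrite /xsection/= inE/=.
    by case=> /boxE[-> ?].
  by case: ifPn => // sab [xab fk]; split => //; apply/boxE.
have Eab : E `<=` `]a1, b1[.
  move=> s Es; rewrite /= in_itv/=; apply/negPn/negP => sab; apply: Es.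
  by rewrite /m' secE (negbTE sab) measure0.
have mfs s : measurable_fun setT (fun x => f (rV_cons (s, x))).
  by apply: (measurableT_comp mf); apply: (measurableT_comp (@measurable_rV_cons R d));
    exact: measurable_pair1.
have E0 : lebesgue_measure E != 0%E.
  apply: contra A0 => /eqP E0; apply/eqP.
  have -> : lebesgue_rV R d.+1 A = (\int[lebesgue_measure]_s m' s)%E by [].
  transitivity (\int[@lebesgue_measure R]_s (cst 0 s))%E; last by rewrite integral0.
  apply: ae_eq_integral => //.
  exists E; split => // s /= H Es; apply: H => _; exact: contrapT.
have fE s : E s -> forall x, open_box a' b' x -> f (rV_cons (s, x)) = k.
  move=> Es; have := Eab _ Es; rewrite /= in_itv/= => sab.
  apply: (IH a' b' (fun x => f (rV_cons (s, x)))) => //.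
    move=> x v xab; have [|r [c [r0 cP]]] := la (rV_cons (s, x)) (rV_cons (0, v)).
      by apply/boxE.
    by exists r, c; split => // h /cP; rewrite -rV_cons_line mulr0 addr0.
  by apply/eqP; have := Es; rewrite /E/= /m' secE sab.
move=> x; rewrite -(rV_unconsK x); case: (rV_uncons x) => s {}x /boxE[sab xab].
apply: (@local_power_series_identity R a1 b1 (fun s => f (rV_cons (s, x))) k E) => //.
- move=> s1; rewrite /= in_itv/= => s1ab.
  have [|r [c [r0 cP]]] := la (rV_cons (s1, x)) (rV_cons (1, 0)); first by apply/boxE.
  by exists r, c; split => // h /cP; rewrite -rV_cons_line mulr1 scaler0 addr0.
- by move=> s1 /fE; exact.
Qed.

Lemma rV_ball_box d (x : 'rV[R]_d) e : 0 < e ->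
  ball x e = open_box (x - const_mx e) (x + const_mx e).
Proof.
move=> e0; apply/seteqP; split => [y [_ xy] k|y xy].
  have : `|x ord0 k - y ord0 k| < e := xy ord0 k.
  by rewrite !mxE ltr_distlC.
split => // i k; rewrite (ord1 i); have := xy k; rewrite !mxE => H.
suff : `|x ord0 k - y ord0 k| < e by [].
by rewrite ltr_distlC.
Qed.

Lemma lebesgue_rV_ball_gt0 d (x : 'rV[R]_d) e : 0 < e -> lebesgue_rV R d (ball x e) != 0%E.
Proof.
move=> e0; rewrite rV_ball_box//.
have := @lebesgue_rV_box R d (x - const_mx e) (x + const_mx e).
rewrite -/(open_box _ _) => ->.
  by rewrite gt_eqF// lte_fin prodr_gt0// => i _; rewrite !mxE; lra.
by move=> i; rewrite !mxE; lra.
Qed.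

(** Balls are boxes, which localises the previous result. A countable cover by rational balls
    contains one in which the level set is not negligible, so the interior of the level set is
    nonempty. It is relatively closed, since a ball in [O] that meets it contains a smaller ball of
    the level set, of positive measure. *)
Lemma line_analytic_identity (d : nat) (O : set 'rV[R]_d) f k :
  open O -> connected O -> measurable_fun setT f -> line_analytic O f ->
  lebesgue_rV R d (O `&` [set x | f x = k]) != 0%E -> forall x, O x -> f x = k.
Proof.
move=> oO cO mf la A0.
have mk : measurable [set x | f x = k].
  by rewrite -[X in measurable X]setTI; exact: (mf measurableT _ (measurable_set1 k)).
have ballk x e : 0 < e -> ball x e `<=` O ->
    lebesgue_rV R d (ball x e `&` [set x | f x = k]) != 0%E -> forall y, ball x e y -> f y = k.
  move=> e0 xeO; rewrite rV_ball_box// => H; apply: line_analytic_box => // y v yB.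
  by apply: la; apply: xeO; rewrite rV_ball_box.
pose W : set 'rV[R]_d := [set h | f h = k]^°.
have oW : open W by exact: open_interior.
have E : O `&` W = O.
  apply: cO.
  - apply/set0P/eqP => W0; move/eqP: A0; apply.
    pose B (i : 'rV[rat]_d * rat) : set 'rV[R]_d := ball (map_mx ratr i.1 : 'rV[R]_d) (ratr i.2).
    suff : {ae lebesgue_rV R d, forall x, forall i, 0 < (ratr i.2 : R) -> B i `<=` O ->
        ~ (B i `&` [set x | f x = k]) x}.
      move=> [N [mN N0 sN]]; apply: (subset_measure0 _ mN _ N0).
        by apply: measurableI => //; exact: open_measurable_rV.
      move=> x [Ox fx]; apply: sN => /= H; move: (Ox); rewrite (open_bigcup_ball_rV oO).
      by move=> [i _]; case: asboolP => // -[i0 iO] xi; apply: (H i (_ : 0 < ratr i.2 :> R) iO (conj xi fx)); rewrite ltr0q.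
    apply: ae_forall_count => i.
    have [i0|] := pselect (0 < (ratr i.2 : R)); last by move=> ni; apply: aeW.
    have [iO|] := pselect (B i `<=` O); last by move=> ni; apply: aeW.
    have mB : measurable (B i) by apply: open_measurable_rV; exact: ball_open.
    exists (B i `&` [set x | f x = k]); split; first exact: measurableI.
      apply: contrapT => /eqP H; suff : (O `&` W) (map_mx ratr i.1) by rewrite W0.
      have xB : B i (map_mx ratr i.1) by exact: ballxx.
      split; first exact: iO.
      apply/nbhs_ballP; exists (ratr i.2) => // y; exact: (ballk _ _ i0 iO H).
    by move=> x /= ns; apply: contrapT => nE; exact: ns.
  - by exists W.
  - exists (closure W); first exact: closed_closure.
    apply/seteqP; split => x [Ox Wx]; split => //; first exact: subset_closure.
    have /nbhs_ballP[e /= e0 xeO] : nbhs x O by exact: open_nbhs_nbhs.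
    have [w [Ww xw]] := Wx _ (nbhsx_ballx x e e0).
    have : nbhs w (ball x e `&` [set h | f h = k]).
      by apply: filterI => //; apply: open_nbhs_nbhs; split => //; exact: ball_open.
    move=> /nbhs_ballP[e' /= e'0 we'].
    apply/nbhs_ballP; exists e => //; apply: ballk => //.
    apply: contra (lebesgue_rV_ball_gt0 w e'0) => /eqP H; apply/eqP.
    apply: (subset_measure0 _ _ we' H).
      by apply: open_measurable_rV; exact: ball_open.
    by apply: measurableI => //; apply: open_measurable_rV; exact: ball_open.
by move=> x Ox; have : (O `&` W) x by [rewrite E]; case=> _ /nbhs_singleton.
Qed.

End space_identity.

(** * The bathtub principle *)

Section real_integral.
Context (dX : measure_display) (X : measurableType dX) (R : realType).
Variable mu : {measure set X -> \bar R}.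
Implicit Types (f g : X -> R) (D : set X).
Local Notation integrable D f := (mu.-integrable D (EFin \o f)).

Lemma Rintegral_fine D f : measurable D -> integrable D f ->
  (\int[mu]_(x in D) (f x)%:E = (\int[mu]_(x in D) f x)%:E)%E.
Proof. by move=> mD if_; rewrite /Rintegral fineK//; exact: integrable_fin_num. Qed.

Lemma integrable_Rmeasurable D f : integrable D f -> measurable_fun D f.
Proof. by move=> if_; apply/measurable_EFinP; exact: measurable_int if_. Qed.

Lemma integrable_subR D f g : measurable D -> integrable D f -> integrable D g ->
  integrable D (fun x => f x - g x).
Proof.
move=> mD if_ ig; apply: (@eq_integrable _ _ _ mu _ mD ((EFin \o f) \- (EFin \o g))%E).
  by move=> x _; rewrite /= EFinB.
exact: integrableB.
Qed.

Lemma Rintegral_ge0_ae D f : measurable D -> integrable D f ->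
  {ae mu, forall x, D x -> 0 <= f x} -> 0 <= \int[mu]_(x in D) f x.
Proof.
move=> mD if_ f0; rewrite -lee_fin -Rintegral_fine//.
have mf := integrable_Rmeasurable if_.
rewrite (_ : (\int[mu]_(x in D) (f x)%:E = \int[mu]_(x in D) `|(f x)%:E|)%E).
  by apply: integral_ge0 => x _; exact: abse_ge0.
apply: ae_eq_integral => //.
- exact/measurable_EFinP.
- by apply: measurableT_comp => //; exact/measurable_EFinP.
- by apply: filterS f0 => x + Dx => /(_ Dx) fx; rewrite /= ger0_norm.
Qed.

Lemma le_Rintegral_ae D f g : measurable D -> integrable D f -> integrable D g ->
  {ae mu, forall x, D x -> f x <= g x} ->
  \int[mu]_(x in D) f x <= \int[mu]_(x in D) g x.
Proof.
move=> mD if_ ig fg; rewrite -subr_ge0 -RintegralB//.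
apply: Rintegral_ge0_ae => //; first exact: integrable_subR.
by apply: filterS fg => x + Dx => /(_ Dx); rewrite subr_ge0.
Qed.

(** The equality case of monotonicity, by which an optimal integral bound becomes an identity almost
    everywhere. *)
Lemma le_Rintegral_eq D f g : measurable D -> integrable D f -> integrable D g ->
  {ae mu, forall x, D x -> f x <= g x} ->
  \int[mu]_(x in D) g x <= \int[mu]_(x in D) f x -> {ae mu, forall x, D x -> f x = g x}.
Proof.
move=> mD if_ ig fg gf; have ib := integrable_subR mD ig if_.
have mb := integrable_Rmeasurable ib.
have b0 : {ae mu, forall x, D x -> 0 <= g x - f x}.
  by apply: filterS fg => x + Dx => /(_ Dx); rewrite subr_ge0.
have E : \int[mu]_(x in D) (g x - f x) = 0.
  by apply/eqP; rewrite eq_le Rintegral_ge0_ae// andbT RintegralB// subr_le0.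
have : (\int[mu]_(x in D) `|(g x - f x)%:E| = 0)%E.
  rewrite -[RHS]/(0%:E) -E -Rintegral_fine//; apply: ae_eq_integral => //.
  - by apply: measurableT_comp => //; exact/measurable_EFinP.
  - exact/measurable_EFinP.
  - by apply: filterS b0 => x + Dx => /(_ Dx) H; rewrite /= ger0_norm.
move=> /(ae_eq_integral_abs mu mD ((measurable_EFinP D (fun x => g x - f x)).2 mb)).
by apply: filterS => x + Dx => /(_ Dx) [/eqP]; rewrite subr_eq0 => /eqP.
Qed.

End real_integral.

Section bathtub.
Context (dX : measure_display) (X : measurableType dX) (R : realType).
Variables (mu : {finite_measure set X -> \bar R}) (L : R).
Hypothesis hL : 0 < L < 1.
Local Notation L2 := (L2 mu).
Local Notation inner := (Defs.inner mu).
Local Notation nrm := (nrm mu).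
Local Notation U_L := (U_L mu L).
Implicit Types (u v w : X -> R).

Definition capacity : R := L * volume mu.
Definition support_value v : R := fine (support_U_L mu L v).
Let CV := Num.sqrt (volume mu).

Lemma volume_ge0 : 0 <= volume mu.
Proof. exact: fine_ge0. Qed.

Lemma capacity_ge0 : 0 <= capacity.
Proof. by rewrite mulr_ge0 ?volume_ge0// ltW//; case/andP: hL. Qed.

Lemma L2_cst c : L2 (fun=> c).
Proof. by have [] := @L2_bounded _ _ _ mu (fun=> c) `|c| (normr_ge0 c). Qed.

Lemma L2_integrable v : L2 v -> mu.-integrable setT (EFin \o v).
Proof.
move=> v2; apply: (@eq_integrable _ _ _ mu _ measurableT _ _ _ (L2_integrable_mul v2 (L2_cst 1))).
by move=> x _; rewrite /= mulr1.
Qed.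

Lemma L2_max v c : L2 v -> L2 (fun x => Num.max 0 (v x - c)).
Proof.
move=> v2; have vc2 := L2_sub v2 (L2_cst c).
rewrite (_ : (fun x => _) = fun x => 2^-1 * (v x - c) + 2^-1 * `|v x - c|).
  by apply: L2_lin => //; apply: L2_scale; exact: L2_abs.
apply/funext => x; case: (leP 0 (v x - c)) => H; first by rewrite ger0_norm//; lra.
by rewrite ltr0_norm//; lra.
Qed.

Lemma U_L0 : U_L (fun=> 0).
Proof.
split; first exact: L2_cst.
- by apply: nearW => x; rewrite lexx ler01.
- rewrite (_ : Rintegral _ _ _ = 0) ?capacity_ge0//.
  by rewrite /Rintegral integral0.
Qed.

Lemma U_L_nrm u : U_L u -> nrm u <= CV.
Proof.
move=> [u2 u01 _].
rewrite -(@ler_pXn2r _ 2)// ?nnegrE ?nrm_ge0 ?sqrtr_ge0//.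
rewrite sqr_nrm sqr_sqrtr ?volume_ge0//.
apply: (@le_trans _ _ (inner (fun=> 1) (fun=> 1))).
  apply: le_Rintegral_ae => //; [exact: L2_integrable_mul|exact/L2_integrable_mul/L2_cst/L2_cst|].
  by apply: filterS u01 => x /andP[? ?] _; nra.
rewrite /Defs.inner; under eq_Rintegral do rewrite mulr1.
by rewrite Rintegral_cst// mul1r.
Qed.

Lemma support_U_L_fin v : L2 v -> support_U_L mu L v = (support_value v)%:E.
Proof.
move=> v2; rewrite /support_value fineK// ge0_fin_numE.
  apply: (@le_lt_trans _ _ (CV * nrm v)%:E); last exact: ltry.
  apply: ge_ereal_sup => _ [u Uu <-]; rewrite lee_fin.
  have [u2 _ _] := Uu; apply: (le_trans (inner_le_nrm u2 v2)).
  by rewrite ler_wpM2r ?nrm_ge0// U_L_nrm.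
apply: ereal_sup_ubound; exists (fun=> 0); first exact: U_L0.
by rewrite inner0l.
Qed.

Lemma support_value_ge u v : L2 v -> U_L u -> inner u v <= support_value v.
Proof.
move=> v2 Uu; rewrite -lee_fin -support_U_L_fin//.
by apply: ereal_sup_ubound; exists u.
Qed.

Lemma support_value_le v c : L2 v -> (forall u, U_L u -> inner u v <= c) ->
  support_value v <= c.
Proof.
move=> v2 H; rewrite -lee_fin -support_U_L_fin//.
by apply: ge_ereal_sup => _ [u Uu <-]; rewrite lee_fin H.
Qed.

Lemma support_value_ge0 v : L2 v -> 0 <= support_value v.
Proof. by move=> v2; rewrite -(inner0l mu v); apply: support_value_ge => //; exact: U_L0. Qed.

Lemma support_valueZ a v : 0 <= a -> L2 v ->
  support_value (fun x => a * v x) = a * support_value v.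
Proof.
move=> a0 v2.
have H c w : 0 <= c -> L2 w -> support_value (fun x => c * w x) <= c * support_value w.
  move=> c0 w2; apply: support_value_le => [|u Uu]; first exact: L2_scale.
  have [u2 _ _] := Uu; rewrite innerZr// ler_wpM2l//; exact: support_value_ge.
apply/eqP; rewrite eq_le H//=.
have [->|an0] := eqVneq a 0.
  by rewrite mul0r support_value_ge0//; exact: L2_scale.
have := H a^-1 (fun x => a * v x); rewrite invr_ge0 a0 => /(_ isT (L2_scale a v2)).
under [X in support_value X]eq_fun do rewrite mulrA mulVf// mul1r.
by rewrite ler_pdivlMl// lt_neqAle eq_sym an0.
Qed.

Lemma support_valueD v w : L2 v -> L2 w ->
  support_value (fun x => v x + w x) <= support_value v + support_value w.
Proof.
move=> v2 w2; apply: support_value_le => [|u Uu]; first exact: L2_add.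
have [u2 _ _] := Uu; rewrite innerDr//.
by apply: lerD; exact: support_value_ge.
Qed.

Lemma support_value_nrm v : L2 v -> support_value v <= CV * nrm v.
Proof.
move=> v2; apply: support_value_le => // u Uu; have [u2 _ _] := Uu.
by apply: (le_trans (inner_le_nrm u2 v2)); rewrite ler_wpM2r ?nrm_ge0// U_L_nrm.
Qed.

Lemma support_value_ae v w : L2 v -> L2 w -> v = w %[ae mu] -> support_value v = support_value w.
Proof.
move=> v2 w2 vw; have H v' w' : L2 v' -> L2 w' -> v' = w' %[ae mu] ->
    support_value v' <= support_value w'.
  move=> ? ? e; apply: support_value_le => // u Uu; have [u2 _ _] := Uu.
  by rewrite innerC (inner_ae _ _ u2 e)// innerC; exact: support_value_ge.
by apply/eqP; rewrite eq_le !H//; apply: filterS vw => x /(_ I).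
Qed.

(** The test function [L] on the set [v > 0] satisfies the mass constraint whatever the measure of
    that set. *)
Lemma support_value0_le0 v : L2 v -> support_value v = 0 -> {ae mu, forall x, v x <= 0}.
Proof.
move=> v2 v0; have /andP[L0 L1] := hL.
pose P := [set x | 0 < v x].
have mP : measurable P.
  rewrite (_ : P = v @^-1` `]0, +oo[).
    by rewrite -[X in measurable X]setTI; apply: (L2_measurable v2) => //; exact: measurable_itv.
  by apply/seteqP; split => x; rewrite /P/= in_itv/= andbT.
have mu2 : L2 (fun x => L * \1_P x).
  have [x|//] := @L2_bounded _ _ _ mu (fun x => L * \1_P x) 1 ler01 (measurable_funM (measurable_cst L) (measurable_indic mP)).
  by rewrite indicE; case: (_ \in _); rewrite ?mulr1 ?mulr0 ?normr0// ger0_norm; lra.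
have U : U_L (fun x => L * \1_P x).
  split => //.
    by apply: nearW => x; rewrite indicE; case: (_ \in _) => /=; lra.
  apply: (@le_trans _ _ (\int[mu]_x L)).
    apply: le_Rintegral => //; [exact: L2_integrable|exact/L2_integrable/L2_cst|].
    by move=> x _; rewrite indicE; case: (_ \in _) => /=; lra.
  by rewrite Rintegral_cst.
have := support_value_ge v2 U; rewrite v0 innerZl//; last first.
  by have := L2_scale L^-1 mu2; under eq_fun do rewrite mulrA mulVf ?mul1r ?gt_eqF//.
rewrite pmulr_rle0// => H.
have H0 : {ae mu, forall x, setT x -> 0 = Num.max 0 (v x - 0)}.
  apply: le_Rintegral_eq => //; [exact/L2_integrable/L2_cst|exact/L2_integrable/L2_max| |].
    by apply: nearW => x _; rewrite le_max lexx.
  rewrite /Rintegral integral0/= -/(Rintegral _ _ _); apply: le_trans H.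
  rewrite le_eqVlt; apply/orP; left; apply/eqP; apply: eq_Rintegral => x _.
  rewrite subr0 indicE /P; case: (ltP 0 (v x)) => vx; first by rewrite mem_set// mul1r.
  rewrite memNset ?mul0r//= => vx'.
  by move: vx; rewrite leNgt vx'.
apply: filterS H0 => x /(_ I); rewrite subr0.
by case: (ltP 0 (v x)) => // v0' E; move: v0'; rewrite -E ltxx.
Qed.

Lemma inner_le_support_value m u v : 0 <= m -> L2 u -> L2 v ->
  {ae mu, forall x, 0 <= u x <= m} -> \int[mu]_x u x <= m * capacity ->
  inner u v <= m * support_value v.
Proof.
rewrite le_eqVlt => /orP[/eqP <-|m0] u2 v2 um uk.
  rewrite mul0r (inner_ae u2 (L2_cst 0) v2) ?inner0l//.
  by apply: filterS um => x; rewrite -eq_le eq_sym => /eqP.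
have U : U_L (fun x => m^-1 * u x).
  split; first exact: L2_scale.
  - apply: filterS um => x /andP[u0 u1]; rewrite ler_pdivrMl// mulr1 u1 andbT.
    by rewrite mulr_ge0 ?invr_ge0// ltW.
  - by rewrite RintegralZl//; [rewrite ler_pdivrMl|exact: L2_integrable].
have := support_value_ge v2 U; rewrite innerZl//.
by rewrite ler_pdivrMl.
Qed.

(** The Lagrangian bound, [c] being a multiplier for the mass constraint. It holds for every
    [c >= 0], so the level of one state may serve to bound the support value of another. *)
Lemma bathtub_le u v c : L2 v -> U_L u -> 0 <= c ->
  inner u v <= \int[mu]_x Num.max 0 (v x - c) + c * capacity.
Proof.
move=> v2 [u2 u01 uk] c0.
have vc2 := L2_sub v2 (L2_cst c).
have -> : inner u v = inner u (fun x => v x - c) + c * \int[mu]_x u x.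
  rewrite innerBr//; last exact: L2_cst.
  rewrite innerC [X in _ - X]innerC.
  have -> : inner (fun=> c) u = c * \int[mu]_x u x.
    by rewrite /Defs.inner RintegralZl//; exact: L2_integrable.
  by rewrite subrK innerC.
apply: lerD; last exact: ler_wpM2l.
apply: le_Rintegral_ae => //; first exact: L2_integrable_mul.
  by apply: L2_integrable; exact: L2_max.
apply: filterS u01 => x /andP[u0 u1] _.
by case: (leP 0 (v x - c)) => H; nra.
Qed.

Hypothesis hV : 0 < volume mu.

Let capacity_gt0 : 0 < capacity.
Proof. by rewrite mulr_gt0//; case/andP: hL. Qed.

Lemma measurable_superlevel v r : measurable_fun setT v -> measurable [set x | r < v x].
Proof.
move=> mv; rewrite (_ : [set x | r < v x] = v @^-1` `]r, +oo[).
  by rewrite -[X in measurable X]setTI; apply: mv => //; exact: measurable_itv.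
by apply/seteqP; split => x; rewrite /= in_itv/= andbT.
Qed.

Local Notation Phi := (level_measure mu).

Lemma le_level_measure v r s : measurable_fun setT v -> r <= s -> (Phi v s <= Phi v r)%E.
Proof.
move=> mv rs; apply: le_measure; rewrite ?inE; try exact: measurable_superlevel.
by move=> x /=; exact: le_lt_trans.
Qed.

Let inv_itv (v : X -> R) q := (Phi v q <= capacity%:E)%E.

(** With [inv_upper], this makes the [inf] in [level_inverse] meaningful: the set is bounded below
    and nonempty. The level measure tends to the volume at [-oo] and to 0 at [+oo], and [0 < L < 1]
    puts the capacity strictly between. *)
Let inv_lower v : measurable_fun setT v -> exists r, ~ inv_itv v r.
Proof.
move=> mv; apply/not_existsP => H.
have : Phi v (- n%:R) @[n --> \oo] --> mu setT.
  rewrite (_ : setT = \bigcup_n [set x | - n%:R < v x]).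
    apply: nondecreasing_cvg_mu => [n||m n mn].
    - exact: measurable_superlevel.
    - by apply: bigcup_measurable => n _; exact: measurable_superlevel.
    - by apply/subsetPset => x /=; apply: le_lt_trans; rewrite lerN2 ler_nat.
  apply/seteqP; split => // x _.
  exists (Num.truncn `|v x|).+1 => //=.
  by rewrite ltrNl (le_lt_trans _ (truncnS_gt _))// (le_trans (ler_norm _))// normrN.
move=> c; have : (mu setT <= capacity%:E)%E.
  apply: (cvge_to_le c); apply: nearW => n; have := H (- n%:R).
  by move=> /contrapT.
apply/negP; rewrite -ltNge -(@fineK _ (mu setT)) ?fin_num_measure// lte_fin.
by rewrite -/(volume mu) gtr_pMl//; case/andP: hL.
Qed.

Let inv_upper v : measurable_fun setT v -> exists r, inv_itv v r.
Proof.
move=> mv; apply/not_existsP => H.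
have : Phi v n%:R @[n --> \oo] --> mu set0.
  rewrite (_ : set0 = \bigcap_n [set x | n%:R < v x]).
    apply: nonincreasing_cvg_mu => [|n||m n mn].
    - by rewrite -ge0_fin_numE// fin_num_measure//; exact: measurable_superlevel.
    - exact: measurable_superlevel.
    - by apply: bigcap_measurableType => n _; exact: measurable_superlevel.
    - by apply/subsetPset => x /=; apply: le_lt_trans; rewrite ler_nat.
  apply/seteqP; split => // x /(_ (Num.truncn `|v x|).+1 I) /=.
  move=> /(lt_trans (truncnS_gt _)); rewrite ltNge ler_norm//.
move=> c; have : (capacity%:E <= mu set0)%E.
  by apply: (cvge_to_ge c); apply: nearW => n; have /negP := H n%:R; rewrite -ltNge => /ltW.
by rewrite measure0 lee_fin leNgt capacity_gt0.
Qed.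

Local Notation inv v := (level_inverse mu v (L * volume mu)%:E).

Lemma lt_level_inverse v q : measurable_fun setT v -> q < inv v -> (capacity%:E < Phi v q)%E.
Proof.
move=> mv qi; rewrite ltNge; apply/negP => Pq; move: qi; rewrite ltNge => /negP; apply.
apply: ge_inf => //; have [r Hr] := inv_lower mv.
exists r => s /= Hs; rewrite leNgt; apply/negP => sr; apply: Hr.
exact: le_trans (le_level_measure mv (ltW sr)) Hs.
Qed.

Lemma le_level_inverse v q : measurable_fun setT v -> (capacity%:E < Phi v q)%E -> q <= inv v.
Proof.
move=> mv kq; have [r Hr] := inv_upper mv.
apply: lb_le_inf; first by exists r.
move=> s /= Hs; rewrite leNgt; apply/negP => sr.
by have := lt_le_trans kq (le_trans (le_level_measure mv (ltW sr)) Hs); rewrite ltxx.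
Qed.

Lemma level_ge0 v : 0 <= level mu L v.
Proof. by rewrite le_max lexx. Qed.

(** The level measure is continuous from the right, because superlevel sets increase as the level
    decreases to its limit; strictly above the inverse it is at most the capacity. *)
Lemma level_measure_le v : measurable_fun setT v -> (Phi v (level mu L v) <= capacity%:E)%E.
Proof.
move=> mv; apply: (@le_trans _ _ (Phi v (inv v))).
  by apply: le_level_measure => //; rewrite le_max lexx orbT.
have : Phi v (inv v + n.+1%:R^-1) @[n --> \oo] --> Phi v (inv v).
  rewrite {2}/level_measure.
  rewrite (_ : [set x | _] = \bigcup_n [set x | inv v + n.+1%:R^-1 < v x]).
    apply: nondecreasing_cvg_mu => [n||m n mn].
    - exact: measurable_superlevel.
    - by apply: bigcup_measurable => n _; exact: measurable_superlevel.
    - apply/subsetPset => x /=; apply: le_lt_trans; rewrite lerD2l.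
      by rewrite lef_pV2 ?posrE ?ltr0n// ler_nat.
  apply/seteqP; split => x /=; first by move=> /ltr_add_invr[n vn]; exists n.
  by case=> n _; apply: lt_trans; rewrite ltrDl.
move=> c; apply: (cvge_to_le c); apply: nearW => n; rewrite leNgt; apply/negP.
by move=> /(le_level_inverse mv); rewrite leNgt ltrDl invr_gt0 ltr0n.
Qed.

(** Just below the inverse the level measure exceeds the capacity, and its left limit there measures
    the set [inv v <= v]. This set differs from the superlevel set by a level set, which is null by
    hypothesis. *)
Lemma level_measure_ge v : measurable_fun setT v -> (forall c, mu [set x | v x = c] = 0%E) ->
  0 < level mu L v -> (capacity%:E <= Phi v (level mu L v))%E.
Proof.
move=> mv v0 h0; have hE : level mu L v = inv v.
  by move: h0; rewrite /level; case: (leP 0 (inv v)) => // _; rewrite ltxx.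
have E : Phi v (inv v) = mu [set x | inv v <= v x].
  rewrite (_ : [set x | inv v <= v x] = [set x | inv v < v x] `|` [set x | v x = inv v]).
    rewrite measureU; first by rewrite -[LHS]adde0; congr (_ + _)%E; exact/esym/v0.
    - exact: measurable_superlevel.
    - by rewrite -[X in measurable X]setTI; exact: (mv measurableT _ (measurable_set1 (inv v))).
    - by apply/seteqP; split => // x /= [H xE]; move: H; rewrite xE ltxx.
  apply/seteqP; split => x /=.
    by rewrite le_eqVlt => /orP[/eqP <-|?]; [right|left].
  by case=> [/ltW//|->].
rewrite hE E.
have : Phi v (inv v - n.+1%:R^-1) @[n --> \oo] --> mu [set x | inv v <= v x].
  rewrite (_ : [set x | _] = \bigcap_n [set x | inv v - n.+1%:R^-1 < v x]).
    apply: nonincreasing_cvg_mu => [|n||m n mn].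
    - by rewrite -ge0_fin_numE// fin_num_measure//; exact: measurable_superlevel.
    - exact: measurable_superlevel.
    - by apply: bigcap_measurableType => n _; exact: measurable_superlevel.
    - apply/subsetPset => x /=; apply: le_lt_trans; rewrite lerD2l lerN2.
      by rewrite lef_pV2 ?posrE ?ltr0n// ler_nat.
  apply/seteqP; split => x /=.
    by move=> H n _ /=; rewrite (lt_le_trans _ H)// ltrBlDr ltrDl.
  move=> H; rewrite leNgt; apply/negP => vx.
  have [n vn] := ltr_add_invr vx; have /= := H n I; rewrite ltrBlDr => /(lt_trans vn).
  by rewrite ltxx.
move=> c; apply: (cvge_to_ge c); apply: nearW => n; apply/ltW/lt_level_inverse => //.
by rewrite ltrBlDr ltrDl.
Qed.

Local Notation chi v := (\1_(superlevel mu L v) : X -> R).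

Lemma L2_superlevel v : measurable_fun setT v -> L2 (chi v).
Proof.
move=> mv; have mS : measurable (superlevel mu L v) by exact: measurable_superlevel.
have [x|//] := @L2_bounded _ _ _ mu (chi v) 1 ler01 (measurable_indic mS).
by rewrite indicE; case: (_ \in _); rewrite ?normr1 ?normr0.
Qed.

Lemma Rintegral_superlevel v : measurable_fun setT v ->
  \int[mu]_x chi v x = fine (level_measure mu v (level mu L v)).
Proof.
move=> mv; rewrite /Rintegral integral_indic ?setIT//; exact: measurable_superlevel.
Qed.

Lemma U_L_superlevel v : measurable_fun setT v -> U_L (chi v).
Proof.
move=> mv; split; first exact: L2_superlevel.
- by apply: nearW => x; rewrite indicE; case: (_ \in _) => /=; lra.
- rewrite Rintegral_superlevel// -lee_fin fineK; first exact: level_measure_le.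
  by apply: fin_num_measure; exact: measurable_superlevel.
Qed.

Section bathtub_equality.
Variable v : X -> R.
Hypotheses (v2 : L2 v) (v0 : forall c, mu [set x | v x = c] = 0%E).
Let h := level mu L v.

Let h0 : 0 <= h. Proof. exact: level_ge0. Qed.

Let mv : measurable_fun setT v. Proof. exact: L2_measurable v2. Qed.

(** Complementary slackness: either the multiplier [h] vanishes or the mass constraint is
    saturated. *)
Lemma level_capacity : h * \int[mu]_x chi v x = h * capacity.
Proof.
have [->|hn0] := eqVneq h 0; first by rewrite !mul0r.
congr (_ * _); rewrite Rintegral_superlevel//; apply/eqP; rewrite -eqe fineK; last first.
  by apply: fin_num_measure; exact: measurable_superlevel.
rewrite eq_le level_measure_le//=; apply: level_measure_ge => //.
by rewrite lt_neqAle eq_sym hn0 h0.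
Qed.

Lemma inner_superlevel : inner (chi v) v =
  \int[mu]_x Num.max 0 (v x - h) + h * capacity.
Proof.
have c2 := L2_superlevel mv.
rewrite -level_capacity -RintegralZl//; last exact: L2_integrable.
rewrite -RintegralD//; [|exact/L2_integrable/L2_max|exact/L2_integrable/L2_scale].
apply: eq_Rintegral => x _; rewrite indicE /superlevel -/h.
case: (ltP 0 (v x - h)) => vh.
  by rewrite mem_set ?mulr1 ?mul1r; [ring|rewrite /= -subr_gt0].
by rewrite memNset ?mulr0 ?mul0r ?addr0//= => vh'; move: vh; rewrite leNgt subr_gt0 vh'.
Qed.

Lemma support_value_superlevel : support_value v = inner (chi v) v.
Proof.
apply/eqP; rewrite eq_le support_value_ge//; last exact: U_L_superlevel.
rewrite andbT; apply: support_value_le => // u Uu.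
by rewrite inner_superlevel; exact: bathtub_le.
Qed.

Lemma support_valueE : support_value v = \int[mu]_x Num.max 0 (v x - h) + h * capacity.
Proof. by rewrite support_value_superlevel inner_superlevel. Qed.

(** Attaining the support value forces equality almost everywhere in [u (v - h) <= (v - h)^+], which
    determines [u] wherever [v <> h], hence almost everywhere. *)
Lemma bathtub_unique u : U_L u -> support_value v <= inner u v ->
  {ae mu, forall x, u x = chi v x}.
Proof.
move=> [u2 u01 uk]; rewrite support_valueE => H.
have vh2 := L2_sub v2 (L2_cst h).
have : {ae mu, forall x, setT x -> u x * (v x - h) = Num.max 0 (v x - h)}.
  apply: le_Rintegral_eq => //; [exact: L2_integrable_mul|exact/L2_integrable/L2_max| |].
    by apply: filterS u01 => x /andP[u0 u1] _; case: (leP 0 (v x - h)) => vh; nra.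
  rewrite -(lerD2r (h * capacity)); apply: (le_trans H).
  have -> : inner u v = \int[mu]_x (u x * (v x - h)) + h * \int[mu]_x u x.
    rewrite -RintegralZl//; last exact: L2_integrable.
    rewrite -RintegralD//; [|exact: L2_integrable_mul|exact/L2_integrable/L2_scale].
    by apply: eq_Rintegral => x _; ring.
  by rewrite lerD2l ler_wpM2l.
have vnh : {ae mu, forall x, v x <> h}.
  exists [set x | v x = h]; split => //; last by move=> x /= /contrapT.
  by rewrite -[X in measurable X]setTI; exact: (mv measurableT (measurable_set1 h)).
move=> Eae; apply: (ae_filter2 Eae vnh) => x /(_ I) E vx; rewrite indicE /superlevel -/h.
case: (ltP 0 (v x - h)) E => vh.
  move=> E; rewrite mem_set; last by rewrite /= -subr_gt0.
  by apply: (mulIf (lt0r_neq0 vh)); rewrite E mul1r.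
have {}vh : v x - h < 0 by rewrite lt_neqAle vh subr_eq0 andbT; exact/eqP.
rewrite memNset; last by rewrite /= => hv; lra.
by move/eqP; rewrite mulf_eq0 (lt_eqF vh) orbF => /eqP.
Qed.

End bathtub_equality.

Lemma level_ae v w : measurable_fun setT v -> measurable_fun setT w ->
  {ae mu, forall x, v x = w x} -> level mu L v = level mu L w.
Proof.
move=> mv mw vw; rewrite /level /level_inverse.
suff E : level_measure mu v = level_measure mu w by rewrite E.
apply/funext => r; rewrite /level_measure.
rewrite -[LHS]mul1e -[RHS]mul1e -!integral_cst; try exact: measurable_superlevel.
rewrite integral_mkcond [RHS]integral_mkcond; apply: ae_eq_integral => //.
- by apply/(measurable_restrictT _ _).1 => //; exact: measurable_superlevel.
- by apply/(measurable_restrictT _ _).1 => //; exact: measurable_superlevel.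
- by apply: filterS vw => x vx _; rewrite !patchE; congr (if _ then _ else _);
    apply/idP/idP; rewrite !inE/= vx.
Qed.

End bathtub.

(** * The space-time cylinder *)

Section ae_integral.
Context (dX : measure_display) (X : measurableType dX) (R : realType).
Variable mu : {measure set X -> \bar R}.
Local Open Scope ereal_scope.
Import HBNNSimple.

(* The integral of a nonnegative function is a supremum over the simple functions
   below it, and these can be set to [0] on a null set. *)
Lemma eq_integral_ae (D : set X) (f g : X -> \bar R) : measurable D ->
  {ae mu, forall x, D x -> f x = g x} -> \int[mu]_(x in D) f x = \int[mu]_(x in D) g x.
Proof.
move=> mD.
have H (f1 g1 : X -> \bar R) : (forall x, 0 <= f1 x) -> (forall x, 0 <= g1 x) ->
    {ae mu, forall x, f1 x = g1 x} -> \int[mu]_x f1 x <= \int[mu]_x g1 x.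
  move=> f0 g0 [N [mN N0 sN]]; rewrite ge0_integralTE//.
  apply: ge_ereal_sup => _ [h /= hf <-].
  have mC := measurableC mN.
  pose h' := mul_nnsfun h (indic_nnsfun R mC).
  have -> : sintegral mu h = sintegral mu h'.
    have S (k : {nnsfun X >-> R}) : sintegral mu k = \int[mu]_x (k x)%:E.
      by rewrite integral_nnsfun// patch_setT.
    rewrite !S.
    apply: ae_eq_integral => //; try exact/measurable_EFinP.
    exists N; split => // x /= /not_implyP[_ hx]; apply: contrapT => Nx; apply: hx.
    by rewrite /h' /= mindicE mem_set// mulr1.
  rewrite ge0_integralTE//; apply: ereal_sup_ubound; exists h' => // x /=.
  rewrite mindicE; have [Nx|nNx] := pselect (N x).
    by rewrite memNset ?mulr0//= => /(_ Nx).
  rewrite mem_set// mulr1 (le_trans (hf x))//.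
  suff -> : f1 x = g1 x by [].
  by apply: contrapT => fg; apply: nNx; exact: sN.
have E (f1 g1 : X -> \bar R) : (forall x, 0 <= f1 x) -> (forall x, 0 <= g1 x) ->
    {ae mu, forall x, f1 x = g1 x} -> \int[mu]_x f1 x = \int[mu]_x g1 x.
  by move=> f0 g0 fg; apply/eqP; rewrite eq_le !H//; apply: filterS fg => x ->.
move=> fg; rewrite !(integral_mkcond D) [LHS]integralE [RHS]integralE.
have fgD : {ae mu, forall x, (f \_ D) x = (g \_ D) x}.
  by apply: filterS fg => x fgx; rewrite !patchE; case: ifPn => // /set_mem.
congr (_ - _); apply: E => //.
- by apply: filterS fgD => x H1; rewrite !funeposE H1.
- by apply: filterS fgD => x H1; rewrite !funenegE H1.
Qed.

Lemma eq_Rintegral_ae (D : set X) (f g : X -> R) : measurable D ->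
  {ae mu, forall x, D x -> f x = g x} ->
  (\int[mu]_(x in D) f x = \int[mu]_(x in D) g x)%R.
Proof.
move=> mD fg; congr fine; apply: eq_integral_ae => //.
by apply: filterS fg => x + Dx => /(_ Dx) ->.
Qed.

End ae_integral.

Section time_measure_finite.
Context (R : realType) (T : R).

Lemma time_measure_fin : fin_num_fun (time_measure T).
Proof.
move=> U mU; rewrite ge0_fin_numE ?measure_ge0// /time_measure /mrestr.
apply: (@le_lt_trans _ _ (lebesgue_measure (`]0, T[%classic : set R))).
  by apply: le_measure; rewrite ?inE//; apply: measurableI => //; exact: measurable_itv.
by rewrite lebesgue_measure_itv/=; case: ifP; rewrite -?EFinB ltry.
Qed.

HB.instance Definition _ := Measure_isFinite.Build _ _ _ (time_measure T) time_measure_fin.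

End time_measure_finite.

Section cylinder.
Context (dX : measure_display) (X : measurableType dX) (R : realType).
Variables (mu : {finite_measure set X -> \bar R}) (T : R).
Hypothesis T0 : 0 < T.
Local Notation leb := (@lebesgue_measure R).
Local Notation I := (`]0, T[%classic : set (measurableTypeR R)).
Local Notation nu := (cylinder_measure mu T).
Implicit Types (f u w : R * X -> R).

Let mI : measurable I. Proof. exact: measurable_itv. Qed.

Lemma cylinder_measure_fin : (nu setT < +oo)%E.
Proof.
rewrite -setXTT; apply: (product_measure_lty (m1 := time_measure T) (m2 := mu)) => //.
  by rewrite -ge0_fin_numE// time_measure_fin.
by rewrite -ge0_fin_numE// fin_num_measure.
Qed.

Lemma cylinder_slices f : nu.-integrable setT (EFin \o f) ->
  [/\ leb.-integrable I (EFin \o (fun t => \int[mu]_x f (t, x))),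
    \int[nu]_z f z = \int[leb]_(t in I) \int[mu]_x f (t, x) &
    {ae leb, forall t, I t -> mu.-integrable setT (EFin \o (fun x => f (t, x)))}].
Proof.
rewrite -setXTT => if_.
have [i1 E a] := Rfubini (m1 := time_measure T) (m2 := mu) measurableT measurableT if_.
have mf := integrable_Rmeasurable i1.
split.
- apply/(integrable_mrestr leb mI); last exact: i1.
  exact/measurable_EFinP.
- rewrite [LHS]E /Rintegral; congr fine; apply: integral_mrestr.
  exact/measurable_EFinP.
- have /ae_mrestr := a; apply: filterS => t H It; exact: H.
Qed.

Lemma ae_cylinder_slices (P : R * X -> Prop) : {ae nu, forall z, P z} ->
  {ae leb, forall t, I t -> {ae mu, forall x, P (t, x)}}.
Proof.
move=> [N [mN N0 sN]].
suff : {ae leb, forall t, I t -> mu (xsection N t) = 0%E}.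
  apply: filterS => t H It; exists (xsection N t); split.
  - exact: measurable_xsection.
  - exact: H.
  - by move=> x /= nP; rewrite /xsection/= inE; exact: sN.
apply/(ae_mrestr leb mI).
have : (\int[time_measure T]_t `|(mu \o xsection N) t| = 0)%E.
  by rewrite -[RHS]N0; apply: eq_integral => t _; rewrite gee0_abs.
move/(ae_eq_integral_abs (time_measure T) measurableT (measurable_fun_xsection mu mN)).
by apply: filterS => t; exact.
Qed.

Lemma cylinder_measure_eq0 (N : set (R * X)) : measurable N ->
  {ae leb, forall t, I t -> {ae mu, forall x, ~ N (t, x)}} -> nu N = 0%E.
Proof.
move=> mN H.
have <- : (\int[time_measure T]_t (cst 0%E t) = 0)%E by rewrite integral0.
apply: ae_eq_integral => //; first exact: (measurable_fun_xsection mu mN).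
apply/(@ae_mrestr _ _ _ leb I mI).
move: H => [M [mM M0 sM]]; exists M; split => // t /= nt; apply: sM => /= Q; apply: nt => It _ /=.
have [N' [mN' N'0 sN']] := Q It.
apply: (subset_measure0 _ mN' _ N'0); first exact: measurable_xsection.
by move=> x; rewrite /xsection/= inE => Nx; apply: sN' => /=; exact.
Qed.

(** Converse of [ae_cylinder_slices]; measurability of the exceptional set lets its measure be read
    off from its slices. *)
Lemma ae_cylinder (P : R * X -> Prop) : measurable [set z | ~ P z] ->
  {ae leb, forall t, I t -> {ae mu, forall x, P (t, x)}} -> {ae nu, forall z, P z}.
Proof.
move=> mP H; exists [set z | ~ P z]; split => //.
apply: cylinder_measure_eq0 => //.
move: H => [M [mM M0 sM]]; exists M; split => // t /= nt; apply: sM => /= Q; apply: nt => It.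
by apply: filterS (Q It) => x Px; exact.
Qed.

Lemma cylinder_L2_slices u : L2 nu u -> {ae leb, forall t, I t -> L2 mu (fun x => u (t, x))}.
Proof.
move=> /L2P[mu_ iu]; have [_ _] := cylinder_slices iu.
apply: filterS => t H It; apply/L2P; split; last exact: H.
exact: (measurableT_comp mu_ (measurable_pair1 _)).
Qed.

Lemma cylinder_inner u w : L2 nu u -> L2 nu w ->
  leb.-integrable I (EFin \o (fun t => Defs.inner mu (fun x => u (t, x)) (fun x => w (t, x)))) /\
  Defs.inner nu u w =
  \int[leb]_(t in I) Defs.inner mu (fun x => u (t, x)) (fun x => w (t, x)).
Proof. by move=> u2 w2; have [] := cylinder_slices (L2_integrable_mul u2 w2). Qed.

Lemma cylinder_L2_bound u (C : R) : measurable_fun setT u -> 0 <= C ->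
  {ae leb, forall t, I t -> L2 mu (fun x => u (t, x)) /\ nrm mu (fun x => u (t, x)) <= C} ->
  L2 nu u /\ nrm nu u <= C * Num.sqrt T.
Proof.
move=> mu_ C0 H.
have mu2 : measurable_fun setT (fun z => u z ^+ 2) by exact: measurable_funX.
have E : (\int[nu]_z (u z ^+ 2)%:E <= (C ^+ 2 * T)%:E)%E.
  rewrite (fubini_tonelli1 (m1 := time_measure T) (m2 := mu) (fun z => (u z ^+ 2)%:E)); last 2 first.
  - exact/measurable_EFinP.
  - by move=> z; rewrite lee_fin sqr_ge0.
  have -> : (C ^+ 2 * T)%:E = (\int[time_measure T]_t (C ^+ 2)%:E)%E.
    have tT : time_measure T setT = T%:E.
      transitivity (leb I); first by rewrite -[in RHS](setTI I).
      by rewrite lebesgue_measure_itv/= lte_fin T0 -EFinB subr0.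
    by rewrite integral_cst//; rewrite [X in (_ * X)%E]tT.
  apply: ae_ge0_le_integral => //.
  - by move=> t _; apply: integral_ge0 => x _; rewrite lee_fin sqr_ge0.
  - apply: (measurable_fun_fubini_tonelli_F (m2 := mu) (fun z => (u z ^+ 2)%:E)) => //.
      exact/measurable_EFinP.
    by move=> z; rewrite lee_fin sqr_ge0.
  - by move=> t _; rewrite lee_fin sqr_ge0.
  - apply/(@ae_mrestr _ _ _ leb I mI); apply: filterS H => t H1 It _.
    have [u2 uC] := H1 It; rewrite /fubini_F.
    have -> : (\int[mu]_y (u (t, y) ^+ 2)%:E = (nrm mu (fun x => u (t, x)) ^+ 2)%:E)%E.
      by rewrite sqr_nrm -Rintegral_fine//; exact: L2_integrable_mul.
    by rewrite lee_fin ler_pXn2r// nnegrE nrm_ge0.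
have u2 : L2 nu u.
  apply/L2P; split => //; apply/integrableP; split; first exact/measurable_EFinP.
  apply: (@le_lt_trans _ _ (C ^+ 2 * T)%:E); last exact: ltry.
  apply: le_trans E; rewrite le_eqVlt; apply/orP; left; apply/eqP; apply: eq_integral => z _.
  by rewrite /= ger0_norm// sqr_ge0.
split => //.
rewrite -(@ler_pXn2r _ 2)// ?nnegrE ?nrm_ge0// ?mulr_ge0 ?sqrtr_ge0//.
rewrite (sqr_nrm nu u) exprMn sqr_sqrtr ?(ltW T0)// -lee_fin -Rintegral_fine//.
exact: (L2_integrable_mul u2 u2).
Qed.

End cylinder.

Section time_reversal.
Context (R : realType) (T : R).
Local Notation leb := (@lebesgue_measure R).

(** Hypoellipticity describes [S_t^* p], whereas the adjoint state at time [t] is [S_(T-t)^* p].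
    Reflection preserves the length of intervals, which characterises Lebesgue measure. *)
Lemma ae_time_reversal (P : R -> Prop) :
  {ae leb, forall t, P t} -> {ae leb, forall t, P (T - t)}.
Proof.
move=> [N [mN N0 sN]].
have mr : measurable_fun setT (fun t : measurableTypeR R => T - t : measurableTypeR R).
  by apply: measurable_funB => //; exact: measurable_id.
have mrN : measurable ((fun t : measurableTypeR R => T - t) @^-1` N).
  by rewrite -[X in measurable X]setTI; exact: mr.
exists ((fun t : measurableTypeR R => T - t) @^-1` N); split => //; last by move=> t /= nP; exact: sN.
rewrite -N0; have := @lebesgue_measure_unique R
  (pushforward leb (fun t : measurableTypeR R => T - t : measurableTypeR R)) _ N mN.
move=> -> //= _ [[a b]] _ <-.
rewrite /pushforward (_ : _ @^-1` _ = `[T - b, T - a[%classic).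
  rewrite !lebesgue_measure_itv/= !lte_fin ltrD2l ltrN2; case: ifPn => // _.
  by rewrite -!EFinB; congr EFin; ring.
by apply/seteqP; split => t /=; rewrite !in_itv/= => /andP[? ?]; apply/andP; split; lra.
Qed.

End time_reversal.

(** * The dual problem *)

(** A null set contains no interval, so a positive value at [T] would be seen at unexceptional times
    just before [T]. *)
Lemma continuous_le0_right (R : realType) (T : R) (G : R -> R) : 0 < T -> continuous G ->
  {ae @lebesgue_measure R, forall t, 0 < t < T -> G t <= 0} -> G T <= 0.
Proof.
move=> T0 cG [N [mN N0 sN]]; rewrite leNgt; apply/negP => GT.
have /nbhs_ballP[e /= e0 He] : \forall t \near T, 0 < G t.
  have c : G @ T --> G T := cG T.
  by apply: (cvgr_gt _ c); exact: GT.
pose a := Num.max (T / 2) (T - e / 2).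
have aT : a < T by rewrite gt_max; apply/andP; split; lra.
have : lebesgue_measure (`]a, T[%classic : set R) = 0%E.
  apply: (@subset_measure0 _ _ _ (@lebesgue_measure R) _ N _ mN _ N0); first exact: measurable_itv.
  move=> t /=; rewrite in_itv/= gt_max => /andP[/andP[t1 t2] t3]; apply: sN => /=.
  have tT : 0 < t < T by apply/andP; split; lra.
  move=> /(_ tT); apply/negP; rewrite -ltNge; apply: He.
  by rewrite /ball/= ltr_distlC; apply/andP; split; lra.
by rewrite lebesgue_measure_itv/= lte_fin aT -EFinB => -[/eqP]; rewrite subr_eq0 gt_eqF.
Qed.

Lemma midpoint_norm_inner (R : realFieldType) (x y i N : R) :
  N ^+ 2 = (2^-1 * x) ^+ 2 + 2 * (2^-1 * (2^-1 * i)) + (2^-1 * y) ^+ 2 ->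
  (x + y) ^+ 2 <= (2 * N) ^+ 2 -> x * y <= i.
Proof. lra. Qed.

(** Along the ray of a minimiser the dual cost is [c^2 A / 2 - c A], with [A] the square of the
    total support, by [minimiser_ray]. *)
Lemma ray_minimum (R : realFieldType) (c A : R) : 0 < A ->
  2^-1 * c ^+ 2 * A - c * A <= 2^-1 * A - A -> c = 1.
Proof.
move=> A0 H; have : (c - 1) ^+ 2 * A <= 0 by lra.
by rewrite pmulr_lle0// => c1; apply/eqP; rewrite -subr_eq0 -sqrf_eq0 eq_le c1 sqr_ge0.
Qed.

Section dual_problem.
Context (dX : measure_display) (X : measurableType dX) (R : realType).
Variables (mu : {finite_measure set X -> \bar R}) (L T eps : R).
Hypotheses (hL : 0 < L < 1) (T0 : 0 < T) (eps0 : 0 < eps).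
Variable S : R -> (X -> R) -> (X -> R).
Hypothesis hS : C0_semigroup mu S.
Local Notation L2 := (L2 mu).
Local Notation inner := (Defs.inner mu).
Local Notation nrm := (nrm mu).
Local Notation leb := (@lebesgue_measure R).
Local Notation I := (`]0, T[%classic : set (measurableTypeR R)).
Local Notation state := (adjoint_state mu T S).
Local Notation sv := (support_value mu L).
Implicit Types (p q f : X -> R) (s t a : R).

Let mI : measurable I. Proof. exact: measurable_itv. Qed.

Let lI : (leb I < +oo)%E.
Proof. by rewrite lebesgue_measure_itv/= lte_fin T0 -EFinB ltry. Qed.

Let It t : I t -> 0 <= t <= T.
Proof. by rewrite /= in_itv/= => /andP[/ltW -> /ltW ->]. Qed.

Lemma adjoint_stateP q t : L2 q -> 0 <= t <= T -> L2 (state q t) /\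
  forall f, L2 f -> inner (S (T - t) f) q = inner f (state q t).
Proof.
move=> q2 /andP[t0 tT]; apply: adjointP => //.
by apply: C0_semigroup_bounded => //; rewrite subr_ge0.
Qed.

Lemma adjoint_state_L2 q t : L2 q -> 0 <= t <= T -> L2 (state q t).
Proof. by move=> q2 tT; have [] := adjoint_stateP q2 tT. Qed.

Lemma adjoint_state_nrm : exists2 M : R, 0 <= M &
  forall q t, L2 q -> 0 <= t <= T -> nrm (state q t) <= M * nrm q.
Proof.
have [M M0 HM] := semigroup_bounded hS T; exists M => // q t q2 /andP[t0 tT].
apply: nrm_adjoint_le => //; first by apply: C0_semigroup_bounded => //; rewrite subr_ge0.
by move=> f f2; apply: HM => //; apply/andP; split; lra.
Qed.

Lemma adjoint_state_lin a p q t : L2 p -> L2 q -> 0 <= t <= T ->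
  state (fun x => a * p x + q x) t = (fun x => a * state p t x + state q t x) %[ae mu].
Proof.
move=> p2 q2 /andP[t0 tT]; apply: adjoint_lin => //.
by apply: C0_semigroup_bounded => //; rewrite subr_ge0.
Qed.

Lemma adjoint_state_continuous f q : L2 f -> L2 q -> exists2 G : R -> R, continuous G &
  forall t, 0 <= t <= T -> G t = inner f (state q t).
Proof.
move=> f2 q2.
have [|G cG GE] := @semigroup_pairing_continuous _ _ _ mu S T hS T0 (fun=> f) 0 q (lexx _) (fun=> f2) _ q2.
  by move=> s t; rewrite mul0r (_ : (fun x => _) = fun=> 0) ?/nrm ?inner0l ?sqrtr0//;
    apply/funext => x; rewrite subrr.
exists (fun t => G (T - t)).
  move=> t; apply: (@continuous_comp _ _ _ (fun t => T - t) G); last exact: cG.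
  by apply: cvgB; [exact: cvg_cst|exact: cvg_id].
move=> t tT; have /andP[t0 tT'] := tT.
rewrite GE; last by apply/andP; split; lra.
by have [_ ->] := adjoint_stateP q2 tT.
Qed.

(** The supremum runs over uncountably many controls, but each pairing is continuous in time, so the
    superlevel sets are unions of relatively open sets. *)
Lemma measurable_support_state q : L2 q -> measurable_fun I (fun t => sv (state q t)).
Proof.
move=> q2; apply: (measurability _ (RGenOInfty.measurableE R)) => _ [_ [r ->] <-].
pose G (u : X -> R) := if pselect (L2 u) is left u2
  then projT1 (cid2 (adjoint_state_continuous u2 q2)) else cst 0.
have GP u : L2 u -> continuous (G u) /\ forall t, 0 <= t <= T -> G u t = inner u (state q t).
  by move=> u2; rewrite /G; case: pselect => // u2'; case: cid2.
rewrite (_ : _ `&` _ = I `&` \bigcup_(u in U_L mu L) (G u @^-1` `]r, +oo[)).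
  apply: measurableI => //; apply: open_measurable; apply: bigcup_open => u [u2 _ _].
  have [cG _] := GP u u2.
  by apply: open_comp => [x _|]; [exact: cG|exact: interval_open].
apply/seteqP; split => t [tI /=].
  rewrite in_itv/= andbT => rt; split => //.
  have q2t := adjoint_state_L2 q2 (It tI).
  apply: contrapT => H; move: rt; rewrite ltNge => /negP; apply.
  apply: support_value_le => // u Uu; rewrite leNgt; apply/negP => ru; apply: H.
  have [u2 _ _] := Uu; exists u => //=; rewrite in_itv/= andbT.
  by have [_ ->] := GP u u2; rewrite ?It.
case=> u Uu /=; rewrite !in_itv/= !andbT => rG; split => //; apply: (lt_le_trans rG).
have [u2 _ _] := Uu; have [_ ->] := GP u u2; rewrite ?It//.
by apply: support_value_ge => //; exact: adjoint_state_L2 (It tI).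
Qed.

Lemma support_state_ge0 q t : L2 q -> 0 <= t <= T -> 0 <= sv (state q t).
Proof. by move=> q2 tT; apply: support_value_ge0 => //; exact: adjoint_state_L2. Qed.

Lemma support_state_le : exists2 K : R, 0 <= K &
  forall q t, L2 q -> 0 <= t <= T -> sv (state q t) <= K * nrm q.
Proof.
have [M M0 HM] := adjoint_state_nrm.
exists (Num.sqrt (volume mu) * M); first by rewrite mulr_ge0// sqrtr_ge0.
move=> q t q2 tT; apply: le_trans (support_value_nrm hL (adjoint_state_L2 q2 tT)) _.
by rewrite -mulrA ler_wpM2l ?sqrtr_ge0// HM.
Qed.

Lemma integrable_support_state q : L2 q -> leb.-integrable I (EFin \o (fun t => sv (state q t))).
Proof.
move=> q2; have [K K0 HK] := support_state_le.
apply: measurable_bounded_integrable => //.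
- exact: measurable_support_state.
- exists (K * nrm q); split; [by rewrite num_real|move=> y Ky t tI].
  by rewrite /= ger0_norm ?support_state_ge0 ?It// (le_trans _ (ltW Ky))// HK// It.
Qed.

Definition total_support q := \int[leb]_(t in I) sv (state q t).

Lemma total_support_ge0 q : L2 q -> 0 <= total_support q.
Proof. by move=> q2; apply: Rintegral_ge0 => t tI; rewrite support_state_ge0// It. Qed.

Lemma total_supportZ a q : 0 <= a -> L2 q ->
  total_support (fun x => a * q x) = a * total_support q.
Proof.
move=> a0 q2; rewrite -RintegralZl//; last exact: integrable_support_state.
apply: eq_Rintegral => t; rewrite inE => tI; have q2t := adjoint_state_L2 q2 (It tI).
rewrite -support_valueZ//; apply: support_value_ae => //.
- by apply: adjoint_state_L2; [exact: L2_scale|exact: It].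
- exact: L2_scale.
have := adjoint_state_lin a q2 (L2_cst0 mu) (It tI).
(* Taken at zero with coefficient [-1], linearity says that the state of the zero datum is null; the
   identity above then reduces to homogeneity. *)
have := adjoint_state_lin (- 1) (L2_cst0 mu) (L2_cst0 mu) (It tI).
have E (h : X -> R) : (fun x => a * h x + 0) = (fun x => a * h x) by apply/funext => x; rewrite addr0.
have E0 : (fun x : X => -1 * 0 + 0 : R) = fun=> 0 by apply/funext => x; rewrite mulr0 addr0.
by rewrite E E0; apply: filterS2 => x /(_ Logic.I) e0 /(_ Logic.I) ->; lra.
Qed.

Lemma total_supportD p q : L2 p -> L2 q ->
  total_support (fun x => p x + q x) <= total_support p + total_support q.
Proof.
move=> p2 q2; rewrite -RintegralD//; try exact: integrable_support_state.
have ip := integrable_support_state p2; have iq := integrable_support_state q2.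
rewrite /total_support; apply: le_Rintegral.
- exact: mI.
- by apply: integrable_support_state; exact: L2_add.
- apply: (@eq_integrable _ _ _ leb _ mI _ _ _ (integrableD mI ip iq)).
  by move=> t _; rewrite /= EFinD.
move=> t tI; have p2t := adjoint_state_L2 p2 (It tI); have q2t := adjoint_state_L2 q2 (It tI).
apply: le_trans (support_valueD hL p2t q2t).
rewrite le_eqVlt; apply/orP; left; apply/eqP; apply: support_value_ae => //.
- by apply: adjoint_state_L2; [exact: L2_add|exact: It].
- exact: L2_add.
have := adjoint_state_lin 1 p2 q2 (It tI).
have E (h1 h2 : X -> R) : (fun x => 1 * h1 x + h2 x) = (fun x => h1 x + h2 x).
  by apply/funext => x; rewrite mul1r.
by rewrite E; apply: filterS => x /(_ Logic.I) -> _; rewrite mul1r.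
Qed.

Lemma total_support_le : exists2 K : R, 0 <= K &
  forall q, L2 q -> total_support q <= K * nrm q.
Proof.
have [K K0 HK] := support_state_le; exists (K * T); first by rewrite mulr_ge0// ltW.
move=> q q2; apply: (@le_trans _ _ (\int[leb]_(t in I) (K * nrm q))).
  apply: le_Rintegral => //; first exact: integrable_support_state.
    apply: measurable_bounded_integrable => //.
    by exists `|K * nrm q|; split; [rewrite num_real|move=> y Ky t _; exact: ltW].
  by move=> t tI; rewrite HK// It.
have E : fine (leb `]0, T[%classic) = T.
  by rewrite lebesgue_measure_itv/= lte_fin T0 -EFinB/= subr0.
rewrite [leRHS]mulrAC -[X in _ <= _ * X]E le_eqVlt; apply/orP; left; apply/eqP.
exact: Rintegral_cst.
Qed.

Lemma total_support_lipschitz : exists2 K : R, 0 <= K &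
  forall p q, L2 p -> L2 q -> `|total_support p - total_support q| <= K * nrm (fun x => p x - q x).
Proof.
have [K K0 HK] := total_support_le; exists K => //.
have H p q : L2 p -> L2 q -> total_support p - total_support q <= K * nrm (fun x => p x - q x).
  move=> p2 q2; rewrite lerBlDl; have b2 := L2_sub p2 q2.
  have := total_supportD q2 b2.
  rewrite (_ : (fun x => q x + (p x - q x)) = p); last by apply/funext => x; rewrite subrKC.
  by move=> /le_trans; apply; rewrite lerD2l HK.
move=> p q p2 q2; rewrite ler_norml lerNl opprB; apply/andP; split; last exact: H.
by rewrite nrm_subC//; exact: H.
Qed.

Lemma total_support_ae p q : L2 p -> L2 q -> p = q %[ae mu] -> total_support p = total_support q.
Proof.
move=> p2 q2 /(nrm_sub_eq0 p2 q2) E; have [K K0 HK] := total_support_lipschitz.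
have := HK p q p2 q2; rewrite E mulr0 normr_le0 subr_eq0 => /eqP//.
Qed.

(** For fixed [u] the pairing with the state is at most 0 at almost every time and continuous up to
    [T], where it is [<u, q>]; so the support value of [q] itself vanishes. *)
Lemma total_support0_le0 q : L2 q -> total_support q = 0 -> {ae mu, forall x, q x <= 0}.
Proof.
move=> q2 s0; apply: (support_value0_le0 hL) => //.
have ae0 : {ae leb, forall t, I t -> 0 = sv (state q t)}.
  apply: le_Rintegral_eq => //.
  - by apply: eq_integrable (integrable0 leb I).
  - exact: integrable_support_state.
  - by apply: aeW => t tI; rewrite support_state_ge0// It.
  - by rewrite [X in X <= _]s0 Rintegral_ge0.
apply: (@le_anti _ R); apply/andP; split; last exact: (support_value_ge0 hL q2).
apply: (support_value_le hL) => // u Uu.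
have [u2 _ _] := Uu; have [G cG GE] := adjoint_state_continuous u2 q2.
have <- : G T = inner u q.
  have TT : 0 <= T <= T by rewrite lexx ltW.
  rewrite GE//; have [_ <-//] := adjoint_stateP q2 TT.
  rewrite subrr; apply: inner_ae => //; first exact: (semigroup_L2 hS).
  exact: C0_semigroup0.
apply: (continuous_le0_right T0 cG); apply: (ae_filter1 ae0) => t H tT.
have tI : I t by rewrite /= in_itv.
rewrite GE ?It// (H tI); apply: (support_value_ge hL) => //; exact: adjoint_state_L2 (It tI).
Qed.

Variable z : X -> R.
Hypotheses (z2 : L2 z) (z0 : {ae mu, forall x, 0 <= z x}).

Definition dual_cost q := 2^-1 * total_support q ^+ 2 - inner z q + eps * nrm q.

Lemma dual_functionalE q : L2 q -> dual_functional mu L T eps S z q = (dual_cost q)%:E.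
Proof.
move=> q2; rewrite /dual_functional Lp_norm2E//.
have -> : (\int[leb]_(t in `]0%R, T[) support_U_L mu L (state q t) = (total_support q)%:E)%E.
  rewrite -Rintegral_fine//; last exact: integrable_support_state.
  apply: eq_integral => t; rewrite inE => tI.
  by rewrite (support_U_L_fin hL)//; exact: adjoint_state_L2 (It tI).
by rewrite /dual_cost EFinD EFinB !EFinM.
Qed.

Lemma inner_le0 q : L2 q -> {ae mu, forall x, q x <= 0} -> inner z q <= 0.
Proof.
move=> q2 q0; rewrite -(inner0r mu z); apply: le_Rintegral_ae => //.
- exact: L2_integrable_mul.
- by apply: L2_integrable_mul => //; exact: L2_cst0.
- by apply: (ae_filter2 q0 z0) => x qx zx _; rewrite mulr0 mulr_ge0_le0.
Qed.

Lemma dual_costZ a q : 0 <= a -> L2 q -> dual_cost (fun x => a * q x) =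
  2^-1 * a ^+ 2 * total_support q ^+ 2 - a * (inner z q - eps * nrm q).
Proof.
move=> a0 q2; rewrite /dual_cost total_supportZ// innerZr// nrmZ// ger0_norm//; ring.
Qed.

Lemma dual_cost_ae p q : L2 p -> L2 q -> p = q %[ae mu] -> dual_cost p = dual_cost q.
Proof.
move=> p2 q2 pq; rewrite /dual_cost (total_support_ae p2 q2 pq) (nrm_ae p2 q2 pq).
by rewrite ![inner z _]innerC (inner_ae p2 q2 z2 pq).
Qed.

Lemma dual_cost_midpoint p q : L2 p -> L2 q ->
  dual_cost (midpoint p q) <= 2^-1 * (dual_cost p + dual_cost q).
Proof.
move=> p2 q2; have pp := L2_scale 2^-1 p2; have qq := L2_scale 2^-1 q2.
have h0 : 0 <= 2^-1 :> R by rewrite invr_ge0.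
have S1 : total_support (midpoint p q) <= 2^-1 * total_support p + 2^-1 * total_support q.
  by apply: le_trans (total_supportD pp qq) _; rewrite !total_supportZ.
have N1 : nrm (midpoint p q) <= 2^-1 * nrm p + 2^-1 * nrm q.
  by apply: le_trans (nrmD_le pp qq) _; rewrite !nrmZ// ger0_norm.
have S0 := total_support_ge0 (L2_midpoint p2 q2).
have Sp := total_support_ge0 p2; have Sq := total_support_ge0 q2.
rewrite /dual_cost {1}/midpoint [inner z _]inner_linr// innerZr//.
move: S1 N1 S0 Sp Sq; move: (total_support _) (total_support p) (total_support q) (nrm _) => A B C N.
move=> S1 N1 S0 Sp Sq.
have : A ^+ 2 <= 2^-1 * (B ^+ 2 + C ^+ 2).
  apply: (@le_trans _ _ ((2^-1 * B + 2^-1 * C) ^+ 2)).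
    by rewrite ler_pXn2r// nnegrE// addr_ge0// mulr_ge0.
  have := sqr_ge0 (B - C); lra.
have := ler_wpM2l (ltW eps0) N1; lra.
Qed.

Lemma dual_cost_cvg (u : nat -> X -> R) q : (forall k, L2 (u k)) -> L2 q ->
  nrm (fun x => u k x - q x) @[k --> \oo] --> 0 ->
  total_support (u k) @[k --> \oo] --> total_support q /\
  dual_cost (u k) @[k --> \oo] --> dual_cost q.
Proof.
move=> u2 q2 uq; have [K K0 HK] := total_support_lipschitz.
have c : total_support (u k) @[k --> \oo] --> total_support q.
  apply/subr_cvg0; apply: norm_cvg0.
  have cK : (fun k => K * nrm (fun x => u k x - q x)) @ \oo --> K * 0.
    by apply: cvgM => //; exact: cvg_cst.
  rewrite mulr0 in cK; apply: (squeeze_cvgr _ (cvg_cst 0) cK).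
  by apply: nearW => k; rewrite normr_ge0/= HK.
split => //; apply: cvgD; last by apply: cvgM; [exact: cvg_cst|exact: nrm_cvg].
apply: cvgB; first by apply: cvgM; [exact: cvg_cst|exact: cvgM].
apply: (bounded_functional_cvg (C := nrm z)) => // [g h g2 h2|g g2].
  exact: innerBr.
exact: normr_inner_le.
Qed.

Lemma closed_dual_cost c : closed_L2 mu [set q | L2 q /\ dual_cost q <= c].
Proof.
move=> u q Hu q2 uq; split => //; have [_ cv] := dual_cost_cvg (fun k => (Hu k).1) q2 uq.
by apply: (cvgr_to_le cv); apply: nearW => k; exact: (Hu k).2.
Qed.

(* A sequence contradicting coercivity has normalisations whose total support
   tends to 0 while their pairing with [z] is at least [eps]; a common point of
   the resulting nested convex sets would be nonpositive, whereas [z >= 0]. *)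
Lemma dual_cost_coercive : exists C : R, forall q, L2 q -> dual_cost q <= 0 -> nrm q <= C.
Proof.
apply: contrapT => /forallNP H.
pose C_ n : set (X -> R) := [set q | [/\ L2 q, nrm q <= 1, eps <= inner z q &
  total_support q <= n.+1%:R^-1]].
have : exists q, forall n, C_ n q.
  apply: (@nested_convex_closed _ _ _ mu C_ 1).
  - by move=> n q [].
  - move=> n p q [p2 p1 pz pS] [q2 q1 qz qS].
    have pp := L2_scale 2^-1 p2; have qq := L2_scale 2^-1 q2.
    have h0 : 0 <= 2^-1 :> R by rewrite invr_ge0.
    split; first exact: L2_midpoint.
    + by apply: (le_trans (nrmD_le pp qq)); rewrite !nrmZ// ger0_norm//; lra.
    + by rewrite /midpoint inner_linr// innerZr//; lra.
    + apply: (le_trans (total_supportD pp qq)).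
      rewrite (total_supportZ h0 p2) (total_supportZ h0 q2).
      by move: pS qS; move: (total_support p) (total_support q) (n.+1%:R^-1) => A B r; lra.
  - move=> n u q Hu q2 uq; have u2 k : L2 (u k) by have [] := Hu k.
    split => //.
    + by apply: (cvgr_to_le (nrm_cvg u2 q2 uq)); apply: nearW => k; have [] := Hu k.
    + have cz : inner z (u k) @[k --> \oo] --> inner z q.
        apply: (bounded_functional_cvg (C := nrm z)) => // [g h g2 h2|g g2].
          exact: innerBr.
        exact: normr_inner_le.
      by apply: (cvgr_to_ge cz); apply: nearW => k; have [] := Hu k.
    + have [cS _] := dual_cost_cvg u2 q2 uq.
      by apply: (cvgr_to_le cS); apply: nearW => k; have [] := Hu k.
  - move=> n q [q2 q1 qz qS]; split => //; apply: (le_trans qS).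
    by rewrite lef_pV2 ?posrE ?ltr0n// ler_nat.
  (* On the ray of [q], a nonpositive cost means that [nrm f] times half the square of
     [total_support q] is at most [<z, q> - eps], which is below [nrm z]. With [nrm f > m] this
     forces the total support under [1 / (n + 1)]. *)
  - move=> n; pose m := 2 * nrm z * n.+1%:R ^+ 2 + 1.
    have m0 : 0 < m by rewrite ltr_wpDl// !mulr_ge0 ?nrm_ge0 ?exprn_ge0.
    have /existsNP[f /not_implyP[f2 /not_implyP[fJ /negP]]] := H m.
    rewrite -ltNge => mf; have f0 : 0 < nrm f by exact: lt_trans mf.
    have i0 : 0 <= (nrm f)^-1 by rewrite invr_ge0 ltW.
    have n1 : (nrm f)^-1 * nrm f = 1 by rewrite mulVf// gt_eqF.
    pose q x := (nrm f)^-1 * f x; have q2 : L2 q by exact: L2_scale.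
    have qn : nrm q = 1 by rewrite nrmZ// ger0_norm.
    exists q; last by rewrite qn.
    have fE : f = fun x => nrm f * q x.
      by apply/funext => x; rewrite /q mulrA divff ?mul1r// gt_eqF.
    have Sq0 := total_support_ge0 q2.
    move: fJ; rewrite fE (dual_costZ (ltW f0) q2) qn mulr1.
    rewrite (_ : 2^-1 * _ * _ - _ = nrm f * (2^-1 * nrm f * total_support q ^+ 2 - (inner z q - eps))); last by ring.
    rewrite pmulr_rle0// subr_le0 => Sq.
    have zq : eps <= inner z q.
      rewrite -subr_ge0; apply: le_trans Sq; rewrite !mulr_ge0 ?sqr_ge0 ?invr_ge0//.
      exact: ltW.
    split => //; first by rewrite qn.
    have zn : inner z q <= nrm z by have := inner_le_nrm z2 q2; rewrite qn mulr1.
    rewrite -(@ler_pXn2r _ 2)// ?nnegrE ?invr_ge0//.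
    rewrite exprVn -[leRHS]mul1r ler_pdivlMr ?exprn_gt0//.
    have n0 : 0 < n.+1%:R ^+ 2 :> R by rewrite exprn_gt0.
    have zge0 : 0 <= nrm z := nrm_ge0 mu z.
    rewrite leNgt; apply/negP => S1.
    have : 2^-1 * m * total_support q ^+ 2 <= nrm z.
      apply: (@le_trans _ _ (2^-1 * nrm f * total_support q ^+ 2)).
        by rewrite ler_wpM2r ?sqr_ge0// ler_wpM2l ?invr_ge0// ltW.
      by have e0 := eps0; lra.
    rewrite /m; have := sqr_ge0 (total_support q).
    move: (total_support q ^+ 2) S1 => A S1 A0 H1.
    have : nrm z * 1 <= nrm z * (A * n.+1%:R ^+ 2) by rewrite ler_wpM2l// ltW.
    move=> H2; have A1 : A <= 0 by nra.
    have A2 : A = 0 by apply/eqP; rewrite eq_le A1.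
    by move: S1; rewrite A2 mul0r ltNge ler01.
move=> [q Hq]; have [q2 _ qz _] := Hq 0%N.
have S0 : total_support q = 0.
  apply/eqP; rewrite eq_le total_support_ge0// andbT leNgt; apply/negP => S0.
  have [k] := ltr_add_invr S0; rewrite add0r; have [_ _ _] := Hq k.
  by move=> H1 /(le_lt_trans H1); rewrite ltxx.
by have := le_lt_trans (inner_le0 q2 (total_support0_le0 q2 S0)) eps0; rewrite ltNge qz.
Qed.

Lemma dual_cost0 : dual_cost (fun=> 0) = 0.
Proof.
have := dual_costZ (lexx 0) (L2_cst0 mu).
rewrite (_ : (fun x => _) = fun=> 0); first by move=> ->; ring.
by apply/funext => x; rewrite mul0r.
Qed.

Lemma dual_minimiser_exists : exists2 p, L2 p & forall q, L2 q -> dual_cost p <= dual_cost q.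
Proof.
have [C HC] := dual_cost_coercive.
apply: (exists_minimiser (f0 := fun=> 0) (C := C)).
- exact: L2_cst0.
- exact: dual_cost_midpoint.
- exact: closed_dual_cost.
- by move=> q q2; rewrite dual_cost0; exact: HC.
- exists (- (nrm z * `|C|)) => q q2; have [qJ|/ltW qJ] := leP (dual_cost q) 0; last first.
    by apply: le_trans qJ; rewrite oppr_le0 mulr_ge0 ?nrm_ge0.
  have qC := le_trans (HC q q2 qJ) (ler_norm C).
  have zq := le_trans (inner_le_nrm z2 q2) (ler_wpM2l (nrm_ge0 mu z) qC).
  have := sqr_ge0 (total_support q); have := mulr_ge0 (ltW eps0) (nrm_ge0 mu q).
  rewrite /dual_cost; lra.
Qed.

Section minimiser.
Variable p : X -> R.
Hypotheses (p2 : L2 p) (pmin : forall q, L2 q -> dual_cost p <= dual_cost q).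

Lemma minimiser_ray : total_support p ^+ 2 = inner z p - eps * nrm p.
Proof.
have E : dual_cost p = 2^-1 * total_support p ^+ 2 - (inner z p - eps * nrm p).
  by rewrite /dual_cost; ring.
have H a : 0 <= a -> 0 <= 2^-1 * (a ^+ 2 - 1) * total_support p ^+ 2 -
    (a - 1) * (inner z p - eps * nrm p).
  move=> a0; have := pmin (L2_scale a p2); rewrite dual_costZ// E; lra.
have := sqr_ge0 (total_support p).
move: (total_support p ^+ 2) (inner z p - eps * nrm p) H => A B H A0.
have [H1 H2] : 0 <= A - B /\ 0 <= B - A.
  split; apply: (@quad_ge0 _ (2^-1 * A)) => s s0.
    by have := H (1 + s) (addr_ge0 ler01 (ltW s0)); lra.
  (* [quad_ge0] asks for every [s > 0], but [1 - s] must stay nonnegative; for [s > 1] the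
     inequality follows from the one at the origin of the ray. *)
  have [s1|s1] := leP s 1; first by have := H (1 - s) ltac:(by rewrite subr_ge0); lra.
  have H0 := H 0 (lexx _).
  have H1 : 0 <= s * (B - 2^-1 * A) by rewrite mulr_ge0 ?(ltW s0)//; lra.
  have H2 : 0 <= 2^-1 * A * (s * (s - 1)).
    by rewrite !mulr_ge0 ?invr_ge0// ?subr_ge0 ltW.
  by lra.
by apply/eqP; rewrite eq_le -subr_ge0 H2 -subr_ge0 H1.
Qed.

(** Total support 0 would make [p] nonpositive, so [<z, p> <= 0], whereas [minimiser_ray] would give
    [<z, p> = eps |p| > 0]. *)
Lemma total_support_minimiser_gt0 : nrm p != 0 -> 0 < total_support p.
Proof.
move=> pn0; rewrite lt_neqAle total_support_ge0// andbT eq_sym; apply/eqP => S0.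
have := minimiser_ray; rewrite S0 expr0n/= => /esym/eqP; rewrite subr_eq0 => /eqP zp.
have := inner_le0 p2 (total_support0_le0 p2 S0); rewrite zp leNgt => /negP; apply.
by rewrite mulr_gt0// lt_neqAle eq_sym pn0 nrm_ge0.
Qed.

End minimiser.

Lemma dual_minimiser_unique p q : L2 p -> L2 q ->
  (forall r, L2 r -> dual_cost p <= dual_cost r) ->
  (forall r, L2 r -> dual_cost q <= dual_cost r) -> q = p %[ae mu].
Proof.
have W p' q' : L2 p' -> L2 q' ->
  (forall r, L2 r -> dual_cost p' <= dual_cost r) ->
  (forall r, L2 r -> dual_cost q' <= dual_cost r) -> nrm p' != 0 -> q' = p' %[ae mu].
  move=> p2 q2 pmin qmin pn0; have p0 : 0 < nrm p' by rewrite lt_neqAle eq_sym pn0 nrm_ge0.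
  have pp := L2_scale 2^-1 p2; have qq := L2_scale 2^-1 q2.
  have h0 : 0 <= 2^-1 :> R by rewrite invr_ge0.
  have m2 := L2_midpoint p2 q2.
  have S1 : total_support (midpoint p' q') <= 2^-1 * total_support p' + 2^-1 * total_support q'.
    by apply: le_trans (total_supportD pp qq) _; rewrite !total_supportZ.
  have S0 := total_support_ge0 m2.
  have Sp := total_support_ge0 p2; have Sq := total_support_ge0 q2.
  (* The midpoint costs no less than either minimiser, while the other terms of the cost are convex.
     This forces the equality case of the triangle inequality and, below, of Cauchy-Schwarz. *)
  have N1 : nrm p' + nrm q' <= 2 * nrm (midpoint p' q').
    have := pmin _ m2; have := pmin _ q2; have := qmin _ p2.
    have zm : inner z (midpoint p' q') = 2^-1 * inner z p' + 2^-1 * inner z q'.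
      by rewrite /midpoint inner_linr// innerZr.
    rewrite /dual_cost zm.
    move: S1 S0 Sp Sq; move: (total_support (midpoint _ _)) (nrm (midpoint _ _)) => A N.
    move: (total_support p') (total_support q') => B C S1 S0 Sp Sq H1 H2 H3.
    have : A ^+ 2 <= 2^-1 * (B ^+ 2 + C ^+ 2).
      apply: (@le_trans _ _ ((2^-1 * B + 2^-1 * C) ^+ 2)).
        by rewrite ler_pXn2r// nnegrE// addr_ge0// mulr_ge0.
      have := sqr_ge0 (B - C); lra.
    move=> HA; rewrite -(ler_pM2l eps0); lra.
  have ipq : nrm p' * nrm q' <= inner p' q'.
    have := sqr_nrmD pp qq; rewrite -/(midpoint p' q') !nrmZ// innerZl// innerZr// ger0_norm//.
    have := nrm_ge0 mu q'; move: (nrm (midpoint _ _)) N1 (nrm_ge0 mu (midpoint p' q')) => N N1 N0 q0 E.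
    have : (nrm p' + nrm q') ^+ 2 <= (2 * N) ^+ 2.
      by rewrite ler_pXn2r// nnegrE ?mulr_ge0// addr_ge0// ltW.
    exact: midpoint_norm_inner E.
  pose c := nrm q' / nrm p'; have c0 : 0 <= c by rewrite divr_ge0 ?nrm_ge0.
  have cE : c * nrm p' = nrm q' by rewrite /c mulfVK.
  have qcp : q' = (fun x => c * p' x) %[ae mu].
    apply/(nrm_sub_eq0 q2 (L2_scale c p2)); apply/eqP; rewrite -sqrf_eq0 eq_le sqr_ge0 andbT.
    rewrite sqr_nrmB//; last exact: L2_scale.
    rewrite nrmZ// ger0_norm// cE innerZr// innerC.
    have := ler_wpM2l c0 ipq; rewrite [X in X <= _ -> _]mulrA cE -expr2.
    move: (nrm q' ^+ 2) (c * inner p' q') => x y xy.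
    by rewrite addrAC subr_le0 mulr_natl mulr2n lerD.
  have q2' := L2_scale c p2.
  have Jq : dual_cost (fun x => c * p' x) = dual_cost q'.
    exact/esym/dual_cost_ae.
  have ray := minimiser_ray p2 pmin.
  have Sp0 := total_support_minimiser_gt0 p2 pmin pn0.
  have c1 : c = 1.
    have := qmin _ p2; rewrite -Jq dual_costZ// -ray.
    rewrite {1}/dual_cost (_ : _ - _ + _ = 2^-1 * total_support p' ^+ 2 - (inner z p' - eps * nrm p')); last by ring.
    rewrite -ray; have Sp2 : 0 < total_support p' ^+ 2 by rewrite exprn_gt0.
    exact: ray_minimum.
  by apply: filterS qcp => x; rewrite c1 mul1r.
move=> p2 q2 pmin qmin; have [p0|] := eqVneq (nrm p) 0; last exact: W.
have [q0|qn0] := eqVneq (nrm q) 0.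
  have /nrm_eq0 -/(_ q2) q00 := q0; have /nrm_eq0 -/(_ p2) p00 := p0.
  by apply: filterS2 q00 p00 => x + + _ => /(_ Logic.I) -> /(_ Logic.I) ->.
have := W _ _ q2 p2 qmin pmin qn0.
by apply: filterS => x H _; rewrite H.
Qed.

End dual_problem.

(** * Strong duality and the optimal control *)

Section cylinder_measure_finite.
Context (dX : measure_display) (X : measurableType dX) (R : realType).
Variables (mu : {finite_measure set X -> \bar R}) (T : R).

Let cylinder_fin : fin_num_fun (cylinder_measure mu T).
Proof.
move=> U mU; rewrite ge0_fin_numE ?measure_ge0//.
apply: le_lt_trans (cylinder_measure_fin mu T); by apply: le_measure; rewrite ?inE.
Qed.

HB.instance Definition _ := Measure_isFinite.Build _ _ _ (cylinder_measure mu T) cylinder_fin.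

End cylinder_measure_finite.

Lemma sqre_le (R : realType) (x : \bar R) (m : R) : 0 <= m -> (x ^+ 2 <= (m ^+ 2)%:E)%E ->
  (x <= m%:E)%E.
Proof.
rewrite expe2; move=> m0; case: x => [r||] //=.
rewrite -EFinM -expr2 !lee_fin => H; rewrite (le_trans (ler_norm r))//.
by rewrite -(@ler_pXn2r _ 2)// ?nnegrE// real_normK ?num_real.
Qed.

Lemma L2_ae (dX : measure_display) (X : measurableType dX) (R : realType)
    (mu : {measure set X -> \bar R}) (f g : X -> R) :
  L2 mu f -> measurable_fun setT g -> {ae mu, forall x, f x = g x} -> L2 mu g.
Proof.
move=> /L2P[mf /integrableP[_ foo]] mg fg; apply/L2P; split => //.
apply/integrableP; split; first by apply/measurable_EFinP; exact: measurable_funX.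
apply: le_lt_trans foo; rewrite le_eqVlt; apply/orP; left; apply/eqP.
by apply: eq_integral_ae => //; apply: filterS fg => x /= ->.
Qed.

Lemma L2_ae_bounded (dX : measure_display) (X : measurableType dX) (R : realType)
    (mu : {finite_measure set X -> \bar R}) (f : X -> R) (m : R) :
  measurable_fun setT f -> {ae mu, forall x, `|f x| <= m} -> L2 mu f.
Proof.
move=> mf fm; pose c := `|m|.
have [||g2 _] := @L2_bounded _ _ _ mu (fun x => Num.max (- c) (Num.min c (f x))) c (normr_ge0 m).
- by apply: measurable_maxr => //; exact: measurable_minr.
- by move=> x; rewrite ler_norml le_max lexx/= ge_max ge_min lexx/= andbT lerNl; rewrite /c; have := normr_ge0 m; lra.
apply: L2_ae g2 mf _; apply: filterS fm => x fx.
have : `|f x| <= c by apply: le_trans fx _; exact: ler_norm.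
by rewrite ler_norml => /andP[? ?]; rewrite min_r// max_r.
Qed.

(** For [r >= 0], the level exceeds [r] exactly when some rational above [r] has level measure
    beyond the capacity; this condition bears on the measure of a section, which is measurable in
    [t]. *)
Lemma measurable_level (dX : measure_display) (X : measurableType dX) (R : realType)
    (mu : {finite_measure set X -> \bar R}) (L : R) (G : R * X -> R) :
  0 < L < 1 -> 0 < volume mu -> measurable_fun setT G ->
  measurable_fun setT (fun t : R => level mu L (fun x => G (t, x))).
Proof.
move=> hL hV mG.
have mGt (t : R) : measurable_fun setT (fun x => G (t, x)).
  exact: (measurableT_comp mG (measurable_pair1 _)).
apply: (measurability _ (RGenOInfty.measurableE R)) => _ [_ [r ->] <-].
rewrite setTI; have [r0|r0] := ltP r 0.
  rewrite (_ : _ @^-1` _ = setT)//; apply/seteqP; split => // t _.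
  by rewrite /= in_itv/= andbT (lt_le_trans r0)// level_ge0.
pose Q (q : rat) : set (measurableTypeR R) := if r < ratr q
  then [set t | (capacity mu L)%:E < level_measure mu (fun x => G (t, x)) (ratr q)]%E else set0.
rewrite (_ : _ @^-1` _ = \bigcup_q Q q).
  apply: countable_bigcupT_measurable; first exact: countableP.
  move=> q; rewrite /Q; case: ifPn => // _.
  have mE : measurable [set z | ratr q < G z] by exact: measurable_superlevel.
  have := measurable_fun_xsection mu mE.
  move=> /(_ measurableT `](capacity mu L)%:E, +oo[%classic (emeasurable_itv _)).
  rewrite setTI; congr measurable; apply/seteqP; split => t /=;
    rewrite in_itv/= andbT /level_measure; rewrite (_ : xsection _ _ = [set x | ratr q < G (t, x)])//;
    by apply/seteqP; split => x; rewrite /xsection/= inE.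
apply/seteqP; split => t /=.
  rewrite in_itv/= andbT /level lt_max ltNge r0/= => /rat_in_itvoo[q].
  rewrite in_itv/= => /andP[rq qi]; exists q => //; rewrite /Q rq /=.
  exact: (lt_level_inverse hL hV).
move=> [q _]; rewrite /Q; case: ifPn => // rq /= kq; rewrite in_itv/= andbT.
apply: (lt_le_trans rq); rewrite /level le_max; apply/orP; right.
exact: (le_level_inverse hL hV).
Qed.

(** [J p <= J (p + s q)] divided by [s]: [A] and [B] are the total supports, [r] the difference
    quotient of an upper bound, [N] and [N'] the norms. The new norm is bounded by the tangent of
    the square root, that is [2 N N' <= N^2 + N'^2]. *)
Lemma descent_quotient (R : realFieldType) (A B s r zq zp N N' i Q e : R) :
  0 < s -> 0 < N -> 0 <= e -> 0 <= B -> B <= A + s * r ->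
  N' ^+ 2 = s ^+ 2 * Q + 2 * s * i + N ^+ 2 ->
  2^-1 * A ^+ 2 - zp + e * N <= 2^-1 * B ^+ 2 - (s * zq + zp) + e * N' ->
  0 <= 2^-1 * (r * (2 * A + s * r)) - zq + e * (i / N + s * (Q / (2 * N))).
Proof.
move=> s0 N0 e0 B0 BA.
have -> : i = (i / N) * N by rewrite mulfVK// gt_eqF.
have -> : Q = 2 * (Q / (2 * N)) * N by field; rewrite gt_eqF.
rewrite mulfK ?gt_eqF//; move: (i / N) (Q / (2 * N)) => a b N'E H.
have -> : 2 * b * N / (2 * N) = b by field; rewrite gt_eqF.
have N'N : N' <= N + s * a + s ^+ 2 * b.
  rewrite -(ler_pM2l (_ : 0 < 2 * N)); last by rewrite mulr_gt0.
  have := sqr_ge0 (N' - N); lra.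
have BB : B ^+ 2 <= (A + s * r) ^+ 2 by rewrite ler_pXn2r// nnegrE// (le_trans B0).
have := ler_wpM2l e0 N'N; rewrite -(pmulr_rge0 _ s0); lra.
Qed.

Section control_problem.
Context (dX : measure_display) (X : measurableType dX) (R : realType).
Variables (mu : {finite_measure set X -> \bar R}) (L T eps : R).
Hypotheses (hL : 0 < L < 1) (T0 : 0 < T) (eps0 : 0 < eps).
Variable S : R -> (X -> R) -> (X -> R).
Hypothesis hS : C0_semigroup mu S.
Local Notation L2mu := (L2 mu).
Local Notation inner := (Defs.inner mu).
Local Notation nnu := (nrm (cylinder_measure mu T)).
Local Notation nrm := (nrm mu).
Local Notation nu := (cylinder_measure mu T).
Local Notation leb := (@lebesgue_measure R).
Local Notation Iv := (`]0, T[%classic : set (measurableTypeR R)).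
Local Notation state := (adjoint_state mu T S).
Local Notation sv := (support_value mu L).
Local Notation slice u t := (fun x => u (t, x)).
Implicit Types (p q f : X -> R) (s t a m : R) (u G : R * X -> R).

Let mI : measurable Iv. Proof. exact: measurable_itv. Qed.

Let lI : (leb Iv < +oo)%E.
Proof. by rewrite lebesgue_measure_itv/= lte_fin T0 -EFinB ltry. Qed.

Let It t : Iv t -> 0 <= t <= T.
Proof. by rewrite /= in_itv/= => /andP[/ltW -> /ltW ->]. Qed.

(** The states are chosen separately at each time; a version is jointly measurable and agrees with
    them at almost every time, which is what Fubini needs. *)
Definition state_version q G := measurable_fun setT G /\
  {ae leb, forall t, Iv t -> {ae mu, forall x, state q t x = G (t, x)}}.

Lemma measurable_slice u t : measurable_fun setT u -> measurable_fun setT (slice u t).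
Proof. by move=> m_u; exact: (measurableT_comp m_u (measurable_pair1 _)). Qed.

Lemma state_version_L2 : exists2 K : R, 0 <= K & forall q G, L2mu q -> state_version q G ->
  L2 nu G /\ nnu G <= K * nrm q.
Proof.
have [M M0 HM] := adjoint_state_nrm T hS.
exists (M * Num.sqrt T); first by rewrite mulr_ge0// sqrtr_ge0.
move=> q G q2 [mG EG].
have [||G2 Gn] := @cylinder_L2_bound _ _ _ mu T T0 G (M * nrm q) mG.
- by rewrite mulr_ge0 ?nrm_ge0.
- apply: (ae_filter1 EG) => t H tI; have st2 := adjoint_state_L2 hS q2 (It tI).
  have Gt2 : L2mu (slice G t).
    by apply: L2_ae st2 (measurable_slice t mG) (H tI).
  split => //; rewrite -(nrm_ae st2 Gt2); first exact: HM (It tI).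
  by apply: filterS (H tI) => x.
by split => //; rewrite mulrAC.
Qed.

Lemma state_version_lin a p q G H : L2mu p -> L2mu q -> state_version p G -> state_version q H ->
  state_version (fun x => a * p x + q x) (fun z => a * G z + H z).
Proof.
move=> p2 q2 [mG EG] [mH EH]; split.
  by apply: measurable_funD => //; exact: measurable_funM.
apply: (ae_filter2 EG EH) => t H1 H2 tI.
have := adjoint_state_lin hS a p2 q2 (It tI).
by apply: filterS3 (H1 tI) (H2 tI) => x -> -> /(_ Logic.I).
Qed.

Definition control_pairing u q :=
  \int[leb]_(t in Iv) inner (S (T - t) (at_time mu u t)) q.

Lemma at_time_L2 u t : L2mu (at_time mu u t).
Proof. by rewrite /at_time; case: asboolP => // _; exact: L2_cst0. Qed.

Lemma control_pairing_ae u q G : L2 nu u -> L2mu q -> state_version q G ->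
  {ae leb, forall t, Iv t -> inner (S (T - t) (at_time mu u t)) q = inner (slice u t) (slice G t)
    /\ inner (slice u t) (slice G t) = inner (slice u t) (state q t)}.
Proof.
move=> u2 q2 [mG EG]; apply: (ae_filter2 (cylinder_L2_slices u2) EG) => t H1 H2 tI.
have ut2 := H1 tI; have [st2 sE] := adjoint_stateP hS q2 (It tI).
have Gt2 : L2mu (slice G t) by apply: L2_ae st2 (measurable_slice t mG) (H2 tI).
have E : inner (slice u t) (slice G t) = inner (slice u t) (state q t).
  rewrite innerC [RHS]innerC; apply: inner_ae => //.
  by apply: filterS (H2 tI) => x -> .
by rewrite sE; [rewrite E /at_time; case: asboolP|exact: at_time_L2].
Qed.

Lemma control_pairingE u q G : L2 nu u -> L2mu q -> state_version q G ->
  control_pairing u q = Defs.inner nu u G.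
Proof.
move=> u2 q2 vG; have [K _ HK] := state_version_L2; have [G2 _] := HK q G q2 vG.
have [_ ->] := cylinder_inner u2 G2; apply: eq_Rintegral_ae => //.
by apply: (ae_filter1 (control_pairing_ae u2 q2 vG)) => t H /H[].
Qed.

Hypothesis version : forall q, L2mu q -> exists G, state_version q G.

(** The weak integral in [control_map] exists by Riesz representation: through versions, the pairing
    is an inner product on the cylinder, hence linear and bounded in [q]. *)
Lemma control_mapP u : L2 nu u -> L2mu (control_map mu T S u) /\
  forall q, L2mu q -> inner (control_map mu T S u) q = control_pairing u q.
Proof.
move=> u2; rewrite /control_map.
set P := [set w | _ /\ _].
have [K K0 HK] := state_version_L2.
have [|q q2|w w2 wE] := @riesz _ _ _ mu (control_pairing u) (nnu u * K).
- move=> a f g f2 g2; have [G vG] := version f2; have [H vH] := version g2.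
  have [G2 _] := HK _ _ f2 vG; have [H2 _] := HK _ _ g2 vH.
  rewrite (control_pairingE u2 f2 vG) (control_pairingE u2 g2 vH).
  rewrite (control_pairingE u2 (L2_lin a f2 g2) (state_version_lin a f2 g2 vG vH)).
  exact: inner_linr.
- have [G vG] := version q2; have [G2 GK] := HK _ _ q2 vG.
  rewrite (control_pairingE u2 q2 vG); apply: (le_trans (normr_inner_le u2 G2)).
  by rewrite -mulrA ler_wpM2l// nrm_ge0.
have : P (xget (fun=> 0) P).
  apply: xgetPex; exists w; split => // q q2; by rewrite innerC -(wE _ q2).
by case.
Qed.

Lemma cost_le u m : 0 <= m -> measurable_fun setT u ->
  {ae leb, forall t, Iv t -> {ae mu, forall x, 0 <= u (t, x) <= m} /\
     \int[mu]_x u (t, x) <= m * capacity mu L} ->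
  (cost mu L T u <= (2^-1 * m ^+ 2)%:E)%E.
Proof.
move=> m0 m_u H; rewrite /cost /convex_indicator.
have u0 : {ae nu, forall z, 0 <= u z}.
  apply: ae_cylinder => //.
    rewrite (_ : [set z | _] = [set z | 0 < - u z]).
      by apply: measurable_superlevel; exact: measurableT_comp.
    by apply/seteqP; split => z /=; rewrite oppr_gt0 ltNge => /negP.
  apply: (ae_filter1 H) => t Ht tI; have [H1 _] := Ht tI.
  by apply: filterS H1 => x /andP[].
case: asboolP => // _; rewrite adde0 EFinM lee_wpmul2l// ?lee_fin ?invr_ge0//.
apply/ess_supP; apply/(@ae_mrestr _ _ _ leb Iv mI).
apply: (ae_filter1 H) => t Ht tI; have [um ui] := Ht tI.
have mut := measurable_slice t m_u.
set A := maxe _ _.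
have A0 : (0 <= A)%E by rewrite le_max Lnorm_ge0.
suff Am : (A <= m%:E)%E.
  by rewrite expr2 EFinM expe2; apply: lee_pmul.
rewrite ge_max; apply/andP; split.
  rewrite /Lp_norm unlock; case: ifPn => // mu0.
  apply/ess_supP; apply: filterS um => x /andP[ux0 uxm].
  by rewrite /= lee_fin ger0_norm.
rewrite /Lp_norm Lnorm1.
have iu : mu.-integrable setT (EFin \o slice u t).
  apply: L2_integrable; apply: (L2_ae_bounded (m := m)) => //.
  by apply: filterS um => x /andP[? ?]; rewrite ger0_norm.
have -> : (\int[mu]_x `|(EFin \o slice u t) x| = (\int[mu]_x u (t, x))%:E)%E.
  rewrite -Rintegral_fine//; apply: ae_eq_integral => //.
  - by apply: measurableT_comp => //; exact/measurable_EFinP.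
  - exact/measurable_EFinP.
  - by apply: filterS um => x /andP[? ?] _; rewrite /= ger0_norm.
rewrite -EFinM lee_fin.
(* On a null space the inverse in the cost is [0] by convention, and so is the L^1 term. *)
have [k0|k0] := eqVneq (L * volume mu) 0; first by rewrite k0 invr0 mulr0.
rewrite ler_pdivrMr// lt_neqAle eq_sym k0; exact: capacity_ge0.
Qed.

Lemma ess_sup_cost_ge0 u : (0 <= ess_sup (time_measure T) (fun t =>
  maxe (Lp_norm mu +oo (slice u t)) (Lp_norm mu 1 (slice u t) * ((L * volume mu)^-1)%:E) ^+ 2))%E.
Proof.
apply: ess_sup_gee.
  apply: (@lt_le_trans _ _ T%:E); first by rewrite lte_fin.
  rewrite le_eqVlt; apply/orP; left; apply/eqP/esym.
  transitivity (leb Iv); first by rewrite -[in RHS](setTI Iv).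
  by rewrite lebesgue_measure_itv/= lte_fin T0 -EFinB subr0.
by apply: aeW => t; rewrite expe2 mule_ge0// le_max Lnorm_ge0.
Qed.

Lemma cost_ge0 u : (0 <= cost mu L T u)%E.
Proof.
rewrite /cost adde_ge0//; last by rewrite /convex_indicator; case: ifP.
by rewrite mule_ge0 ?lee_fin ?invr_ge0//; exact: ess_sup_cost_ge0.
Qed.

Lemma cost_slices u m : 0 <= m -> L2 nu u -> (cost mu L T u <= (2^-1 * m ^+ 2)%:E)%E ->
  {ae leb, forall t, Iv t -> [/\ L2mu (slice u t), {ae mu, forall x, 0 <= u (t, x) <= m} &
     \int[mu]_x u (t, x) <= m * capacity mu L]}.
Proof.
move=> m0 u2; have E0 := ess_sup_cost_ge0 u.
rewrite /cost /convex_indicator; case: asboolP => [u0|_]; last first.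
  rewrite addey ?leye_eq// gt_eqF// (@lt_le_trans _ _ 0%E)//.
  by rewrite mule_ge0 ?lee_fin ?invr_ge0.
rewrite adde0 EFinM lee_pmul2l ?lte_fin ?invr_gt0// => /ess_supP Em.
have {}Em := (@ae_mrestr _ _ _ leb Iv mI _).1 Em.
apply: (ae_filter2 (ae_filter2 Em (cylinder_L2_slices u2) (fun t H1 H2 => conj H1 H2))
  (ae_cylinder_slices u0)) => t [H1 H2] H3 tI.
have ut2 := H2 tI; have u0t := H3 tI.
have /(sqre_le m0) := H1 tI; rewrite ge_max => /andP[Noo N1].
split => //.
- move: Noo; rewrite /Lp_norm unlock; case: ifPn => [mu0|mu0 _].
    move=> /ess_supP um; apply: filterS2 u0t um => x ux0.
    by rewrite /= lee_fin ger0_norm// ux0 => ->.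
  have : mu setT = 0%E by apply/eqP; rewrite eq_le measure_ge0 andbT leNgt.
  by move=> mu00; exists setT; split.
- have iu := L2_integrable ut2.
  have E : Lp_norm mu 1 (slice u t) = (\int[mu]_x u (t, x))%:E.
    rewrite /Lp_norm Lnorm1 -Rintegral_fine//.
    have mut := integrable_Rmeasurable iu.
    apply: ae_eq_integral => //.
    + by apply: measurableT_comp => //; exact/measurable_EFinP.
    + exact/measurable_EFinP.
    + by apply: filterS u0t => x ux0 _; rewrite /= ger0_norm.
  move: N1; rewrite E -EFinM lee_fin.
  (* With inverse [0] the cost says nothing about the integral, but on a null space every integral
     is 0. *)
  have [k0|k0] := eqVneq (L * volume mu) 0; last first.
    by rewrite ler_pdivrMr// lt_neqAle eq_sym k0; exact: capacity_ge0.
  move=> _; rewrite /capacity k0 mulr0.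
  have /eqP : volume mu = 0.
    by move/eqP: k0; rewrite mulf_eq0 gt_eqF ?orFb//=; [move/eqP|case/andP: hL].
  rewrite -eqe fineK ?fin_num_measure// => /eqP mu00.
  rewrite (_ : Rintegral _ _ _ = 0)//.
  transitivity (\int[mu]_x (cst 0 x : R)); last by rewrite /Rintegral integral0.
  by apply: eq_Rintegral_ae => //; exists setT.
Qed.

Lemma pairing_le u q m : 0 <= m -> L2 nu u -> L2mu q ->
  (cost mu L T u <= (2^-1 * m ^+ 2)%:E)%E ->
  control_pairing u q <= m * total_support mu L T S q /\
  (m * total_support mu L T S q <= control_pairing u q ->
   {ae leb, forall t, Iv t -> inner (slice u t) (state q t) = m * sv (state q t)}).
Proof.
move=> m0 u2 q2 uc; have [G vG] := version q2.
have [K _ HK] := state_version_L2; have [G2 _] := HK q G q2 vG.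
have [iuG uGE] := cylinder_inner u2 G2.
have isv := integrable_support_state hL T0 hS q2.
have ims : leb.-integrable Iv (EFin \o (fun t => m * sv (state q t))).
  apply: (@eq_integrable _ _ _ leb _ mI _ _ _ (integrableZl mI m isv)).
  by move=> t _; rewrite /= EFinM.
have le : {ae leb, forall t, Iv t -> inner (slice u t) (slice G t) <= m * sv (state q t)}.
  apply: (ae_filter2 (control_pairing_ae u2 q2 vG) (cost_slices m0 u2 uc)) => t H1 H2 tI.
  have [_ ->] := H1 tI; have [ut2 um ui] := H2 tI.
  by apply: inner_le_support_value => //; exact: adjoint_state_L2 (It tI).
have E : m * total_support mu L T S q = \int[leb]_(t in Iv) (m * sv (state q t)).
  by rewrite RintegralZl.
rewrite (control_pairingE u2 q2 vG) uGE E; split; first exact: le_Rintegral_ae.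
move=> /(le_Rintegral_eq mI iuG ims le) H.
apply: (ae_filter2 H (control_pairing_ae u2 q2 vG)) => t H1 H2 tI.
by rewrite -H1//; have [_ ->] := H2 tI.
Qed.

Lemma volume_gt0 p : L2mu p -> nrm p != 0 -> 0 < volume mu.
Proof.
move=> p2 /eqP pn0; rewrite lt_neqAle volume_ge0 andbT eq_sym; apply/eqP => V0; apply: pn0.
have /eqP := V0; rewrite -eqe fineK ?fin_num_measure// => /eqP mu0.
by apply/(nrm_eq0 p2); exists setT.
Qed.

(** * The Euler equation at a nonzero dual minimiser *)

Section optimality.
Variables (z p : X -> R).
Hypotheses (z2 : L2mu z) (p2 : L2mu p).
Local Notation Sigma := (total_support mu L T S).
Local Notation J := (dual_cost mu L T eps S z).
Hypothesis pmin : forall q, L2mu q -> J p <= J q.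
Hypothesis pn0 : nrm p != 0.
Hypothesis null_levels : {ae leb, forall t, Iv t -> forall c, mu [set x | state p t x = c] = 0%E}.
Variable G : R * X -> R.
Hypothesis vG : state_version p G.

Let mG : measurable_fun setT G. Proof. by have [] := vG. Qed.

Let hV : 0 < volume mu. Proof. exact: volume_gt0 pn0. Qed.

Let k0 : 0 < capacity mu L.
Proof. by rewrite /capacity mulr_gt0//; case/andP: hL. Qed.

(** [level * capacity] is a summand in [support_valueE], the other one being nonnegative; so it is
    at most the support value, which is bounded in time. *)
Let exC : exists C : R, 0 <= C /\ {ae leb, forall t, Iv t -> level mu L (state p t) <= C}.
Proof.
have [K K0 HK] := support_state_le T hL hS.
exists (K * nrm p / capacity mu L); split.
  apply: divr_ge0; first by rewrite mulr_ge0 ?nrm_ge0.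
  exact: ltW.
apply: (ae_filter1 null_levels) => t nl tI; have st2 := adjoint_state_L2 hS p2 (It tI).
rewrite ler_pdivlMr//; apply: le_trans (HK p t p2 (It tI)).
rewrite (support_valueE hL hV st2 (nl tI)) lerDr.
by apply: Rintegral_ge0 => x _; rewrite le_max lexx.
Qed.

Let C := projT1 (cid exC).

(* [C] bounds the level at almost every time; the truncation makes [time_level]
   integrable without a hypothesis at the exceptional times. *)
Definition time_level t := Num.min C (level mu L (slice G t)).
Local Notation h := time_level.

Let mh : measurable_fun setT h.
Proof. by apply: measurable_minr => //; exact: (measurable_level hL hV mG). Qed.

Let h0 t : 0 <= h t.
Proof. by rewrite le_min level_ge0 andbT; have [] := projT2 (cid exC). Qed.

Lemma time_levelP : {ae leb, forall t, Iv t -> [/\ {ae mu, forall x, state p t x = G (t, x)},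
  h t = level mu L (state p t) & forall c, mu [set x | state p t x = c] = 0%E]}.
Proof.
have [_ HC] := projT2 (cid exC); have [_ EG] := vG.
apply: (ae_filter2 HC (ae_filter2 EG null_levels (fun t H1 H2 => conj H1 H2))) => t H1 [H2 H3] tI.
split; [exact: H2| |exact: H3].
have st2 := adjoint_state_L2 hS p2 (It tI).
rewrite /h -(level_ae L (L2_measurable st2) (measurable_slice t mG) (H2 tI)).
by rewrite min_r// H1.
Qed.

Let h_integrable : leb.-integrable Iv (EFin \o h).
Proof.
apply: measurable_bounded_integrable => //.
- exact: measurable_funTS.
- exists C; split; first by rewrite num_real.
  by move=> y Cy t _; rewrite /= ger0_norm// (le_trans _ (ltW Cy))// ge_min lexx.
Qed.

Definition active_set : set (R * X) := [set z | 0 < G z - h z.1].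

Let mA : measurable active_set.
Proof.
apply: measurable_superlevel; apply: measurable_funB => //.
by apply: (measurableT_comp mh); exact: measurable_fst.
Qed.

Let G2 : L2 nu G.
Proof. by have [K _ HK] := state_version_L2; have [] := HK p G p2 vG. Qed.

Section direction.
Variables (q : X -> R) (H : R * X -> R).
Hypotheses (q2 : L2mu q) (vH : state_version q H).

Let mH : measurable_fun setT H. Proof. by have [] := vH. Qed.

Let H2 : L2 nu H.
Proof. by have [K _ HK] := state_version_L2; have [] := HK q H q2 vH. Qed.

Let excess s (z : R * X) : R := Num.max 0 (s * H z + G z - h z.1).

Let excess_integrable s : nu.-integrable setT (EFin \o excess s).
Proof.
have i1 := L2_integrable (L2_abs (L2_lin s H2 G2)).
apply: (le_integrable measurableT _ _ i1).
  apply/measurable_EFinP; apply: measurable_maxr => //; apply: measurable_funB.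
    by apply: measurable_funD => //; exact: measurable_funM.
  by apply: (measurableT_comp mh); exact: measurable_fst.
move=> y _; rewrite /= lee_fin normr_id ger0_norm ?le_max ?lexx//.
rewrite ge_max normr_ge0/= lerBlDr (le_trans (ler_norm _))// lerDl; exact: h0.
Qed.

(** The level of [p + s q] need not be differentiable in [s]. Here [bathtub_le] is applied with the
    level of [p] frozen, which leaves only a positive part to differentiate. *)
Let bound s := \int[nu]_z excess s z + capacity mu L * \int[leb]_(t in Iv) h t.

Let boundE s : leb.-integrable Iv (EFin \o (fun t => \int[mu]_x excess s (t, x) + h t * capacity mu L))
  /\ bound s = \int[leb]_(t in Iv) (\int[mu]_x excess s (t, x) + h t * capacity mu L).
Proof.
have [i1 E _] := cylinder_slices (excess_integrable s).
have ih : leb.-integrable Iv (EFin \o (fun t => h t * capacity mu L)).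
  apply: (@eq_integrable _ _ _ leb _ mI _ _ _ (integrableZl mI (capacity mu L) h_integrable)).
  by move=> t _; rewrite /= EFinM muleC.
split.
  apply: (@eq_integrable _ _ _ leb _ mI _ _ _ (integrableD mI i1 ih)).
  by move=> t _; rewrite /= EFinD.
rewrite RintegralD; [|exact: mI|exact: i1|exact: ih].
rewrite RintegralZr; [|exact: mI|exact: h_integrable].
by rewrite /bound E mulrC.
Qed.

Let total_support_bound s : Sigma (fun x => s * q x + p x) <= bound s.
Proof.
have [ib ->] := boundE s; have [_ EH] := vH.
apply: le_Rintegral_ae => //.
  by apply: integrable_support_state => //; exact: L2_lin.
apply: (ae_filter2 time_levelP EH) => t H1 H3 tI; have [Gt ht _] := H1 tI.
have l2 := L2_lin s q2 p2; have st2 := adjoint_state_L2 hS l2 (It tI).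
have lin := adjoint_state_lin hS s q2 p2 (It tI).
apply: support_value_le => // u Uu; apply: (le_trans (bathtub_le st2 Uu (h0 t))).
rewrite lerD2r le_eqVlt; apply/orP; left; apply/eqP; apply: eq_Rintegral_ae => //.
by apply: filterS3 lin Gt (H3 tI) => x -> // -> -> _.
Qed.

Let total_support_bound0 : Sigma p = bound 0.
Proof.
have [ib ->] := boundE 0; apply: eq_Rintegral_ae => //.
apply: (ae_filter1 time_levelP) => t H1 tI; have [Gt ht nl] := H1 tI.
have st2 := adjoint_state_L2 hS p2 (It tI).
rewrite (support_valueE hL hV st2 nl) -ht; congr (_ + _); apply: eq_Rintegral_ae => //.
by apply: filterS Gt => x -> _; rewrite /excess mul0r add0r.
Qed.

Let quotient n (z : R * X) : R := n.+1%:R * (excess n.+1%:R^-1 z - excess 0 z).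

(** The contact set [G = h] is where the positive part fails to be differentiable; at almost every
    time its slice is, up to a null set, a level set of the state. *)
Let excess_contact : {ae nu, forall z, G z - h z.1 <> 0}.
Proof.
apply: ae_cylinder.
  rewrite (_ : [set z | _] = (fun z => G z - h z.1) @^-1` [set 0]).
    rewrite -[X in measurable X]setTI.
    have mGh : measurable_fun setT (fun z : R * X => G z - h z.1).
      by apply: measurable_funB => //; apply: (measurableT_comp mh); exact: measurable_fst.
    exact: (mGh measurableT _ (measurable_set1 0)).
  by apply/seteqP; split => y /=; [exact: contrapT|move=> -> ].
apply: (ae_filter1 time_levelP) => t H1 tI; have [Gt ht nl] := H1 tI.
have nl' : {ae mu, forall x, state p t x <> h t}.
  exists [set x | state p t x = h t]; split => //; last by move=> x /= /contrapT.
  have := L2_measurable (adjoint_state_L2 hS p2 (It tI)).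
  by move=> mst; rewrite -[X in measurable X]setTI; exact: (mst measurableT _ (measurable_set1 (h t))).
apply: (ae_filter2 Gt nl') => x Gx nx /= /eqP; rewrite subr_eq0 -Gx => /eqP; exact: nx.
Qed.

(** Off the contact set, [s H + G - h] has the sign of [G - h] for small [s], so the quotients are
    eventually constant in [n], equal to [H] or 0. They are dominated by [|H|], the positive part
    being 1-Lipschitz. *)
Let quotient_cvg : \int[nu]_z quotient n z @[n --> \oo] --> \int[nu]_z (\1_active_set z * H z).
Proof.
have iH := L2_integrable (L2_abs H2).
have mex s : measurable_fun setT (excess s) := integrable_Rmeasurable (excess_integrable s).
have [||||_ c] := @Rdominated_cvg _ _ _ nu setT quotient (fun z => \1_active_set z * H z)
    (fun z => `|H z|) measurableT _ _ _ iH.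
- by move=> n; apply: measurable_funM => //; apply: measurable_funB; exact: mex.
- by apply: measurable_funM => //; exact: measurable_indic.
- apply: (ae_filter1 excess_contact) => y Gy _.
  have cH : (fun n : nat => n.+1%:R^-1 * H y) @ \oo --> 0 * H y.
    by apply: cvgM; [exact: cvg_harmonic|exact: cvg_cst].
  rewrite mul0r in cH.
  have d0 : 0 < `|G y - h y.1| by rewrite normr_gt0; exact/eqP.
  have nr : \forall n \near \oo, `|n.+1%:R^-1 * H y| < `|G y - h y.1|.
    have /cvgrPdist_lt /(_ _ d0) := cH; apply: filterS => n.
    by rewrite sub0r normrN.
  apply: cvg_near_cst; apply: filterS nr => n Hn.
  have [a aE] : exists a, a = n.+1%:R^-1 * H y by exists (n.+1%:R^-1 * H y).
  rewrite /quotient /excess mul0r add0r indicE /active_set -aE.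
  have Ha : n.+1%:R * a = H y by rewrite aE mulrA divff ?mul1r// pnatr_eq0.
  rewrite -aE in Hn; clear aE; move: Gy Hn {cH d0}; rewrite -addrA.
  rewrite (_ : (y \in _) = (0 < G y - h y.1)); last by rewrite mem_setE.
  move: (G y - h y.1) => b b0 Hn; have [bp|bn] := ltP 0 b.
    move: Hn; rewrite (gtr0_norm bp) ltr_norml => /andP[Hn _].
    rewrite max_r; last by lra.
    by rewrite addrK Ha mul1r.
  have {}bn : b < 0 by rewrite lt_neqAle bn andbT; exact/eqP.
  move: Hn; rewrite (ltr0_norm bn) ltr_norml => /andP[_ Hn].
  rewrite max_l; last by lra.
  by rewrite subrr mulr0 mul0r.
- apply: nearW => y n _; rewrite /quotient normrM gtr0_norm// -ler_pdivlMl//.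
  have -> : n.+1%:R^-1 * `|H y| = `|n.+1%:R^-1 * H y| by rewrite normrM gtr0_norm.
  rewrite /excess mul0r add0r -addrA; move: (n.+1%:R^-1 * H y) (G y - h y.1) => a b.
  case: (leP 0 (a + b)) => ab; case: (leP 0 b) => b0; rewrite ?subr0 ?subrr ?normr0//.
  + by rewrite addrK.
  + by rewrite ger0_norm// (le_trans _ (ler_norm a))//; lra.
  + by rewrite sub0r normrN ger0_norm// -normrN (le_trans _ (ler_norm (- a)))//; lra.
exact: c.
Qed.

Lemma optimality_direction :
  0 <= Sigma p * \int[nu]_z (\1_active_set z * H z) - inner z q + eps * (inner p q / nrm p).
Proof.
have p0 : 0 < nrm p by rewrite lt_neqAle eq_sym pn0 nrm_ge0.
pose r n := \int[nu]_z quotient n z.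
have rE n : bound n.+1%:R^-1 = Sigma p + n.+1%:R^-1 * r n.
  rewrite total_support_bound0 /r /quotient RintegralZl//; last first.
    by apply: integrable_subR.
  rewrite mulrA mulVf ?pnatr_eq0// mul1r RintegralB// /bound; ring.
have c1 : (fun n : nat => n.+1%:R^-1 : R) @ \oo --> (0 : R) by exact: cvg_harmonic.
have c : (fun n => 2^-1 * (r n * (2 * Sigma p + n.+1%:R^-1 * r n)) - inner z q +
    eps * (inner p q / nrm p + n.+1%:R^-1 * (nrm q ^+ 2 / (2 * nrm p)))) @ \oo -->
  2^-1 * (\int[nu]_z (\1_active_set z * H z) * (2 * Sigma p + 0 * \int[nu]_z (\1_active_set z * H z))) -
    inner z q + eps * (inner p q / nrm p + 0 * (nrm q ^+ 2 / (2 * nrm p))).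
  apply: cvgD; last first.
    apply: cvgM; first exact: cvg_cst.
    by apply: cvgD; [exact: cvg_cst|apply: cvgM => //; exact: cvg_cst].
  apply: cvgB; last exact: cvg_cst.
  apply: cvgM; first exact: cvg_cst.
  apply: cvgM; first exact: quotient_cvg.
  apply: cvgD; first exact: cvg_cst.
  by apply: cvgM => //; exact: quotient_cvg.
have H0 n : 0 <= 2^-1 * (r n * (2 * Sigma p + n.+1%:R^-1 * r n)) - inner z q +
    eps * (inner p q / nrm p + n.+1%:R^-1 * (nrm q ^+ 2 / (2 * nrm p))).
  have s0 : 0 < n.+1%:R^-1 :> R by [].
  move: (n.+1%:R^-1) s0 (rE n) => s s0 bE.
  have l2 := L2_lin s q2 p2.
  apply: (@descent_quotient _ _ (Sigma (fun x => s * q x + p x)) _ _ _ (inner z p) _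
    (nrm (fun x => s * q x + p x))) => //.
  - exact: ltW.
  - exact: total_support_ge0.
  - by rewrite -bE; exact: total_support_bound.
  - rewrite sqr_nrmD//; last exact: L2_scale.
    by rewrite nrmZ// exprMn real_normK ?num_real// innerZl// innerC mulrA.
  - by have := pmin l2; rewrite /dual_cost inner_linr.
apply: (le_trans (cvgr_to_ge c (nearW _ H0))).
rewrite le_eqVlt; apply/orP; left; apply/eqP; field.
exact: pn0.
Qed.

End direction.

Lemma optimality q H : L2mu q -> state_version q H ->
  Sigma p * \int[nu]_z (\1_active_set z * H z) = inner z q - eps * (inner p q / nrm p).
Proof.
move=> q2 vH; have H1 := optimality_direction q2 vH.
(* [- q] is written [-2 q + q] to fit the shape [a f + g] of the linearity lemmas. *)
have nq2 := L2_lin (- 2) q2 q2; have vnH := state_version_lin (- 2) q2 q2 vH vH.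
have [K _ HK] := state_version_L2; have [H2 _] := HK q H q2 vH.
have := optimality_direction nq2 vnH; rewrite !inner_linr//.
have -> : \int[nu]_z (\1_active_set z * (- 2 * H z + H z)) =
    - (\int[nu]_z (\1_active_set z * H z)).
  transitivity (\int[nu]_z (-1 * (\1_active_set z * H z))).
    by apply: eq_Rintegral => y _; ring.
  rewrite RintegralZl ?mulN1r//.
  apply: (le_integrable measurableT _ _ (L2_integrable (L2_abs H2))).
    apply/measurable_EFinP; apply: measurable_funM; first exact: measurable_indic.
    exact: L2_measurable H2.
  move=> y _; rewrite /= lee_fin normr_id normrM ler_piMl// indicE.
  by case: (_ \in _); rewrite ?normr1 ?normr0.
move: (\int[nu]_z (\1_active_set z * H z)) H1 => D H1 H3.
move: (Sigma p) (inner z q) (inner p q) (nrm p) H1 H3 pn0 => s a b n H1 H3 n0.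
apply/eqP; rewrite eq_le; apply/andP; split; last by lra.
have E : (- 2 * b + b) / n = - (b / n) by field.
by move: H3; rewrite E; lra.
Qed.

Definition optimal_control (y : R * X) : R := Sigma p * \1_active_set y.

Let M0 : 0 <= Sigma p. Proof. exact: total_support_ge0. Qed.

Lemma active_setE : {ae leb, forall t, Iv t -> {ae mu, forall x,
  \1_active_set (t, x) = \1_(superlevel mu L (state p t)) x :> R}}.
Proof.
apply: (ae_filter1 time_levelP) => t H tI; have [Gt ht _] := H tI.
apply: filterS Gt => x Gx; rewrite !indicE; congr (_%:R); congr nat_of_bool.
by apply/idP/idP; rewrite !inE /active_set /superlevel /= subr_gt0 -ht Gx.
Qed.

Let measurable_optimal_control : measurable_fun setT optimal_control.
Proof. by apply: measurable_funM => //; exact: measurable_indic mA. Qed.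

Lemma optimal_control_L2 : L2 nu optimal_control.
Proof.
apply: (L2_ae_bounded (m := Sigma p)) => //; apply: nearW => y.
rewrite /optimal_control indicE; case: (_ \in _); rewrite ?mulr1 ?mulr0 ?normr0//.
by rewrite ger0_norm.
Qed.

Lemma optimal_control_cost : (cost mu L T optimal_control <= (2^-1 * Sigma p ^+ 2)%:E)%E.
Proof.
apply: cost_le => //; apply: (ae_filter2 active_setE time_levelP) => t H1 H2 tI.
have At := H1 tI; have [_ _ nl] := H2 tI.
split.
  apply: nearW => x; rewrite /optimal_control indicE.
  by case: (_ \in _); rewrite ?mulr1 ?mulr0 ?lexx ?M0.
have mst := L2_measurable (adjoint_state_L2 hS p2 (It tI)).
have [chi2 _ chik] := U_L_superlevel hL hV mst.
rewrite (eq_Rintegral_ae (g := fun x => Sigma p * \1_(superlevel mu L (state p t)) x))//.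
  rewrite RintegralZl//; first by rewrite ler_wpM2l.
  exact: L2_integrable.
by apply: filterS At => x Ax _; rewrite /optimal_control Ax.
Qed.

Lemma optimal_control_map : control_map mu T S optimal_control =
  (fun x => - (eps / nrm p) * p x + z x) %[ae mu].
Proof.
have [c2 cP] := control_mapP optimal_control_L2.
have l2 := L2_lin (- (eps / nrm p)) p2 z2.
apply: inner_ext => // q q2; rewrite cP// inner_linl//.
have [H vH] := version q2; rewrite (control_pairingE optimal_control_L2 q2 vH).
have [K _ HK] := state_version_L2; have [H2 _] := HK q H q2 vH.
transitivity (Sigma p * \int[nu]_z (\1_active_set z * H z)); last first.
  by rewrite (optimality q2 vH); ring.
rewrite -RintegralZl//; first by apply: eq_Rintegral => y _; rewrite /optimal_control mulrA.
apply: (le_integrable measurableT _ _ (L2_integrable (L2_abs H2))).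
  apply/measurable_EFinP; apply: measurable_funM; first exact: measurable_indic.
  exact: L2_measurable H2.
move=> y _; rewrite /= lee_fin normr_id normrM ler_piMl// indicE.
by case: (_ \in _); rewrite ?normr1 ?normr0.
Qed.

Lemma optimal_control_ball : closed_ball2 mu eps z (control_map mu T S optimal_control).
Proof.
have [c2 _] := control_mapP optimal_control_L2.
have l2 := L2_lin (- (eps / nrm p)) p2 z2.
split => //; rewrite Lp_norm2E; last exact: L2_sub.
rewrite lee_fin (nrm_ae (g := fun x => - (eps / nrm p) * p x)).
- by rewrite nrmZ// normrN ger0_norm ?mulfVK// divr_ge0 ?nrm_ge0// ltW.
- exact: L2_sub.
- exact: L2_scale.
- by apply: filterS optimal_control_map => x H /H ->; rewrite addrK.
Qed.

Lemma amplitudeE : amplitude mu L T S p = Sigma p.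
Proof.
apply: eq_Rintegral_ae => //; apply: (ae_filter1 time_levelP) => t H tI.
have [_ _ nl] := H tI; have st2 := adjoint_state_L2 hS p2 (It tI).
rewrite (support_value_superlevel hL hV st2 nl) Rintegral_mkcond /Defs.inner.
apply: eq_Rintegral => x _; rewrite patchE indicE.
by case: ifPn => _; rewrite ?mul1r ?mul0r.
Qed.

End optimality.

(** * Weak and strong duality *)

Section duality.
Variable z : X -> R.
Hypotheses (z2 : L2mu z) (z0 : {ae mu, forall x, 0 <= z x}).
Local Notation Sigma := (total_support mu L T S).
Local Notation J := (dual_cost mu L T eps S z).

Lemma weak_duality p u m : 0 <= m -> L2mu p -> L2 nu u ->
  (cost mu L T u <= (2^-1 * m ^+ 2)%:E)%E -> closed_ball2 mu eps z (control_map mu T S u) ->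
  inner z p - eps * nrm p <= m * Sigma p /\
  (m * Sigma p <= inner z p - eps * nrm p -> {ae leb, forall t, Iv t ->
     inner (slice u t) (state p t) = m * sv (state p t)}).
Proof.
move=> m0 p2 u2 uc [c2]; rewrite Lp_norm2E; last exact: L2_sub.
rewrite lee_fin => cz; have [H1 H2] := pairing_le m0 u2 p2 uc.
have [_ cP] := control_mapP u2.
have H3 : inner z p - eps * nrm p <= control_pairing u p.
  rewrite -cP// lerBlDr -lerBlDl -innerBl//.
  apply: (le_trans (inner_le_nrm (L2_sub z2 c2) p2)).
  by rewrite nrm_subC// ler_wpM2r ?nrm_ge0.
split; first exact: le_trans H3 H1.
by move=> H; apply: H2; exact: le_trans H H3.
Qed.

Lemma cost_sqr u (c : R) : (cost mu L T u <= c%:E)%E -> exists m : R,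
  [/\ 0 <= m, (cost mu L T u <= (2^-1 * m ^+ 2)%:E)%E & (2^-1 * m ^+ 2)%:E = cost mu L T u].
Proof.
move=> uc; have u0 := cost_ge0 u.
have uf : cost mu L T u \is a fin_num.
  by rewrite ge0_fin_numE//; apply: le_lt_trans uc (ltry _).
exists (Num.sqrt (2 * fine (cost mu L T u))).
have E : (2^-1 * Num.sqrt (2 * fine (cost mu L T u)) ^+ 2)%:E = cost mu L T u.
  rewrite sqr_sqrtr; last by rewrite mulr_ge0// fine_ge0.
  by rewrite mulrA mulVf// mul1r fineK.
by split; rewrite ?sqrtr_ge0// E.
Qed.

(** The first-order condition along the ray of [z] bounds [|z|^2] by [eps |z|]. When the dual
    minimiser is null, this makes the zero control feasible. *)
Lemma nrm_le_of_dual0 : (forall q, L2mu q -> 0 <= J q) -> nrm z <= eps.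
Proof.
move=> J0; have := @quad_ge0 _ (2^-1 * Sigma z ^+ 2) (- (inner z z - eps * nrm z)) _.
rewrite -sqr_nrm oppr_ge0 subr_le0 expr2 => /(_ _) H.
have [->|n0] := eqVneq (nrm z) 0; first exact: ltW.
rewrite -(ler_pM2r (_ : 0 < nrm z)); last by rewrite lt_neqAle eq_sym n0 nrm_ge0.
apply: H => s s0; have := J0 _ (L2_scale s z2).
rewrite dual_costZ//; last exact: ltW.
rewrite -sqr_nrm expr2 => /le_trans; apply.
by rewrite le_eqVlt; apply/orP; left; apply/eqP; ring.
Qed.

Section minimiser.
Variable p : X -> R.
Hypotheses (p2 : L2mu p) (pmin : forall q, L2mu q -> J p <= J q).

Let M0 : 0 <= Sigma p. Proof. exact: total_support_ge0. Qed.

Let ray : Sigma p ^+ 2 = inner z p - eps * nrm p.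
Proof. exact: minimiser_ray pmin. Qed.

Lemma dual_cost_minimiser : J p = - (2^-1 * Sigma p ^+ 2).
Proof.
move: ray; rewrite /dual_cost; move: (Sigma p ^+ 2) (inner z p) (eps * nrm p) => a b c E.
by rewrite (_ : b = a + c); [field|rewrite E subrK].
Qed.

Lemma primal_ge u : L2 nu u ->
  ((2^-1 * Sigma p ^+ 2)%:E <= primal_functional mu L T eps S z u)%E.
Proof.
move=> u2; rewrite /primal_functional /convex_indicator; case: asboolP => [ub|_]; last first.
  by rewrite addey ?leey// gt_eqF// (@lt_le_trans _ _ 0%E)// cost_ge0.
rewrite adde0 leNgt; apply/negP => uc.
have [m [m0 um mE]] := cost_sqr (ltW uc).
have [H _] := weak_duality m0 p2 u2 um ub.
rewrite -mE lte_fin ltr_pM2l ?invr_gt0// ltr_pXn2r// in uc.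
have Sp : 0 < Sigma p by exact: le_lt_trans uc.
by rewrite -ray expr2 ler_pM2r// leNgt uc in H.
Qed.

Lemma optimal_control_exists :
  (nrm p != 0 -> {ae leb, forall t, Iv t -> forall c, mu [set x | state p t x = c] = 0%E}) ->
  exists u, [/\ L2 nu u, (cost mu L T u <= (2^-1 * Sigma p ^+ 2)%:E)%E,
    closed_ball2 mu eps z (control_map mu T S u),
    (forall v, L2 nu v -> (cost mu L T v <= (2^-1 * Sigma p ^+ 2)%:E)%E ->
      closed_ball2 mu eps z (control_map mu T S v) -> {ae nu, forall y, v y = u y}) &
    {ae leb, forall t, Iv t -> {ae mu, forall x, u (t, x) =
      amplitude mu L T S p * \1_(superlevel mu L (state p t)) x}}].
Proof.
move=> nl; have mneq (v u : R * X -> R) : measurable_fun setT v -> measurable_fun setT u ->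
    measurable [set y | ~ v y = u y].
  move=> mv mu_; have mvu : measurable_fun setT (fun y => v y - u y) by exact: measurable_funB.
  rewrite (_ : [set y | _] = ~` ((fun y => v y - u y) @^-1` [set 0])).
    apply: measurableC; rewrite -[X in measurable X]setTI.
    exact: (mvu measurableT _ (measurable_set1 0)).
  apply/seteqP; split => y /= H /eqP; first by rewrite subr_eq0 => /eqP.
  by move=> /eqP E; apply: H; rewrite E subrr.
(* For a null minimiser the control is 0 and the formula holds with amplitude 0; otherwise [p / |p|]
   makes sense and the Euler equation is available. *)
have [pn0|pn0] := eqVneq (nrm p) 0.
  have S0 : Sigma p = 0.
    have [K K0 HK] := total_support_le hL T0 hS.
    by apply/eqP; rewrite eq_le M0 andbT (le_trans (HK p p2))// pn0 mulr0.
  have J0 q : L2mu q -> 0 <= J q.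
    by move=> /pmin; rewrite dual_cost_minimiser S0 expr0n mulr0 oppr0.
  have z1 := nrm_le_of_dual0 J0.
  have u2 : L2 nu (fun=> 0) by exact: L2_cst0.
  exists (fun=> 0); split => //.
  - apply: cost_le => //; apply: aeW => t tI; split.
      by apply: nearW => x; rewrite lexx M0.
    by rewrite /Rintegral integral0/= mulr_ge0// capacity_ge0.
  - have [c2 cP] := control_mapP u2; split => //; rewrite Lp_norm2E ?lee_fin; last exact: L2_sub.
    rewrite (nrm_ae (g := fun x => - z x)) ?nrmN//; [exact: L2_sub|exact: L2_opp|].
    have c0 : control_map mu T S (fun=> 0) = (fun=> 0) %[ae mu].
      apply: inner_ext => //; first exact: L2_cst0.
      move=> q q2; have [H vH] := version q2.
      by rewrite cP// (control_pairingE u2 q2 vH) !inner0l.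
    by apply: filterS c0 => x H /H ->; rewrite sub0r.
  - move=> v v2 vc _; rewrite S0 in vc.
    have vs := cost_slices (lexx 0) v2 vc.
    apply: ae_cylinder; first by apply: mneq => //; exact: L2_measurable v2.
    apply: (ae_filter1 vs) => t H tI; have [_ v0 _] := H tI.
    by apply: filterS v0 => x; rewrite -eq_le eq_sym => /eqP.
  - have A0 : amplitude mu L T S p = 0.
      transitivity (\int[leb]_(t in Iv) 0); last by rewrite /Rintegral integral0.
      apply: eq_Rintegral => t; rewrite inE => tI.
      have [K K0 HK] := adjoint_state_nrm T hS.
      have st2 := adjoint_state_L2 hS p2 (It tI).
      have /(nrm_eq0 st2) st0 : nrm (state p t) = 0.
        by apply/eqP; rewrite eq_le nrm_ge0 andbT (le_trans (HK p t p2 (It tI)))// pn0 mulr0.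
      have mS : measurable (superlevel mu L (state p t)).
        by apply: measurable_superlevel; exact: L2_measurable st2.
      transitivity (\int[mu]_(x in superlevel mu L (state p t)) 0).
        by apply: eq_Rintegral_ae => //; apply: filterS st0 => x H _; exact: H.
      by rewrite /Rintegral integral0.
    by apply: aeW => t _; apply: nearW => x; rewrite A0 mul0r.
have {}nl := nl pn0; have [G vG] := version p2.
exists (optimal_control p2 pn0 nl G); split.
- exact: optimal_control_L2.
- exact: optimal_control_cost.
- exact: optimal_control_ball.
- move=> v v2 vc vb.
  have M1 : 0 < Sigma p by exact: total_support_minimiser_gt0 pmin pn0.
  have [_ H] := weak_duality M0 p2 v2 vc vb.
  have {}H := H (ltac:(by rewrite -ray expr2)).
  apply: ae_cylinder.
    apply: mneq; first exact: L2_measurable v2.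
    exact: (L2_measurable (optimal_control_L2 p2 pn0 nl vG)).
  have hV := volume_gt0 p2 pn0.
  apply: (ae_filter2 (ae_filter2 H (cost_slices M0 v2 vc) (fun t H1 H2 => conj H1 H2))
    (ae_filter2 (active_setE p2 pn0 nl vG) nl (fun t H1 H2 => conj H1 H2)))
    => t [H1 H2] [H3 H4] tI.
  have [vt2 v01 vk] := H2 tI; have st2 := adjoint_state_L2 hS p2 (It tI).
  (* Divided by the optimal amplitude, a slice of the competitor [v] is admissible and attains the
     support value, so that uniqueness in the bathtub principle identifies it. *)
  have U : U_L mu L (fun x => (Sigma p)^-1 * v (t, x)).
    split; first exact: L2_scale.
    + apply: filterS v01 => x /andP[w0 w1]; rewrite ler_pdivrMl// mulr1 w1 andbT.
      by rewrite mulr_ge0// invr_ge0.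
    + rewrite RintegralZl//; last exact: L2_integrable.
      by rewrite ler_pdivrMl.
  have := bathtub_unique hL hV st2 (H4 tI) U.
  rewrite innerZl// (H1 tI) mulrA mulVf ?gt_eqF// mul1r => /(_ (lexx _)) E.
  apply: filterS2 E (H3 tI) => x E1 E2; rewrite /optimal_control E2 -E1.
  by rewrite mulrA divff ?mul1r// gt_eqF.
- apply: (ae_filter1 (active_setE p2 pn0 nl vG)) => t H tI.
  by apply: filterS (H tI) => x Ax; rewrite /optimal_control Ax (amplitudeE p2 pn0 nl vG).
Qed.

End minimiser.

(** Abstract form, in which regularity of the semigroup enters through jointly measurable versions
    and null level sets of the adjoint states; hypoellipticity and (GUC) serve to supply these. *)
Theorem bang_bang_duality :
  (forall p, L2mu p -> nrm p != 0 ->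
    {ae leb, forall t, Iv t -> forall c, mu [set x | state p t x = c] = 0%E}) ->
  let primal := primal_functional mu L T eps S z in
  let dual := dual_functional mu L T eps S z in
  primal_value mu L T eps S z = dual_value mu L T eps S z /\
  exists pf, [/\ is_minimiser L2mu dual pf,
    (forall q, is_minimiser L2mu dual q -> q = pf %[ae mu]) &
    exists u, [/\ is_minimiser (control_space mu T) primal u,
      (forall v, is_minimiser (control_space mu T) primal v -> v = u %[ae nu]) &
      {ae leb, forall t, Iv t -> {ae mu, forall x, u (t, x) =
        amplitude mu L T S pf * \1_(superlevel mu L (state pf t)) x}}]].
Proof.
move=> nl primal dual.
have [p p2 pmin] := dual_minimiser_exists hL T0 eps0 hS z2 z0.
have dualE q : L2mu q -> dual q = (J q)%:E by move=> q2; exact: dual_functionalE.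
have [u [u2 uc ub uu uf]] := optimal_control_exists p2 pmin (nl p p2).
have uE : primal u = (2^-1 * Sigma p ^+ 2)%:E.
  apply/eqP; rewrite eq_le (primal_ge p2 pmin u2) andbT /primal /primal_functional /convex_indicator.
  by case: asboolP => // _; rewrite adde0.
have umin : is_minimiser (control_space mu T) primal u.
  by split; [exact: u2|move=> v v2; rewrite uE; exact: (primal_ge p2 pmin v2)].
have dmin : is_minimiser L2mu dual p.
  by split; [exact: p2|move=> q q2; rewrite dualE// dualE// lee_fin pmin].
split.
  have -> : primal_value mu L T eps S z = primal u.
    apply/eqP; rewrite eq_le; apply/andP; split.
      by apply: ereal_inf_lbound; exists u.
    by apply: le_ereal_inf_tmp => _ [v v2 <-]; have [_] := umin; apply.
  have -> : dual_value mu L T eps S z = (- dual p)%E.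
    congr (- _)%E; apply/eqP; rewrite eq_le; apply/andP; split.
      by apply: ereal_inf_lbound; exists p.
    by apply: le_ereal_inf_tmp => _ [q q2 <-]; have [_] := dmin; apply.
  by rewrite uE dualE// (dual_cost_minimiser p2 pmin) -EFinN opprK.
exists p; split => //.
  move=> q [q2 qmin]; apply: (dual_minimiser_unique hL T0 eps0 hS z2 z0 p2 q2 pmin).
  by move=> r r2; have := qmin r r2; rewrite !dualE// lee_fin.
exists u; split => // v [v2 vmin].
have := vmin u u2; rewrite uE /primal /primal_functional /convex_indicator.
case: asboolP => [vb|_]; last first.
  by rewrite addey ?leye_eq// gt_eqF// (@lt_le_trans _ _ 0%E)// cost_ge0.
rewrite adde0 => vc; apply: (ae_filter1 (uu v v2 vc vb)) => y vy _; exact: vy.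
Qed.

End duality.

End control_problem.

(** * Versions and null level sets from hypoellipticity *)

Section semigroup_hypoelliptic.
Context (R : realType) (d : nat) (O : set 'rV[R]_d).
Hypotheses (oO : open O) (cO : connected O) (finO : (lebesgue_rV R d O < +oo)%E).
Variables (T : R) (D : set ('rV[R]_d -> R)) (A : ('rV[R]_d -> R) -> ('rV[R]_d -> R)).
Variable S : R -> ('rV[R]_d -> R) -> ('rV[R]_d -> R).
Let mu := lebesgue_on oO finO.
Hypotheses (T0 : 0 < T) (gen : generates mu D A S).
Hypothesis hyp : analytic_hypoelliptic T O mu D A.

Lemma hypoelliptic_state_version q : L2 mu q -> exists G, state_version mu T S q G.
Proof.
move=> q2; have [g [mg _ gq]] := semigroup_analytic T0 gen hyp q2.
exists (fun z => g (T - z.1, z.2)); split.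
  apply: (measurableT_comp mg); apply: measurable_fun_pair; last exact: measurable_snd.
  by apply: measurable_funB => //; exact: measurable_fst.
have := ae_time_reversal T gq => H; apply: (ae_filter1 H) => t Ht; rewrite /= in_itv/= => /andP[t0 tT].
have /Ht : 0 < T - t < T by apply/andP; split; lra.
by apply: filterS => x; exact.
Qed.

Hypothesis guc : GUC mu T S.

Lemma hypoelliptic_null_levels p : L2 mu p -> nrm mu p != 0 ->
  {ae @lebesgue_measure R, forall t, `]0, T[%classic t ->
    forall c, mu [set x | adjoint_state mu T S p t x = c] = 0%E}.
Proof.
move=> p2 pn0; have [g [mg ag gp]] := semigroup_analytic T0 gen hyp p2.
have := ae_time_reversal T gp => H; apply: (ae_filter1 H) => t Ht; rewrite /= in_itv/= => /andP[t0 tT] c.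
have tT' : 0 < T - t < T by apply/andP; split; lra.
have Gt := Ht tT'; set w := adjoint_state mu T S p t.
have [hS _ _] := gen.
have [w2 _] : L2 mu w /\ _ := adjoint_stateP hS p2 (ltac:(by rewrite !ltW) : 0 <= t <= T).
have mgt : measurable_fun setT (fun x => g (T - t, x)).
  exact: (measurableT_comp mg (measurable_pair1 _)).
have mset (f : 'rV[R]_d -> R) : measurable_fun setT f -> measurable [set x | f x = c].
  by move=> mf; rewrite -[X in measurable X]setTI; exact: (mf measurableT _ (measurable_set1 c)).
apply/eqP/negPn/negP => wc; move/eqP: pn0; apply.
apply/(nrm_eq0 p2); apply: guc => //; exists (T - t); split => //; exists c.
(* [mu] is Lebesgue measure on [O], and the state agrees with [g] almost everywhere; positivity of
   the level set thus passes to [g], to which the identity theorem applies. *)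
have gc : lebesgue_rV R d (O `&` [set x | g (T - t, x) = c]) != 0%E.
  apply: contra wc => /eqP gc; apply/eqP.
  have g0 : {ae mu, forall x, g (T - t, x) <> c}.
    exists [set x | g (T - t, x) = c]; split; first exact: mset.
      by rewrite /mu /lebesgue_on /= /mfrestr /mrestr setIC gc.
    by move=> x /= /contrapT.
  have [N [mN N0 sN]] : {ae mu, forall x, w x <> c}.
    by apply: (ae_filter2 Gt g0) => x wg gx; rewrite (_ : w x = g (T - t, x))//; exact: wg.
  apply: (@subset_measure0 _ _ _ mu _ N _ mN _ N0); first by apply: mset; exact: L2_measurable w2.
  by move=> x wx; apply: sN => /=; exact.
have gE := line_analytic_identity oO cO mgt (space_analytic_line ag tT') gc.
have HO : {ae mu, forall x, O x}.
  by apply/(@ae_mrestr _ _ _ (lebesgue_rV R d) O (open_measurable_rV oO)); exact: aeW.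
by apply: (ae_filter2 Gt HO) => x wg Ox _; rewrite wg// gE.
Qed.

End semigroup_hypoelliptic.

Theorem theorem3p1 (R : realType) (d : nat) (O : set 'rV[R]_d)
    (oO : open O) (cO : connected O) (finO : (lebesgue_rV R d O < +oo)%E)
    (L T eps : R) (hL : 0 < L < 1) (hT : 0 < T) (heps : 0 < eps)
    (D : set ('rV[R]_d -> R)) (A : ('rV[R]_d -> R) -> ('rV[R]_d -> R))
    (S : R -> ('rV[R]_d -> R) -> ('rV[R]_d -> R)) (y0 yf : 'rV[R]_d -> R) :
  let mu := lebesgue_on oO finO in
  generates mu D A S ->
  L2 mu y0 -> L2 mu yf ->
  {ae mu, forall x, S T y0 x <= yf x} ->
  GUC mu T S ->
  analytic_hypoelliptic T O mu D A ->
  let z := fun x => yf x - S T y0 x in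
  let primal := primal_functional mu L T eps S z in
  let dual := dual_functional mu L T eps S z in
  primal_value mu L T eps S z = dual_value mu L T eps S z /\
  exists pf : 'rV[R]_d -> R,
    [/\ is_minimiser (L2 mu) dual pf,
        (forall q, is_minimiser (L2 mu) dual q -> q = pf %[ae mu]) &
        exists u : R * 'rV[R]_d -> R,
          [/\ is_minimiser (control_space mu T) primal u,
              (forall v, is_minimiser (control_space mu T) primal v ->
                v = u %[ae cylinder_measure mu T]) &
              {ae lebesgue_measure, forall t, 0 < t < T ->
                {ae mu, forall x, u (t, x) = amplitude mu L T S pf *
                  \1_(superlevel mu L (adjoint_state mu T S pf t)) x}}]].
Proof.
move=> mu gen y02 yf2 yfy0 guc hyp z primal dual; have [hS _ _] := gen.
have Sy2 : L2 mu (S T y0) by apply: (semigroup_L2 hS) => //; exact: ltW.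
have z2 : L2 mu z by exact: L2_sub.
have z0 : {ae mu, forall x, 0 <= z x} by apply: filterS yfy0 => x; rewrite subr_ge0.
have [|pd [p [pmin puniq [u [umin uuniq uE]]]]] := bang_bang_duality hL hT heps hS
  (hypoelliptic_state_version hT gen hyp) z2 z0.
  exact: (hypoelliptic_null_levels cO hT gen hyp guc).
by split => //; exists p; split => //; exists u; split.
Qed.
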